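(* Let $p(\cdot)\in\mathcal{P}(\mathbb{R}^n)$ be an exponent function such that $p(\cdot)\in LH(\mathbb{R}^n)$ and $1<p_-\le p_+<n$. Then there exists a constant $C>0$ such that for all $f\in C_0^\infty(\mathbb{R}^n)$, $$\left\|\frac{f}{|\cdot|}\right\|_{L^{p(\cdot)}(\mathbb{R}^n)}\le C\,\|\nabla f\|_{L^{p(\cdot)}(\mathbb{R}^n)},$$ where $C$ is independent of $f$.
   Context: $\mathcal{P}(\mathbb{R}^n)$ is the set of Lebesgue measurable functions $p(\cdot):\mathbb{R}^n\to[1,\infty]$ (exponent functions); $p_-=\operatorname{ess\,inf}_{x\in\mathbb{R}^n}p(x)$ and $p_+=\operatorname{ess\,sup}_{x\in\mathbb{R}^n}p(x)$. $p(\cdot)\in LH(\mathbb{R}^n)$ (log-H\''older continuity) means: there is a constant $C_0$ with $|p(x)-p(y)|\le \frac{C_0}{-\log|x-y|}$ for all $x,y$ with $|x-y|<\frac12$, and there are constants $C_\infty$, $p_\infty$ with $|p(x)-p_\infty|\le\frac{C_\infty}{\log(e+|x|)}$ for all $x$. When $p_+<\infty$, $\|g\|_{L^{p(\cdot)}(\mathbb{R}^n)}=\inf\{\lambda>0:\int_{\mathbb{R}^n}(|g(x)|/\lambda)^{p(x)}\,dx\le1\}$ for measurable $g$, with value $\infty$ if the set is empty. For vector-valued $g$, $|g|$ is the Euclidean norm. $|\cdot|$ denotes the function $x\mapsto|x|$. $C_0^\infty(\mathbb{R}^n)$ is the set of compactly supported smooth functions. *)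

(* Defs.v *)
From HB Require Import structures.
From mathcomp Require Import all_boot all_order all_algebra.
From mathcomp Require Import all_classical all_reals all_analysis.
From mathcomp Require Import measurable_realfun ess_sup_inf.

Set Implicit Arguments.
Unset Strict Implicit.
Unset Printing Implicit Defensive.

Import Order.TTheory GRing.Theory Num.Theory.
Import numFieldNormedType.Exports.

Local Open Scope classical_set_scope.
Local Open Scope ring_scope.

Section lebesgue_outer.
Context (R : realType) (n : nat).
Implicit Types (ab : 'rV[R]_n * 'rV[R]_n) (A : set 'rV[R]_n).

Definition box ab : set 'rV[R]_n :=
  [set x | forall i, ab.1 ord0 i < x ord0 i <= ab.2 ord0 i].

Definition box_volume ab : \bar R :=
  (\prod_(i < n) Num.max 0 (ab.2 ord0 i - ab.1 ord0 i))%:E.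

(* Covers are countable families of boxes, possibly finite or empty. Sequences
   of boxes would not do for n = 0, where every box has volume 1. *)
Definition box_cover A : set (set ('rV[R]_n * 'rV[R]_n)) :=
  [set S | countable S /\ A `<=` \bigcup_(ab in S) box ab].

Definition lebesgue_outer A : \bar R :=
  ereal_inf [set \esum_(ab in S) box_volume ab | S in box_cover A].

Local Open Scope ereal_scope.

Lemma box_volume_ge0 ab : 0 <= box_volume ab.
Proof.
by rewrite lee_fin; apply: prodr_ge0 => i _; rewrite le_max lexx.
Qed.

Lemma lebesgue_outer_ge0 A : 0 <= lebesgue_outer A.
Proof.
apply: le_ereal_inf_tmp => _ [S _ <-].
by apply: esum_ge0 => ab _; exact: box_volume_ge0.
Qed.

Lemma lebesgue_outer0 : lebesgue_outer set0 = 0.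
Proof.
apply/eqP; rewrite eq_le lebesgue_outer_ge0 andbT.
by apply: ereal_inf_lbound; exists set0; [split | rewrite esum_set0].
Qed.

Lemma le_lebesgue_outer : {homo lebesgue_outer : A B / A `<=` B >-> A <= B}.
Proof.
move=> A B AB; apply: ereal_inf_le_tmp => _ [S [cS BS] <-].
by exists S => //; split => //; exact: subset_trans BS.
Qed.

Lemma esum_bigcup_le (S : (set ('rV[R]_n * 'rV[R]_n))^nat) :
  \esum_(ab in \bigcup_k S k) box_volume ab <=
  \sum_(k <oo) \esum_(ab in S k) box_volume ab.
Proof.
rewrite seqDU_bigcup_eq esum_bigcupT; last 2 first.
- exact: trivIset_seqDU.
- by move=> ab; exact: box_volume_ge0.
rewrite -nneseries_esumT; last first.
  by move=> k; apply: esum_ge0 => ab _; exact: box_volume_ge0.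
apply: lee_nneseries => [k _ _|k _].
  by apply: esum_ge0 => ab _; exact: box_volume_ge0.
apply: ereal_sup_le => _ [X [fX XS] <-]; exists X => //.
by split => //; exact: (subset_trans XS (@subset_seqDU _ _ _)).
Qed.

Lemma lebesgue_outer_sigma_subadditive : sigma_subadditive lebesgue_outer.
Proof.
move=> A; have [[i ioo]|] := pselect (exists i, lebesgue_outer (A i) = +oo).
  rewrite (eseries_pinfty _ _ ioo) ?leey// => k _.
  by rewrite -ltNye (lt_le_trans _ (lebesgue_outer_ge0 _)).
rewrite -forallNE => Aoo.
apply/lee_addgt0Pr => _/posnumP[e].
rewrite (le_trans _ (epsilon_trick _ _ _))//; last first.
  by move=> k; exact: lebesgue_outer_ge0.
pose P k S := box_cover (A k) S /\
  \esum_(ab in S) box_volume ab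
    <= lebesgue_outer (A k) + (e%:num / (2 ^ k.+1)%:R)%:E.
have [G PG] : {G : (set ('rV[R]_n * 'rV[R]_n))^nat & forall k, P k (G k)}.
  apply: (@choice _ _ P) => k; rewrite /P.
  have fA : lebesgue_outer (A k) \is a fin_num.
    rewrite fin_numE -ltNye (lt_le_trans _ (lebesgue_outer_ge0 _))//=.
    exact/eqP/Aoo.
  have e0 : (0 < e%:num / (2 ^ k.+1)%:R)%R by [].
  have [_ [S cS <-] SA] := lb_ereal_inf_adherent e0 fA.
  by exists S; split => //; exact: ltW.
apply: (@le_trans _ _ (\esum_(ab in \bigcup_k G k) box_volume ab)).
  apply: ereal_inf_lbound; exists (\bigcup_k G k) => //; split.
    by apply: bigcup_countable => // k _; exact: (PG k).1.1.
  move=> x [k _ /((PG k).1.2)] [ab Gab xab].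
  by exists ab => //; exists k.
apply: (le_trans (esum_bigcup_le G)).
apply: lee_nneseries => [k _ _|k _]; last exact: (PG k).2.
by apply: esum_ge0 => ab _; exact: box_volume_ge0.
Qed.

HB.instance Definition _ := isOuterMeasure.Build R 'rV[R]_n lebesgue_outer
  lebesgue_outer0 lebesgue_outer_ge0 le_lebesgue_outer
  lebesgue_outer_sigma_subadditive.

End lebesgue_outer.

(* R^n carrying the sigma-algebra of Lebesgue measurable sets. *)
Definition Rn (R : realType) (n : nat) := caratheodory_type (@lebesgue_outer R n).

HB.instance Definition _ (R : realType) (n : nat) := Measurable.on (Rn R n).

Definition lebesgue_Rn (R : realType) (n : nat) (A : set (Rn R n)) : \bar R :=
  lebesgue_outer A.

HB.instance Definition _ (R : realType) (n : nat) :=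
  isMeasure.Build (caratheodory_display (@lebesgue_outer R n)) (Rn R n) R
    (@lebesgue_Rn R n)
    (@caratheodory_measure0 R _ (@lebesgue_outer R n))
    (@caratheodory_measure_ge0 R _ (@lebesgue_outer R n))
    (@caratheodory_measure_sigma_additive R _ (@lebesgue_outer R n)).

Section variable_exponent.
Context (R : realType) (n : nat).
Implicit Types (p : 'rV[R]_n -> \bar R) (f g : 'rV[R]_n -> R).

(* The library norm on 'rV[R]_n is the sup norm. *)
Definition enorm (x : 'rV[R]_n) : R := Num.sqrt (\sum_(i < n) x ord0 i ^+ 2).

Definition exponent p : Prop :=
  measurable_fun [set: Rn R n] (p : Rn R n -> \bar R) /\
  (forall x, (1 <= p x)%E).

Definition exponent_inf p : \bar R := ess_inf (@lebesgue_Rn R n) p.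
Definition exponent_sup p : \bar R := ess_sup (@lebesgue_Rn R n) p.

(* For x = y the first estimate reads 0 <= C0 / +oo, hence 0 < enorm (x - y).
   The second one makes p finite everywhere, +oo - pinf being +oo. *)
Definition log_holder p : Prop :=
  (exists C0 : R, forall x y : 'rV[R]_n, 0 < enorm (x - y) < 2^-1 ->
     (`|p x - p y| <= (C0 / - ln (enorm (x - y)))%:E)%E) /\
  (exists Cinf pinf : R, forall x : 'rV[R]_n,
     (`|p x - pinf%:E| <= (Cinf / ln (expR 1 + enorm x))%:E)%E).

(* Meant for exponent_sup p < +oo: then p = +oo only on a null set, where the
   junk value of fine is harmless. The infimum of the empty set is +oo. *)
Definition vLnorm p g : \bar R :=
  ereal_inf [set l%:E | l in [set l : R | 0 < l /\
    (\int[@lebesgue_Rn R n]_x ((`|g x| / l) `^ fine (p x))%:E <= 1)%E]].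

Definition partial (i : 'I_n) f : 'rV[R]_n -> R :=
  fun x => 'D_(delta_mx ord0 i) f x.

(* f is C^oo when all its iterated partial derivatives, in any order, exist
   and are continuous. *)
Definition smooth f : Prop := forall s : seq 'I_n,
  continuous (foldr partial f s) /\
  forall (i : 'I_n) (x : 'rV[R]_n),
    derivable (foldr partial f s) x (delta_mx ord0 i).

Definition smooth_compactly_supported f : Prop :=
  smooth f /\ compact (closure [set x | f x != 0]).

Definition gradient f (x : 'rV[R]_n) : 'rV[R]_n := \row_(i < n) partial i f x.

End variable_exponent.

(* Main.v *)
Require Import Defs.
From mathcomp Require Import all_boot all_order all_algebra.
From mathcomp Require Import all_classical all_reals all_analysis.
From mathcomp Require Import measurable_realfun ess_sup_inf.
From mathcomp Require Import ring lra zify.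

(** Let C_k be the cube ]-2^k, 2^k]^n and Q_j(x) the dyadic cube of side 2^j that
    contains x. For x in the shell C_(k+1) \ C_k,

      |f(x)| <= K 2^k (sum_m 2^(-m) A_m + sum_m 2^m B_m),    m = 0, 1, 2, ...

    where A_m is the average of |grad f| over Q_(k-m)(x) and B_m its average over
    C_(k+m+2) \ C_(k+m): f(x) is the limit of the averages of f over the cubes
    that shrink to x, these averages vanish far away from the support, and the
    averages of f over two neighbouring boxes differ by at most a multiple of
    their size times an average of |grad f| over their hull
    (pointwise_representation). As |x| is at least 2^k in the shell, this bounds
    f / |x| by averages of |grad f|.

    Suppose that an exponent q and a function phi satisfy the mean inequality
    (av_E phi)^(q x) <= K av_E (phi^q) for all the sets E above. When q is at most
    P < n, convexity bounds the power q x of the sum by averages of phi^q with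
    weights 2^(-m) and rho^m, for some rho < 2^n (hardy_pointwise). For fixed m
    the cubes Q_(k-m)(x) form a partition, and the shell k occupies a fraction of
    order 2^(-mn) of the shell k + m; hence the integral of these averages is at
    most a constant times the integral of phi^q (integral_hardy_majorant). No
    maximal function is involved.

    By homogeneity the integral of |grad f|^p may be assumed to be at most 1. Cut
    |grad f| at height 1. The part with values in {0} U [1, oo[ satisfies the mean
    inequality for p itself: log-Hoelder continuity makes the change of the
    exponent from p(y) to p(x) harmless for averages that are at most an inverse
    volume (power_mean_variable). The part with values in [0, 1] is treated with
    two constant exponents, the essential supremum P of p and the exponent p_oo at
    infinity, for which the mean inequality is Jensen's. The decay condition
    compares t^p and t^p_oo for t in [0, 1] up to the integrable error
    (e + |x|)^(-n-1) (decay_compare), and t^p <= t^P for t >= 1; so integrability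
    passes from p to P and p_oo before the Hardy estimate, and back to p after it
    (power_split_bound, modular_hardy).

    Of the measure one needs that boxes are measurable, that it is invariant under
    translations, and that a unit cube has measure c with 0 < c < oo. Positivity is
    a consequence of the hypotheses, since on a null space the essential supremum
    of p would be -oo. *)

Set Implicit Arguments.
Unset Strict Implicit.
Unset Printing Implicit Defensive.

Import Order.TTheory GRing.Theory Num.Theory.
Import numFieldNormedType.Exports.

Local Open Scope classical_set_scope.
Local Open Scope ring_scope.


(** * Boxes and the measure of R^n *)

Section box_geometry.
Context (R : realType) (n : nat).
Implicit Types (a b x v : 'rV[R]_n) (i : 'I_n) (A X : set 'rV[R]_n).

Definition upd a i (t : R) : 'rV[R]_n :=
  \row_j (if j == i then t else a ord0 j).

Lemma upd_eq a i t : upd a i t ord0 i = t.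
Proof. by rewrite mxE eqxx. Qed.

Lemma upd_neq a i j t : j != i -> upd a i t ord0 j = a ord0 j.
Proof. by rewrite mxE => /negbTE ->. Qed.

Lemma box_low a b i t :
  box (a, b) `&` [set x | x ord0 i <= t] =
  box (a, upd b i (Num.min (b ord0 i) t)).
Proof.
apply/seteqP; split => x /=.
  move=> [bx xt] j; have [->|ji] := eqVneq j i.
    by rewrite upd_eq le_min xt andbT; exact: bx.
  by rewrite upd_neq//; exact: bx.
move=> bx; split.
  move=> j; have [->|ji] := eqVneq j i.
    by have := bx i; rewrite upd_eq le_min => /andP[-> /andP[->]].
  by have := bx j; rewrite upd_neq.
by have := bx i; rewrite upd_eq le_min => /andP[_ /andP[_]].
Qed.

Lemma box_high a b i t :
  box (a, b) `&` ~` [set x | x ord0 i <= t] =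
  box (upd a i (Num.max (a ord0 i) t), b).
Proof.
apply/seteqP; split => x /=.
  move=> [bx /negP]; rewrite -ltNge => xt j; have [->|ji] := eqVneq j i.
    by rewrite upd_eq gt_max xt andbT; exact: bx.
  by rewrite upd_neq//; exact: bx.
move=> bx; split.
  move=> j; have [->|ji] := eqVneq j i.
    by have := bx i; rewrite upd_eq gt_max => /andP[/andP[-> _] ->].
  by have := bx j; rewrite upd_neq.
by apply/negP; rewrite -ltNge; have := bx i; rewrite upd_eq gt_max => /andP[/andP[]].
Qed.

Lemma box_volume_split a b i t :
  (box_volume (a, upd b i (Num.min (b ord0 i) t)) +
   box_volume (upd a i (Num.max (a ord0 i) t), b) = box_volume (a, b))%E.
Proof.
rewrite /box_volume -EFinD; congr EFin => /=.
rewrite (bigD1 i)//= [X in _ + X](bigD1 i)//= [RHS](bigD1 i)//=.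
rewrite !upd_eq.
under eq_bigr => j ji do rewrite upd_neq//.
under [X in _ + _ * X]eq_bigr => j ji do rewrite upd_neq//.
rewrite -mulrDl; congr (_ * _).
move: (a ord0 i) (b ord0 i) => u w.
rewrite /Num.max /Num.min.
by case: ifPn; case: ifPn; case: ifPn; case: ifPn; case: ifPn; lra.
Qed.

Lemma outer_box_le (ab : 'rV[R]_n * 'rV[R]_n) : (lebesgue_outer (box ab) <= box_volume ab)%E.
Proof.
apply: ereal_inf_lbound; exists [set ab].
  split; first exact: countable1.
  by move=> x bx; exists ab.
by rewrite esum_set1// box_volume_ge0.
Qed.

(** Covers are indexed by sets of boxes and distinct boxes may have the same
    image under F, so that the images need not form a cover with the same sum;
    an injection of the index set into nat reduces this to sequences. *)
Lemma outer_bigcup_le (S : set ('rV[R]_n * 'rV[R]_n))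
    (F : 'rV[R]_n * 'rV[R]_n -> set 'rV[R]_n) : countable S ->
  (lebesgue_outer (\bigcup_(ab in S) F ab) <=
   \esum_(ab in S) lebesgue_outer (F ab))%E.
Proof.
move=> /countable_injP[f finj].
pose h k := \bigcup_(ab in [set ab | S ab /\ f ab = k]) F ab.
apply: (@le_trans _ _ (lebesgue_outer (\bigcup_k h k))).
  apply: le_lebesgue_outer => x [ab Sab Fx].
  by exists (f ab) => //; exists ab.
apply: (le_trans (lebesgue_outer_sigma_subadditive h)).
rewrite nneseries_esumT; last by move=> k; exact: lebesgue_outer_ge0.
have hE ab : S ab -> h (f ab) = F ab.
  move=> Sab; apply/seteqP; split => [x [cd [Scd fcd] Fx]|x Fx]; last by exists ab.
  by have <- : cd = ab by apply: finj; rewrite ?inE.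
have -> : (\esum_(ab in S) lebesgue_outer (F ab) =
           \esum_(ab in S) lebesgue_outer (h (f ab)))%E.
  by apply: eq_esum => ab Sab; rewrite hE.
rewrite -(esum_image S f (fun k => lebesgue_outer (h k)))//.
rewrite [leRHS]esum_mkcond; apply: le_esum => k _; case: ifPn => //.
rewrite notin_setE => Sk; rewrite (_ : h k = set0) ?lebesgue_outer0//.
by apply/seteqP; split => // x [ab [Sab fk] _]; apply: Sk; exists ab.
Qed.

(** A cover translates to a cover by boxes of the same volumes. *)
Lemma outer_shift_le v A :
  (lebesgue_outer ((fun x => x + v)%R @^-1` A) <= lebesgue_outer A)%E.
Proof.
apply: le_ereal_inf_tmp => _ [S [cS AS] <-].
pose F (ab : 'rV[R]_n * 'rV[R]_n) := box (ab.1 - v, ab.2 - v).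
apply: (@le_trans _ _ (lebesgue_outer (\bigcup_(ab in S) F ab))).
  apply: le_lebesgue_outer => x /= /AS[ab Sab bx]; exists ab => // i.
  by have := bx i; rewrite /= !mxE; lra.
apply: (le_trans (outer_bigcup_le F cS)); apply: le_esum => ab _.
apply: (le_trans (outer_box_le _)); rewrite lee_fin le_eqVlt; apply/orP; left.
by apply/eqP; apply: eq_bigr => i _; rewrite /= !mxE; congr (Num.max _ _); lra.
Qed.

Lemma outer_shift v A :
  lebesgue_outer ((fun x => x + v) @^-1` A) = lebesgue_outer A.
Proof.
apply/eqP; rewrite eq_le outer_shift_le/=.
rewrite [leLHS](_ : _ = lebesgue_outer
  ((fun x => x - v) @^-1` ((fun x => x + v) @^-1` A))) ?outer_shift_le//.
by rewrite -comp_preimage; congr lebesgue_outer;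
   apply/seteqP; split => x /=; rewrite ?subrK.
Qed.

End box_geometry.

Section lebesgue_Rn_basics.
Context (R : realType) (n : nat).
Local Notation mu := (@lebesgue_Rn R n).
Local Notation T := (Rn R n).
Implicit Types (a b x v : 'rV[R]_n) (i : 'I_n).

(** The hyperplane cuts each box of a cover into two boxes whose volumes add up,
    so a cover of X yields covers of the two parts of X of the same total volume. *)
Lemma measurable_half i (t : R) : measurable ([set x | x ord0 i <= t] : set T).
Proof.
apply: le_caratheodory_measurable => X.
apply: le_ereal_inf_tmp => _ [S [cS XS] <-].
pose lo (ab : 'rV[R]_n * 'rV[R]_n) := (ab.1, upd ab.2 i (Num.min (ab.2 ord0 i) t)).
pose hi (ab : 'rV[R]_n * 'rV[R]_n) := (upd ab.1 i (Num.max (ab.1 ord0 i) t), ab.2).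
rewrite [leRHS](_ : _ =
    \esum_(ab in S) (box_volume (lo ab) + box_volume (hi ab)))%E; last first.
  by apply: eq_esum => -[a b] _; rewrite box_volume_split.
rewrite esumD; [|by move=> *; exact: box_volume_ge0..].
apply: leeD.
  apply: (@le_trans _ _ (lebesgue_outer (\bigcup_(ab in S) box (lo ab)))).
    apply: le_lebesgue_outer => x [/XS[[a b] Sab bx] xt]; exists (a, b) => //.
    by rewrite /lo/= -box_low.
  apply: (le_trans (outer_bigcup_le _ cS)); apply: le_esum => ab _.
  exact: outer_box_le.
apply: (@le_trans _ _ (lebesgue_outer (\bigcup_(ab in S) box (hi ab)))).
  apply: le_lebesgue_outer => x [/XS[[a b] Sab bx] xt]; exists (a, b) => //.
  by rewrite /hi/= -box_high.
apply: (le_trans (outer_bigcup_le _ cS)); apply: le_esum => ab _.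
exact: outer_box_le.
Qed.

Lemma measurable_box (ab : 'rV[R]_n * 'rV[R]_n) : measurable (box ab : set T).
Proof.
rewrite (_ : box ab = \big[setI/setT]_(i < n)
   (~` [set x : T | x ord0 i <= ab.1 ord0 i] `&` [set x : T | x ord0 i <= ab.2 ord0 i])).
  apply: bigsetI_measurable => i _; apply: measurableI; last exact: measurable_half.
  by apply: measurableC; exact: measurable_half.
rewrite -bigcap_seq; apply/seteqP; split => x /=.
  move=> bx i _ /=; split; last by have /andP[] := bx i.
  by apply/negP; rewrite -ltNge; have /andP[] := bx i.
move=> bx i; have [|/negP xa xb] := bx i; first by rewrite /= mem_index_enum.
by rewrite ltNge xa.
Qed.

Lemma mu_box_lty (ab : 'rV[R]_n * 'rV[R]_n) : (mu (box ab) < +oo)%E.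
Proof. by apply: (le_lt_trans (outer_box_le ab)); rewrite ltry. Qed.

Lemma mu_shift v (A : set T) : mu ((fun x => x + v) @^-1` A) = mu A.
Proof. exact: outer_shift. Qed.

Lemma measurable_shift v : measurable_fun setT ((fun x => x + v) : T -> T).
Proof.
move=> _ A mA; rewrite setTI.
have {}mA : (@lebesgue_outer R n).-caratheodory A by [].
suff : (@lebesgue_outer R n).-caratheodory ((fun x => x + v) @^-1` A) by [].
move=> X; pose Y := (fun x => x - v) @^-1` X.
have -> : X = (fun x => x + v) @^-1` Y.
  by rewrite /Y -comp_preimage; apply/seteqP; split => x /=; rewrite ?addrK.
have /= := mA Y; rewrite -(outer_shift v Y) -(outer_shift v (Y `&` A)).
by rewrite -(outer_shift v (Y `&` ~` A)).
Qed.

Lemma mu_box_shift v a b : mu (box (a + v, b + v)) = mu (box (a, b)).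
Proof.
rewrite -(mu_shift v); congr (lebesgue_outer _).
by apply/seteqP; split => x /= bx i; have := bx i; rewrite /= !mxE; lra.
Qed.

Local Open Scope ereal_scope.

Lemma ge0_integral_shift v (A : set T) (f : T -> \bar R) :
  measurable A -> measurable_fun A f -> (forall x, 0 <= f x) ->
  \int[mu]_(x in (fun x => x + v)%R @^-1` A) f (x + v)%R = \int[mu]_(x in A) f x.
Proof.
move=> mA mf f0.
pose ms := @measurable_shift v.
transitivity (\int[pushforward mu (fun x : T => (x + v)%R : T)]_(x in A) f x).
  by symmetry; exact: (ge0_integral_pushforward ms mu mA mf (fun x _ => f0 x)).
apply: (@eq_measure_integral _ _ _ A mu (pushforward mu (fun x : T => (x + v)%R : T)) f) => B mB BA.
exact: mu_shift.
Qed.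

End lebesgue_Rn_basics.

(** * Averages over boxes *)

Section box_average.
Context (R : realType) (n : nat).
Local Notation mu := (@lebesgue_Rn R n).
Local Notation T := (Rn R n).
Implicit Types (a b x v : 'rV[R]_n) (i : 'I_n) (f g : T -> R).

Definition vol a b : R := fine (mu (box (a, b))).

Definition unitv i : 'rV[R]_n := delta_mx ord0 i.

Lemma mu_boxE a b : mu (box (a, b)) = (vol a b)%:E.
Proof. by rewrite /vol fineK// ge0_fin_numE ?mu_box_lty. Qed.

Lemma vol_ge0 a b : 0 <= vol a b.
Proof. exact: fine_ge0. Qed.

Lemma vol_shift v a b : vol (a + v) (b + v) = vol a b.
Proof. by rewrite /vol mu_box_shift. Qed.

Lemma upd_shift a i t : upd a i t = a + (t - a ord0 i) *: unitv i.
Proof.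
apply/rowP => j; rewrite !mxE eqxx/=; case: eqVneq => [->|]; rewrite ?mulr1 ?mulr0 ?addr0//.
by rewrite addrC subrK.
Qed.

Lemma box_halfU a b i : a ord0 i <= b ord0 i ->
  let m := (a ord0 i + b ord0 i) / 2 in
  box (a, b) = box (a, upd b i m) `|` box (upd a i m, b) /\
  [disjoint box (a, upd b i m) & box (upd a i m, b)].
Proof.
move=> ab m; have am : a ord0 i <= m by rewrite /m; lra.
have mb : m <= b ord0 i by rewrite /m; lra.
have := box_low a b i m; have := box_high a b i m.
rewrite (max_idPr am) (min_idPr mb) => <- <-.
split; first by rewrite -setIUr setUv setIT.
by apply/eqP; rewrite setIACA setICr setI0.
Qed.

Lemma upper_half_shift a b i (m := (a ord0 i + b ord0 i) / 2)
    (h := (b ord0 i - a ord0 i) / 2) :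
  (upd a i m, b) = (a + h *: unitv i, upd b i m + h *: unitv i).
Proof.
congr (_, _); first by rewrite upd_shift; congr (_ + _ *: _); rewrite /m /h; lra.
by rewrite upd_shift -addrA -scalerDl (_ : _ + h = 0) ?scale0r ?addr0// /m /h; lra.
Qed.

(** The two halves are translates of each other. *)
Lemma vol_half a b i (m := (a ord0 i + b ord0 i) / 2) : a ord0 i <= b ord0 i ->
  vol a b = 2 * vol a (upd b i m) /\ vol (upd a i m) b = vol a (upd b i m).
Proof.
move=> ab; have [E1 E2] := box_halfU ab.
have E3 : vol (upd a i m) b = vol a (upd b i m).
  have := upper_half_shift a b i; rewrite -/m => -[F1 F2].
  by rewrite -[RHS](vol_shift (((b ord0 i - a ord0 i) / 2) *: unitv i)) -F1 -F2.
split => //; rewrite mulr_natl mulr2n -[X in _ = _ + X]E3.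
apply: EFin_inj; rewrite EFinD -!mu_boxE E1 measureU//; [exact: measurable_box..|].
exact/eqP.
Qed.

Lemma bounded_integrable (A : set T) f (B : R) : measurable A ->
  (mu A < +oo)%E -> measurable_fun setT f -> (forall x, `|f x| <= B) ->
  mu.-integrable A (EFin \o f).
Proof.
move=> mA Afin mf fB; apply: measurable_bounded_integrable => //.
  exact: measurable_funTS.
exists B; split; first exact: num_real.
by move=> M BM x _; apply: (le_trans (fB x)); exact: ltW.
Qed.

Lemma box_integrable a b f (B : R) : measurable_fun setT f ->
  (forall x, `|f x| <= B) -> mu.-integrable (box (a, b)) (EFin \o f).
Proof.
by move=> mf fB; apply: bounded_integrable fB => //;
   [exact: measurable_box | exact: mu_box_lty].
Qed.

Lemma shift_measurable v f : measurable_fun setT f ->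
  measurable_fun setT (fun x : T => f (x + v)).
Proof. by move=> mf; apply: (measurableT_comp mf); exact: measurable_shift. Qed.

Lemma Rintegral_box_shift v a b f (B : R) : measurable_fun setT f ->
  (forall x, `|f x| <= B) ->
  \int[mu]_(x in box (a + v, b + v)) f x = \int[mu]_(x in box (a, b)) f (x + v).
Proof.
move=> mf fB.
(* f + B is nonnegative, and the integrals of the constant B agree *)
have cstB a' b' : mu.-integrable (box (a', b')) (EFin \o fun=> B).
  exact: (@box_integrable _ _ _ `|B| (measurable_cst B) (fun=> lexx _)).
have := @ge0_integral_shift _ _ v (box (a + v, b + v)) (fun x => (f x + B)%:E)
   (measurable_box _).
have -> : (fun x => x + v) @^-1` box (a + v, b + v) = box (a, b).
  by apply/seteqP; split => x /= bx i; have := bx i; rewrite /= !mxE; lra.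
have -> : (\int[mu]_(x in box (a, b)) (f (x + v)%R + B)%:E =
          (\int[mu]_(x in box (a, b)) f (x + v)%R + B * vol a b)%:E)%E.
  rewrite -(Rintegral_cst mu (measurable_box (a, b))) -RintegralD//; first last.
  - exact: (box_integrable _ _ (shift_measurable v mf) (fun x => fB (x + v))).
  - exact: measurable_box.
  rewrite /Rintegral fineK//; apply: integrable_fin_num; first exact: measurable_box.
  apply: (@box_integrable _ _ _ (B + `|B|)).
    by apply: measurable_funD; [exact: shift_measurable | exact: measurable_cst].
  by move=> x; rewrite (le_trans (ler_normD _ _))// lerD.
have -> : (\int[mu]_(x in box ((a + v)%R, (b + v)%R)) (f x + B)%:E =
          (\int[mu]_(x in box (a + v, b + v)) f x + B * vol a b)%:E)%E.
  rewrite -(vol_shift v a b).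
  rewrite -(Rintegral_cst mu (measurable_box (a + v, b + v))) -RintegralD//; first last.
  - exact: (@box_integrable _ _ _ B).
  - exact: measurable_box.
  rewrite /Rintegral fineK//; apply: integrable_fin_num; first exact: measurable_box.
  apply: (@box_integrable _ _ _ (B + `|B|)).
    by apply: measurable_funD; [exact: mf | exact: measurable_cst].
  by move=> x; rewrite (le_trans (ler_normD _ _))// lerD.
move=> H; apply: (@addIr _ (B * vol a b)); apply: EFin_inj; apply/esym/H.
  by apply: measurable_funTS; apply/measurable_EFinP; apply: measurable_funD;
    [exact: mf | exact: measurable_cst].
by move=> x; rewrite lee_fin; have := fB x; rewrite ler_norml; lra.
Qed.

End box_average.

(** * A Poincare inequality along coordinate directions *)

Section slope.
Context (R : realType) (n : nat).
Local Notation mu := (@lebesgue_Rn R n).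
Local Notation T := (Rn R n).
Implicit Types (a b x v : 'rV[R]_n) (i : 'I_n) (A : set T).

(** All that is used of a smooth f and g = |grad f|. In contrast to smoothness,
    which speaks of all iterated derivatives, it visibly passes from (f, g) to
    (f / l, g / l). *)
Record slope_bound (f g : T -> R) : Prop := SlopeBound {
  slope_mf : measurable_fun setT f;
  slope_mg : measurable_fun setT g;
  slope_bf : exists B : R, forall x, `|f x| <= B;
  slope_bg : exists B : R, forall x, `|g x| <= B;
  slope_g0 : forall x, 0 <= g x;
  slope_step : exists M : R, 0 <= M /\ forall x i t, 0 <= t ->
    `|f (x + t *: unitv R i) - f x| <= t * g x + M * t ^+ 2 }.

Definition avg a b (f : T -> R) : R := (\int[mu]_(x in box (a, b)) f x) / vol a b.

Variables (f g : T -> R).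
Hypothesis fg : slope_bound f g.

Let integrable_f a b : mu.-integrable (box (a, b)) (EFin \o f).
Proof. by have [B fB] := slope_bf fg; apply: (box_integrable _ _ (slope_mf fg) fB). Qed.

Lemma slope_integrable A : measurable A -> (mu A < +oo)%E ->
  mu.-integrable A (EFin \o g).
Proof.
by move=> mA A0; have [B gB] := slope_bg fg;
  apply: (bounded_integrable mA A0 (slope_mg fg) gB).
Qed.

Lemma slope_Rintegral_subset A1 A2 : measurable A1 -> measurable A2 ->
  (mu A2 < +oo)%E -> A1 `<=` A2 ->
  \int[mu]_(x in A1) g x <= \int[mu]_(x in A2) g x.
Proof.
move=> m1 m2 A2oo A12.
have A1oo : (mu A1 < +oo)%E by apply: le_lt_trans A2oo; apply: le_measure; rewrite ?inE.
apply: fine_le.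
- by apply: integrable_fin_num => //; exact: slope_integrable.
- by apply: integrable_fin_num => //; exact: slope_integrable.
- apply: (@ge0_subset_integral _ _ _ mu _ _ m1 m2 (EFin \o g) _ _ A12).
    by apply: measurable_funTS; apply/measurable_EFinP; exact: slope_mg fg.
  by move=> x _; rewrite lee_fin; exact: slope_g0 fg x.
Qed.

Let integrable_g a b : mu.-integrable (box (a, b)) (EFin \o g).
Proof. by apply: slope_integrable; [exact: measurable_box|exact: mu_box_lty]. Qed.

Let short_step i : exists2 M : R, 0 <= M & forall a b t, 0 <= t ->
  `|\int[mu]_(x in box (a + t *: unitv R i, b + t *: unitv R i)) f x -
    \int[mu]_(x in box (a, b)) f x| <=
  t * \int[mu]_(x in box (a, b)) g x + M * t ^+ 2 * vol a b.
Proof.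
have [M [M0 HM]] := slope_step fg; exists M => // a b t t0.
have [B fB] := slope_bf fg; have [B' gB] := slope_bg fg.
have mf := slope_mf fg; have mg := slope_mg fg.
have mB := measurable_box (a, b).
rewrite (Rintegral_box_shift _ _ _ mf fB).
have sB x : `|f (x + t *: unitv R i)| <= B by [].
have ms := shift_measurable (t *: unitv R i) mf.
have mc : measurable_fun setT (fun _ : T => M * t ^+ 2) by exact: measurable_cst.
rewrite -(RintegralB mB (box_integrable a b ms sB) (integrable_f a b)).
have md : measurable_fun setT (fun x : T => f (x + t *: unitv R i) - f x).
  exact: measurable_funB ms mf.
have dB x : `|f (x + t *: unitv R i) - f x| <= B + B.
  by rewrite (le_trans (ler_normB _ _))// lerD.
apply: (le_trans (le_normr_Rintegral mB (box_integrable a b md dB))).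
have mtg : measurable_fun setT (fun x : T => t * g x).
  exact: measurable_funM (measurable_cst t) mg.
have tgB x : `|t * g x| <= t * B' by rewrite normrM (ger0_norm t0) ler_wpM2l.
rewrite -(RintegralZl _ mB (integrable_g a b)).
have -> : M * t ^+ 2 * vol a b = \int[mu]_(x in box (a, b)) (M * t ^+ 2).
  by rewrite (Rintegral_cst mu mB).
rewrite -(RintegralD mB (box_integrable a b mtg tgB)
            (box_integrable a b mc (fun=> lexx _))).
apply: (le_Rintegral mB).
- apply: (@box_integrable _ _ _ _ _ (B + B)).
    exact: measurableT_comp (@normr_measurable R setT) md.
  by move=> x; rewrite normr_id.
- apply: (@box_integrable _ _ _ _ _ (t * B' + `|M * t ^+ 2|)).
    exact: measurable_funD mtg mc.
  by move=> x; rewrite (le_trans (ler_normD _ _))// lerD2r.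
- by move=> x _; exact: HM.
Qed.

(** Cutting the translation into N short steps of length h / N leaves a total
    error of order h ^ 2 / N, and each step costs h / N times the integral of g
    over a translate that lies in the hull. This replaces an integration of g
    along segments followed by an exchange of integrals. *)
Lemma translation_step i a b (h : R) : 0 <= h ->
  `|\int[mu]_(x in box (a + h *: unitv R i, b + h *: unitv R i)) f x -
    \int[mu]_(x in box (a, b)) f x| <=
  h * \int[mu]_(x in box (a, b + h *: unitv R i)) g x.
Proof.
move=> h0; have [M M0 HM] := short_step i.
set G := \int[mu]_(x in box (a, b + _)) g x.
apply/ler_addgt0Pr => e e0.
pose N := (Num.trunc (M * h ^+ 2 * vol a b / e)).+1.
pose t := h / N%:R.
have N0 : 0 < N%:R :> R by rewrite ltr0n.
have t0 : 0 <= t by rewrite divr_ge0// ltW.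
pose I (k : nat) := \int[mu]_(x in box (a + (k%:R * t) *: unitv R i,
                           b + (k%:R * t) *: unitv R i)) f x.
have step (k : nat) : (k < N)%N -> `|I k.+1 - I k| <= t * G + M * t ^+ 2 * vol a b.
  move=> kN; rewrite /I -natr1 mulrDl mul1r scalerDl !addrA.
  apply: (le_trans (HM _ _ _ t0)); rewrite vol_shift lerD2r ler_wpM2l//.
  apply: slope_Rintegral_subset; [exact: measurable_box|exact: measurable_box|exact: mu_box_lty|].
  move=> x /= bx j; have := bx j; rewrite !mxE eqxx/=.
  have k0 : 0 <= k%:R * t by rewrite mulr_ge0.
  have kh : k%:R * t <= h.
    by rewrite /t mulrCA ler_piMr// ler_pdivrMr// mul1r ler_nat ltnW.
  case: (j == i); rewrite /= ?mulr1 ?mulr0 => /andP[u w]; apply/andP; split; lra.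
have tele : forall k : nat, (k <= N)%N ->
    `|I k - I 0%N| <= k%:R * (t * G + M * t ^+ 2 * vol a b).
  elim=> [_|k IH kN]; first by rewrite subrr normr0 mul0r.
  rewrite -(subrKA (I k)) (le_trans (ler_normD _ _))// -natr1 mulrDl mul1r addrC lerD//; last exact: step.
  exact: IH (ltnW kN).
have := tele N (leqnn N); rewrite /I mul0r scale0r !addr0.
have -> : N%:R * t = h by rewrite /t mulrCA divff ?mulr1// gt_eqF.
have E (u V : R) : N%:R * (t * u + M * t ^+ 2 * V) = h * u + M * h ^+ 2 * V / N%:R.
  by rewrite /t; field; rewrite gt_eqF.
rewrite E => /le_trans; apply; rewrite lerD2l.
rewrite ler_pdivrMr// -ler_pdivrMl// mulrC.
apply: ltW; exact: truncnS_gt.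
Qed.

(** The average over a box is the mean of the averages over its two halves, which
    differ by a translation. *)
Lemma half_step i a b a' b' (m := (a ord0 i + b ord0 i) / 2) :
    a ord0 i <= b ord0 i -> 0 < vol a b ->
    (a', b') = (a, upd b i m) \/ (a', b') = (upd a i m, b) ->
  `|avg a' b' f - avg a b f| <=
  (b ord0 i - a ord0 i) / 2 / vol a b * \int[mu]_(x in box (a, b)) g x.
Proof.
move=> ab V0 abE; set h := (b ord0 i - a ord0 i) / 2.
have [V1 V2] := vol_half ab; rewrite -/m in V1 V2.
have [U1 U2] := box_halfU ab; rewrite -/m in U1 U2.
have h0 : 0 <= h by rewrite /h; lra.
pose I1 := \int[mu]_(x in box (a, upd b i m)) f x.
pose I2 := \int[mu]_(x in box (upd a i m, b)) f x.
have IE : \int[mu]_(x in box (a, b)) f x = I1 + I2.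
  by rewrite U1 Rintegral_setU//; [exact: measurable_box|exact: measurable_box|rewrite -U1].
have D : `|I2 - I1| <= h * \int[mu]_(x in box (a, b)) g x.
  have := translation_step i a (upd b i m) h0.
  have := upper_half_shift a b i; rewrite -/m -/h => -[E1 E2].
  by rewrite -E1 -E2.
set v := vol a (upd b i m) in V1 V2.
have v0 : 0 < v by move: V0; rewrite V1; lra.
have -> : `|avg a' b' f - avg a b f| = `|I2 - I1| / vol a b.
  rewrite /avg IE V1; case: abE => -[-> ->].
    rewrite -/I1 -/v -normrN -[in RHS](@ger0_norm _ (2 * v)); last by lra.
    by rewrite -normf_div; congr `|_|; field; rewrite gt_eqF.
  rewrite -/I2 V2 -/v -[in RHS](@ger0_norm _ (2 * v)); last by lra.
  by rewrite -normf_div; congr `|_|; field; rewrite gt_eqF.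
by rewrite mulrAC ler_pM2r ?invr_gt0.
Qed.

End slope.

(** * Chains of boxes *)

Section chains.
Context (R : realType) (n : nat).
Local Notation mu := (@lebesgue_Rn R n).
Local Notation T := (Rn R n).
Implicit Types (a b w x : 'rV[R]_n) (i : 'I_n) (A : set T).

(** The point reached from a after moving the first l coordinates to those of
    a'. *)
Definition mix (l : nat) a' a : 'rV[R]_n :=
  \row_i (if (i < l)%N then a' ord0 i else a ord0 i).

Lemma mix0 a' a : mix 0 a' a = a.
Proof. by apply/rowP => i; rewrite mxE. Qed.

Lemma mixn a' a : mix n a' a = a'.
Proof. by apply/rowP => i; rewrite mxE ltn_ord. Qed.

Lemma mixS (i : 'I_n) a' a : mix i.+1 a' a = upd (mix i a' a) i (a' ord0 i).
Proof.
apply/rowP => j; rewrite !mxE ltnS leq_eqVlt; have [->|ji] := eqVneq j i.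
  by rewrite eqxx.
by rewrite (_ : (j == i :> nat) = false)//; exact/negbTE.
Qed.

Lemma mixE i a' a : mix i a' a ord0 i = a ord0 i.
Proof. by rewrite mxE ltnn. Qed.

Definition is_half a b a' b' := forall i, let m := (a ord0 i + b ord0 i) / 2 in
  (a' ord0 i = a ord0 i /\ b' ord0 i = m) \/ (a' ord0 i = m /\ b' ord0 i = b ord0 i).

Lemma is_half_step a b a' b' i : is_half a b a' b' ->
  let: (u, w) := (mix i a' a, mix i b' b) in
  let m := (u ord0 i + w ord0 i) / 2 in
  (mix i.+1 a' a, mix i.+1 b' b) = (u, upd w i m) \/
  (mix i.+1 a' a, mix i.+1 b' b) = (upd u i m, w).
Proof.
move=> ab /=; rewrite !mixE !mixS.
have updid (v : 'rV[R]_n) : upd v i (v ord0 i) = v.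
  by apply/rowP => j; rewrite mxE; case: eqVneq => [->|].
by case: (ab i) => -[-> ->]; [left|right]; congr (_, _);
  rewrite -[RHS]updid mixE.
Qed.

Lemma is_half_subset a b a' b' l : (forall i, a ord0 i <= b ord0 i) ->
  is_half a b a' b' -> box (mix l a' a, mix l b' b) `<=` box (a, b).
Proof.
move=> ab half x bx i; have := bx i; rewrite /= !mxE; have := ab i.
by case: (half i) => -[-> ->]; case: ifP => _ ? /andP[? ?]; apply/andP; split; lra.
Qed.

Lemma vol_mix a b a' b' l : (forall i, a ord0 i <= b ord0 i) ->
  is_half a b a' b' -> (l <= n)%N ->
  vol a b = 2 ^+ l * vol (mix l a' a) (mix l b' b).
Proof.
move=> ab half; elim: l => [_|l IH ln]; first by rewrite !mix0 mul1r.
rewrite (IH (ltnW ln)) exprSr -mulrA; congr (_ * _).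
have H := is_half_step (Ordinal ln) half.
have := @vol_half _ _ (mix l a' a) (mix l b' b) (Ordinal ln).
rewrite !(mixE (Ordinal ln)) => /(_ (ab _)) [V1 V2].
move: H; rewrite /= !(mixE (Ordinal ln)).
by case=> -[-> ->]; rewrite V1 // V2.
Qed.

Variables (f g : T -> R).
Hypothesis fg : slope_bound f g.

(** Halving one coordinate after the other; the volume drops by at most 2 ^ n on
    the way, whence the constant. *)
Lemma half_chain a b a' b' (s : R) : 0 <= s ->
  (forall i, b ord0 i = a ord0 i + s) -> is_half a b a' b' -> 0 < vol a b ->
  `|avg a' b' f - avg a b f| <=
  n%:R * (s / 2) * 2 ^+ n / vol a b * \int[mu]_(x in box (a, b)) g x.
Proof.
move=> s0 bE half V0; set G := \int[mu]_(x in _) g x.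
have ab i : a ord0 i <= b ord0 i by rewrite bE lerDl.
suff H l : (l <= n)%N -> `|avg (mix l a' a) (mix l b' b) f - avg a b f| <=
     l%:R * ((s / 2) * 2 ^+ n / vol a b * G).
  by have := H _ (leqnn n); rewrite !mixn !mulrA.
elim: l => [_|l IH ln]; first by rewrite !mix0 subrr normr0 mul0r.
pose i := Ordinal ln.
rewrite -(subrKA (avg (mix l a' a) (mix l b' b) f)).
rewrite (le_trans (ler_normD _ _))// -natr1 mulrDl mul1r addrC lerD//.
  exact: IH (ltnW ln).
have Vl := vol_mix ab half (ltnW ln).
have Vl0 : 0 < vol (mix l a' a) (mix l b' b).
  by move: V0; rewrite Vl pmulr_rgt0// exprn_gt0.
have := @half_step _ _ _ _ fg i (mix l a' a) (mix l b' b) (mix l.+1 a' a) (mix l.+1 b' b).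
rewrite !(mixE i) => /(_ (ab i) Vl0).
have := is_half_step i half; rewrite /= !(mixE i) => /[swap] /[apply] /le_trans; apply.
rewrite bE addrAC subrr add0r.
have G'G : \int[mu]_(x in box (mix l a' a, mix l b' b)) g x <= G.
  apply: (slope_Rintegral_subset fg); [exact: measurable_box|exact: measurable_box|exact: mu_box_lty|].
  exact: is_half_subset.
have G'0 : 0 <= \int[mu]_(x in box (mix l a' a, mix l b' b)) g x.
  by apply: Rintegral_ge0 => x _; exact: slope_g0 fg x.
apply: ler_pM => //.
  by rewrite divr_ge0 ?divr_ge0// ltW.
rewrite -!mulrA ler_wpM2l// ler_wpM2l// Vl invfM mulrA.
rewrite ler_peMl// ?invr_ge0 ?(ltW Vl0)//.
rewrite ler_pdivlMr ?exprn_gt0// mul1r.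
by rewrite ler_weXn2l ?ler1n// ltnW.
Qed.

(** Moving one coordinate after the other; every intermediate hull lies in the
    hull of the first and the last box. *)
Lemma move_chain a a' w (d : R) A : (forall i, 0 <= w ord0 i) ->
  (forall i, a ord0 i <= a' ord0 i <= a ord0 i + d) ->
  measurable A -> (mu A < +oo)%E -> box (a, a' + w) `<=` A ->
  0 < vol a (a + w) ->
  `|avg a' (a' + w) f - avg a (a + w) f| <=
  n%:R * d / vol a (a + w) * \int[mu]_(x in A) g x.
Proof.
move=> w0 aa' mA Aoo hull V0; set G := \int[mu]_(x in _) g x.
suff H l : (l <= n)%N -> `|avg (mix l a' a) (mix l a' a + w) f - avg a (a + w) f| <=
     l%:R * (d / vol a (a + w) * G).
  by have := H _ (leqnn n); rewrite !mixn !mulrA.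
elim: l => [_|l IH ln]; first by rewrite !mix0 subrr normr0 mul0r.
pose i := Ordinal ln.
rewrite -(subrKA (avg (mix l a' a) (mix l a' a + w) f)).
rewrite (le_trans (ler_normD _ _))// -natr1 mulrDl mul1r addrC lerD//.
  exact: IH (ltnW ln).
have Vl k : vol (mix k a' a) (mix k a' a + w) = vol a (a + w).
  rewrite -[RHS](vol_shift (mix k a' a - a)) [a + w]addrC -addrA.
  by rewrite (addrC a) subrK (addrC w).
have /andP[ai1 ai2] := aa' i.
pose h := a' ord0 i - a ord0 i.
have h0 : 0 <= h by rewrite subr_ge0.
have mS : mix l.+1 a' a = mix l a' a + h *: unitv R i.
  by rewrite (mixS i) upd_shift (mixE i).
rewrite /avg !Vl -mulrBl normrM (gtr0_norm (x := _^-1)) ?invr_gt0//.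
rewrite mulrAC ler_pM2r ?invr_gt0//.
have := translation_step fg i (mix l a' a) (mix l a' a + w) h0.
rewrite mS addrAC => /le_trans; apply.
apply: ler_pM => //.
- by apply: Rintegral_ge0 => x _; exact: slope_g0 fg x.
- by rewrite /h; lra.
apply: (slope_Rintegral_subset fg) => //; first exact: measurable_box.
apply: subset_trans hull => x bx j; have := bx j; rewrite /= !mxE eqxx/=.
have := aa' j; have := w0 j; case: ifPn => jl.
  rewrite (_ : (j == i) = false) ?mulr0 ?addr0; last first.
    by apply/negbTE/eqP => ji; move: jl; rewrite ji /= ltnn.
  by move=> ? /andP[? ?] /andP[? ?]; apply/andP; split; lra.
case: eqVneq => [->|_]; rewrite /= ?mulr1 ?mulr0 /h;
  by move=> ? /andP[? ?] /andP[? ?]; apply/andP; split; lra.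
Qed.

End chains.

(** * Dyadic cubes and shells *)

Section dyadic.
Context (R : realType) (n : nat).
Local Notation mu := (@lebesgue_Rn R n).
Local Notation T := (Rn R n).
Implicit Types (a b w x : 'rV[R]_n) (i : 'I_n) (A : set T) (j k : int).
Implicit Types (z : 'rV[int]_n).

Definition side j : R := 2 ^ j.

Lemma side_gt0 j : 0 < side j.
Proof. exact: exprz_gt0. Qed.
Hint Resolve side_gt0 : core.

Lemma side_neq0 j : side j != 0.
Proof. exact: lt0r_neq0. Qed.
Hint Resolve side_neq0 : core.

Lemma side0 : side 0 = 1.
Proof. by []. Qed.

Lemma sideD j k : side (j + k) = side j * side k.
Proof. by rewrite /side expfzDr. Qed.

Lemma sideS j : side (j + 1) = 2 * side j.
Proof. by rewrite sideD mulrC. Qed.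

Lemma side_nat (m : nat) : side m%:Z = 2 ^+ m.
Proof. by []. Qed.

Lemma sideDn j (m : nat) : side (j + m%:Z) = side j * 2 ^+ m.
Proof. by rewrite sideD. Qed.

Lemma sideBn j (m : nat) : side (j - m%:Z) = side j / 2 ^+ m.
Proof. by rewrite sideD /side -invr_expz. Qed.

Lemma ler_side j k : j <= k -> side j <= side k.
Proof. by move=> jk; rewrite /side ler_eXz2l// ltr1n. Qed.

Definition cube_lo j z : 'rV[R]_n := \row_i (side j * (z ord0 i - 1)%:~R).
Definition cube_hi j z : 'rV[R]_n := \row_i (side j * (z ord0 i)%:~R).
Definition cube j z : set T := box (cube_lo j z, cube_hi j z).
Definition cube_index j x : 'rV[int]_n := \row_i Num.ceil (x ord0 i / side j).

Lemma cubeP j z x : cube j z x <-> cube_index j x = z.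
Proof.
split=> [bx|<- i].
  apply/rowP => i; rewrite mxE; apply: ceil_def; have := bx i.
  by rewrite /= !mxE ltr_pdivlMr// ler_pdivrMr// !(mulrC (side j)).
rewrite /= !mxE; have := ceil_itv (x ord0 i / side j).
by rewrite ltr_pdivlMr// ler_pdivrMr// !(mulrC (side j)).
Qed.

Lemma cube_hiE j z i : cube_hi j z ord0 i = cube_lo j z ord0 i + side j.
Proof. by rewrite !mxE intrB mulrBr mulr1 subrK. Qed.

Lemma cube_hi_const j z : cube_hi j z = cube_lo j z + const_mx (side j).
Proof. by apply/rowP => i; rewrite cube_hiE [RHS]mxE [X in _ = _ + X]mxE. Qed.

Lemma cube_lo_le j z i : cube_lo j z ord0 i <= cube_hi j z ord0 i.
Proof. by rewrite cube_hiE lerDl ltW. Qed.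

Lemma is_half_cube j z z' :
  (forall i, z' ord0 i = 2 * z ord0 i - 1 \/ z' ord0 i = 2 * z ord0 i) ->
  is_half (cube_lo (j + 1) z) (cube_hi (j + 1) z) (cube_lo j z') (cube_hi j z').
Proof.
move=> zz' i /=; rewrite !mxE sideS; case: (zz' i) => ->; [left|right].
  by split; rewrite !(intrB, intrM); lra.
by split; rewrite !(intrB, intrM); lra.
Qed.

Lemma cube_index_half j x i :
  let z := cube_index (j + 1) x in let z' := cube_index j x in
  z' ord0 i = 2 * z ord0 i - 1 \/ z' ord0 i = 2 * z ord0 i.
Proof.
rewrite /= !mxE sideS.
set u := x ord0 i / (2 * side j); have -> : x ord0 i / side j = 2 * u.
  by rewrite /u; field.
have /andP[u1 u2] := ceil_itv u; set v := Num.ceil u in u1 u2 *.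
have [uv|uv] := lerP (2 * u) (2 * v - 1)%:~R.
  left; apply: ceil_def; rewrite uv andbT.
  by move: u1; rewrite !(intrB, intrM); lra.
right; apply: ceil_def; rewrite uv /=.
by move: u2; rewrite !(intrB, intrM); lra.
Qed.

Definition unit_volume : R := vol (cube_lo 0 0) (cube_hi 0 0).
Local Notation c := unit_volume.

Let vol_cube0 j z :
  vol (cube_lo j z) (cube_hi j z) = vol (cube_lo j 0) (cube_hi j 0).
Proof.
pose v : 'rV[R]_n := \row_i (side j * (z ord0 i)%:~R).
have -> : cube_lo j z = cube_lo j 0 + v.
  by apply/rowP => i; rewrite !mxE !(intrB, mulr0z); ring.
have -> : cube_hi j z = cube_hi j 0 + v.
  by apply/rowP => i; rewrite !mxE !(intrB, mulr0z); ring.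
exact: vol_shift.
Qed.

(** Translation invariance and halving determine the measure of dyadic cubes up
    to the factor c. All later estimates compare integrals and volumes for the
    same measure, so the value of c does not matter once it is positive. *)
Lemma vol_cube j z : vol (cube_lo j z) (cube_hi j z) = c * side j ^+ n.
Proof.
rewrite vol_cube0; set v := fun j => vol (cube_lo j 0) (cube_hi j 0).
have vS k : v (k + 1) = 2 ^+ n * v k.
  have := @vol_mix _ _ (cube_lo (k + 1) 0) (cube_hi (k + 1) 0)
     (cube_lo k 0) (cube_hi k 0) n (cube_lo_le _ _).
  rewrite !mixn; apply => //; apply: is_half_cube => i.
  by right; rewrite !mxE mulr0.
have vN (m : nat) : v m%:Z = c * side m ^+ n.
  elim: m => [|m IH]; first by rewrite side0 expr1n mulr1.
  by rewrite -addn1 PoszD vS IH sideS exprMn; ring.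
rewrite -/(v j); case: j => // m; rewrite NegzE.
elim: m => [|m IH].
  have := vS (-1); rewrite addNr => v0.
  have -> : c = v 0 by [].
  by rewrite v0 mulrAC -exprMn (_ : 2 * side (- 1%:Z) = 1) ?expr1n ?mul1r// -sideS addNr.
apply: (@mulfI _ (2 ^+ n)); first by rewrite expf_eq0 pnatr_eq0 andbF.
rewrite -vS (_ : - m.+2%:Z + 1 = - m.+1%:Z); last by lia.
by rewrite IH mulrCA -exprMn -sideS; congr (_ * side _ ^+ n); lia.
Qed.

Definition centered_cube k : set T := box (const_mx (- side k), const_mx (side k)).
Definition shell k : set T := centered_cube (k + 1) `\` centered_cube k.
(** Two consecutive shells: room for a path of boxes from one shell to the next
    that stays away from the origin. *)
Definition wide_shell k : set T := centered_cube (k + 2) `\` centered_cube k.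

Lemma centered_cubeP k x : centered_cube k x <-> forall i, - side k < x ord0 i <= side k.
Proof. by split => cx i; have := cx i; rewrite /= !mxE. Qed.

Lemma mu_centered_cube k : mu (centered_cube k) = (c * side (k + 1) ^+ n)%:E.
Proof.
pose v : 'rV[R]_n := const_mx (side k).
have E1 : const_mx (- side k) = cube_lo (k + 1) 0 + v :> 'rV[R]_n.
  by apply/rowP => i; rewrite !mxE sideS !(intrB, mulr0z); ring.
have E2 : const_mx (side k) = cube_hi (k + 1) 0 + v :> 'rV[R]_n.
  by apply/rowP => i; rewrite !mxE sideS !(intrB, mulr0z); ring.
by rewrite /centered_cube E1 E2 mu_boxE vol_shift vol_cube.
Qed.

Lemma measurable_centered_cube k : measurable (centered_cube k).
Proof. exact: measurable_box. Qed.

Lemma measurable_shell k : measurable (shell k).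
Proof. by apply: measurableD; exact: measurable_centered_cube. Qed.

Lemma measurable_wide_shell k : measurable (wide_shell k).
Proof. by apply: measurableD; exact: measurable_centered_cube. Qed.

Lemma centered_cube_subset j k : j <= k -> centered_cube j `<=` centered_cube k.
Proof.
move=> jk x /centered_cubeP cx; apply/centered_cubeP => i; have := cx i; have := ler_side jk.
by move=> ? /andP[? ?]; apply/andP; split; lra.
Qed.

Lemma wide_shell_lty k : (mu (wide_shell k) < +oo)%E.
Proof.
apply: (@le_lt_trans _ _ (mu (centered_cube (k + 2)))); last by rewrite mu_centered_cube ltry.
apply: le_measure; rewrite ?inE; [exact: measurable_wide_shell|exact: measurable_centered_cube|].
exact: subDsetl.
Qed.

(** One coordinate that stays away from 0 keeps the whole box out of the inner
    cube. *)
Lemma box_wide_shell k a b : (forall i, - (4 * side k) <= a ord0 i) ->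
  (forall i, b ord0 i <= 4 * side k) ->
  (exists i, side k <= a ord0 i \/ b ord0 i <= - side k) ->
  box (a, b) `<=` wide_shell k.
Proof.
move=> ha hb [i hi] x bx; split.
  apply/centered_cubeP => j; have := bx j; have := ha j; have := hb j.
  rewrite /= sideD (_ : side 2 = 4); last by rewrite /side /exprz /=; ring.
  by move=> ? ? /andP[? ?]; apply/andP; split; lra.
move=> /centered_cubeP/(_ i); have := bx i => /= /andP[? ?] /andP[? ?].
by case: hi => ?; lra.
Qed.

Lemma shell_cube_index k x : shell k x ->
  (forall i, -1 <= cube_index k x ord0 i <= 2) /\
  exists i, cube_index k x ord0 i = -1 \/ cube_index k x ord0 i = 2.
Proof.
move=> [/centered_cubeP cx ncx].
have H i : -1 <= cube_index k x ord0 i <= 2.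
  have /andP[x1 x2] := cx i; rewrite mxE; apply/andP; split.
    suff : -2 < Num.ceil (x ord0 i / side k) by lia.
    by rewrite ceil_gt_int ltr_pdivlMr//; move: x1; rewrite sideS; lra.
  by rewrite ceil_le_int ler_pdivrMr//; move: x2; rewrite sideS; lra.
split => //; apply: contrapT => nz; apply: ncx; apply/centered_cubeP => i.
have z0 : cube_index k x ord0 i <> -1 by move=> z1; apply: nz; exists i; left.
have z1 : cube_index k x ord0 i <> 2 by move=> z2; apply: nz; exists i; right.
have : 0 <= cube_index k x ord0 i <= 1 by have := H i; lia.
rewrite mxE => /andP[y1 y2]; apply/andP; split.
  by move: y1; rewrite ceil_ge0 ltr_pdivlMr// mulN1r.
by move: y2; rewrite ceil_le_int ler_pdivrMr// mul1r.
Qed.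

Lemma shell_index_eq k x y : cube_index k x = cube_index k y -> shell k x -> shell k y.
Proof.
move=> xy [/centered_cubeP cx ncx].
have E i : Num.ceil (x ord0 i / side k) = Num.ceil (y ord0 i / side k).
  by move/rowP : xy => /(_ i); rewrite !mxE.
have centered_cube_ceil (m : nat) (u : 'rV[R]_n) : (forall i, - (m%:R * side k) < u ord0 i <= m%:R * side k) <->
    (forall i, - m%:Z < Num.ceil (u ord0 i / side k) <= m%:Z).
  by split => H i; have := H i;
    rewrite ceil_gt_int ceil_le_int ltr_pdivlMr// ler_pdivrMr// intrN mulNr.
split.
  apply/centered_cubeP; rewrite sideS; apply: (centered_cube_ceil 2%N y).2 => i; rewrite -E; move: i.
  by apply: (centered_cube_ceil 2%N x).1; move: cx; rewrite sideS.
move=> /centered_cubeP cy; apply: ncx; apply/centered_cubeP; rewrite -[side k]mul1r.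
apply: (centered_cube_ceil 1%N x).2 => i; rewrite E; move: i; apply: (centered_cube_ceil 1%N y).1.
by rewrite mul1r.
Qed.

Lemma cube_index_coarser j (m : nat) x y :
  cube_index (j - m%:Z) x = cube_index (j - m%:Z) y -> cube_index j x = cube_index j y.
Proof.
elim: m => [|m IH]; first by rewrite subr0.
move=> H; apply: IH; apply/rowP => i.
have -> : j - m%:Z = (j - m.+1%:Z) + 1 by lia.
move/rowP : H => /(_ i) H.
have := cube_index_half (j - m.+1%:Z) x i; have := cube_index_half (j - m.+1%:Z) y i.
rewrite /= H; move: (cube_index _ x _ _) (cube_index _ y _ _) (cube_index _ y _ _).
by move=> u v w; lia.
Qed.

Lemma shell_disjoint j k x : shell j x -> shell k x -> j = k.
Proof.
wlog jk : j k / j <= k.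
  by move=> H sj sk; have [/H->//|/ltW/H<-//] := leP j k.
move=> [sj _] [_ nsk]; apply/eqP; rewrite eq_le jk/=.
rewrite leNgt; apply/negP => ltjk; apply: nsk; apply: centered_cube_subset sj; lia.
Qed.

Lemma centered_cube_exists x : exists m : nat, centered_cube m x.
Proof.
pose B := \sum_(i < n) `|x ord0 i|.
exists (Num.trunc B).+1; apply/centered_cubeP => i.
have xB : `|x ord0 i| <= B by rewrite /B (bigD1 i)//= lerDl sumr_ge0.
have : B < side (Num.trunc B).+1.
  apply: (lt_le_trans (truncnS_gt B)); rewrite side_nat -natrX ler_nat.
  exact/ltnW/ltn_expl.
by move: xB; rewrite ler_norml => /andP[? ?] ?; apply/andP; split; lra.
Qed.

Lemma shell_exists x : x != 0 -> exists k, shell k x.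
Proof.
move=> x0.
have [i xi] : exists i, x ord0 i != 0.
  apply: contrapT => H; move/eqP : x0; apply; apply/rowP => i; rewrite mxE.
  by apply: contrapT => /eqP xi; apply: H; exists i.
have [N Nx] : exists N : nat, ~ centered_cube (- N%:Z) x.
  pose r := `|x ord0 i|; have r0 : 0 < r by rewrite normr_gt0.
  exists (Num.trunc r^-1).+1; move=> /centered_cubeP/(_ i); set N := (Num.trunc _).+1.
  have : side (- N%:Z) < r.
    rewrite -[- N%:Z]add0r sideBn mul1r -[r]invrK ltf_pV2 ?posrE ?invr_gt0 ?exprn_gt0//.
    apply: (lt_le_trans (truncnS_gt r^-1)); rewrite -natrX ler_nat.
    exact/ltnW/ltn_expl.
  move=> rN /andP[x1 x2]; have : r <= side (- N%:Z) by rewrite ler_norml x2 ltW.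
  by rewrite leNgt rN.
have [M Mx] := centered_cube_exists x.
have H : exists m, `[< centered_cube (m%:Z - N%:Z) x >].
  exists (M + N)%N; apply/asboolP; apply: centered_cube_subset Mx; lia.
have [[|m] /asboolP mx mmin] := find_ex_minn H.
  by rewrite sub0r in mx.
exists (m%:Z - N%:Z); split; first by apply: centered_cube_subset mx; lia.
by move=> /asboolP/mmin; rewrite ltnn.
Qed.

End dyadic.

(** * The dyadic representation *)

Section representation.
Context (R : realType) (n : nat).
Local Notation mu := (@lebesgue_Rn R n).
Local Notation T := (Rn R n).
Local Notation c := (unit_volume R n).
Local Notation side := (@side R).
Implicit Types (x : 'rV[R]_n) (A : set T) (j k : int) (phi : T -> R) (z : 'rV[int]_n).

Definition mean j A phi : R := (\int[mu]_(x in A) phi x) / side j ^+ n.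

Definition cube_at j x : set T := cube j (cube_index j x).

(** Averages over the dyadic cubes that shrink to x, weighted by their size
    relative to 2 ^ k. *)
Definition near_sum (M : nat) phi k x : R :=
  \sum_(m < M) (2 ^+ m)^-1 * mean (k - m%:Z) (cube_at (k - m%:Z) x) phi.

(** Averages over the shells farther out than shell k. Shells are used instead of
    cubes around the origin because a point belongs to two of them only. *)
Definition far_sum (M : nat) phi k : R :=
  \sum_(m < M) 2 ^+ m * mean (k + m%:Z) (wide_shell (k + m%:Z)) phi.

Lemma mean_ge0 j A phi : (forall x, 0 <= phi x) -> 0 <= mean j A phi.
Proof.
move=> p0; apply: divr_ge0; last by rewrite exprn_ge0// ltW// side_gt0.
by apply: Rintegral_ge0 => x _.
Qed.

Lemma cube_at_self j x : cube_at j x x.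
Proof. exact/cubeP. Qed.

Lemma measurable_cube_at j x : measurable (cube_at j x).
Proof. exact: measurable_box. Qed.

Variables (f g : T -> R).
Hypotheses (fg : slope_bound f g) (c0 : 0 < c).

Definition cube_avg j (z : 'rV[int]_n) : R := avg (cube_lo R j z) (cube_hi R j z) f.

(** A common bound for all steps: a move by at most three side lengths costs
    3 n / c, and halving all coordinates of a cube costs n 2 ^ n / (2 c). *)
Definition step_const : R := 6 * n%:R * 2 ^+ n / c.
Local Notation K := step_const.

Let g0 x : 0 <= g x. Proof. exact: slope_g0 fg x. Qed.

Let vol0 j z : 0 < vol (cube_lo R j z) (cube_hi R j z).
Proof. by rewrite vol_cube mulr_gt0// exprn_gt0// side_gt0. Qed.

Let K_le j (u : R) A : 0 <= u <= 6 * 2 ^+ n * side j ->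
  n%:R * u / (c * side j ^+ n) * \int[mu]_(x in A) g x <= K * side j * mean j A g.
Proof.
move=> /andP[u0 u1]; rewrite /mean /step_const.
have s0 := @side_gt0 R j; have sn : 0 < side j ^+ n by rewrite exprn_gt0.
have I0 : 0 <= \int[mu]_(x in A) g x by apply: Rintegral_ge0 => x _.
move: (\int[mu]_(x in A) g x) I0 => I I0.
have -> : 6 * n%:R * 2 ^+ n / c * side j * (I / side j ^+ n) =
   (n%:R * (6 * 2 ^+ n * side j)) / (c * side j ^+ n) * I.
  by field; rewrite !gt_eqF.
by rewrite ler_wpM2r// ler_wpM2r ?invr_ge0 ?mulr_ge0 ?(ltW sn) ?(ltW c0)// ler_wpM2l.
Qed.

Lemma expr2n_ge1 (m : nat) : 1 <= 2 ^+ m :> R.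
Proof. by rewrite exprn_ege1// ler1n. Qed.

Lemma parent_step j z z' :
  (forall i, z' ord0 i = 2 * z ord0 i - 1 \/ z' ord0 i = 2 * z ord0 i) ->
  `|cube_avg j z' - cube_avg (j + 1) z| <=
  K * side (j + 1) * mean (j + 1) (cube (j + 1) z) g.
Proof.
move=> zz'; have s0 := @side_gt0 R (j + 1).
have := half_chain fg (ltW s0) (fun i => cube_hiE R (j + 1) z i)
  (is_half_cube R j zz') (vol0 _ _).
rewrite -/(cube_avg j z') -/(cube_avg (j + 1) z) => /le_trans; apply.
rewrite vol_cube -(mulrA n%:R (_ / 2)).
apply: K_le; have := expr2n_ge1 n; nra.
Qed.

(** The cubes ]2 ^ k, 2 ^ (k + 1)]^n of consecutive scales are joined through the
    cube ]2 ^ (k + 1), 3 2 ^ k]^n, a translate of the first and a child of the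
    second. *)
Lemma outer_step k : `|cube_avg k (const_mx 2) - cube_avg (k + 1) (const_mx 2)| <=
  2 * K * side k * mean k (wide_shell k) g.
Proof.
have s0 := @side_gt0 R k; have E2 := expr2n_ge1 n.
rewrite -(subrKA (cube_avg k (const_mx 3))).
rewrite (le_trans (ler_normD _ _))//.
have -> : 2 * K * side k * mean k (wide_shell k) g =
   K * side k * mean k (wide_shell k) g + K * side k * mean k (wide_shell k) g by ring.
have wm := @measurable_wide_shell R n k; have wl := @wide_shell_lty R n k.
have I0 : 0 <= \int[mu]_(x in wide_shell k) g x by apply: Rintegral_ge0 => x _.
apply: lerD; last first.
  have H : forall i, (const_mx 3 : 'rV[int]_n) ord0 i = 2 * (const_mx 2 : 'rV[int]_n) ord0 i - 1 \/
           (const_mx 3 : 'rV[int]_n) ord0 i = 2 * (const_mx 2 : 'rV[int]_n) ord0 i.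
    by move=> i; left; rewrite !mxE.
  have := parent_step k H => /le_trans; apply.
  have [n0|n0] := posnP n.
    have -> : K = 0 by rewrite /step_const n0 mulr0 !mul0r.
    by rewrite !mul0r.
  have K0 : 0 <= K by rewrite /step_const divr_ge0 ?mulr_ge0// ltW.
  have KS : 0 <= K * side k by rewrite mulr_ge0// ltW.
  rewrite sideS.
  have E (u v w : R) : u * (2 * v) * w = u * v * (2 * w) by ring.
  rewrite E ler_wpM2l// /mean sideS.
  have IS : \int[mu]_(x in cube (k + 1) (const_mx 2)) g x <= \int[mu]_(x in wide_shell k) g x.
    apply: (slope_Rintegral_subset fg) => //; first exact: measurable_box.
    apply: box_wide_shell.
    - by move=> i; rewrite !mxE sideS; lra.
    - by move=> i; rewrite !mxE sideS; lra.
    - by exists (Ordinal n0); left; rewrite !mxE sideS; lra.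
  have J0 : 0 <= \int[mu]_(x in cube (k + 1) (const_mx 2)) g x.
    by apply: Rintegral_ge0 => x _.
  move: (\int[mu]_(x in cube _ _) g x) (\int[mu]_(x in wide_shell k) g x) J0 IS => I1 I2 J0 IS.
  have E3 : 2 <= 2 ^+ n :> R by rewrite -[leLHS]expr1 ler_weXn2l ?ler1n.
  rewrite exprMn ler_pdivlMr ?exprn_gt0//.
  have -> : 2 * (I1 / (2 ^+ n * side k ^+ n)) * side k ^+ n = I1 * (2 / 2 ^+ n).
    by field; rewrite !expf_neq0 ?gt_eqF.
  by apply: le_trans IS; rewrite ler_piMr// ler_pdivrMr ?exprn_gt0// mul1r.
have [n0|n0] := posnP n.
  rewrite (_ : const_mx 2 = const_mx 3 :> 'rV[int]_n) ?subrr ?normr0; last first.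
    by apply/rowP => i; exfalso; have : (0 < n)%N := leq_ltn_trans (leq0n i) (ltn_ord i); rewrite lt0n => /eqP.
  have -> : K = 0 by rewrite /step_const n0 mulr0 !mul0r.
  by rewrite !mul0r.
have := @move_chain _ _ _ _ fg (cube_lo R k (const_mx 2)) (cube_lo R k (const_mx 3))
  (const_mx (side k)) (side k) (wide_shell k) _ _ wm wl _ _.
rewrite -!cube_hi_const vol_cube distrC => /(_ _ _ _ _)/le_trans; apply.
- by move=> i; rewrite mxE ltW.
- by move=> i; rewrite !mxE; lra.
- apply: box_wide_shell.
  + by move=> i; rewrite !mxE; lra.
  + by move=> i; rewrite !mxE; lra.
  + by exists (Ordinal n0); left; rewrite !mxE; lra.
- by rewrite mulr_gt0// exprn_gt0.
- by apply: K_le; nra.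
Qed.

(** This is where the dimension must exceed 1: in dimension 1 the shell is not
    connected. *)
Lemma shell_step k x : (1 < n)%N -> shell k x ->
  `|cube_avg k (cube_index k x) - cube_avg k (const_mx 2)| <=
  2 * K * side k * mean k (wide_shell k) g.
Proof.
move=> n1 kx; have s0 := @side_gt0 R k; have E2 := expr2n_ge1 n.
have wm := @measurable_wide_shell R n k; have wl := @wide_shell_lty R n k.
have [zb [i zi]] := shell_cube_index kx.
move: (cube_index k x) zb zi => z zb zi {kx}.
(* the path first raises a coordinate other than i, so that at every moment one
   of the two coordinates keeps the box away from the origin *)
have [i1 ii1] : exists i1 : 'I_n, i1 != i.
  have n0 : (0 < n)%N by exact: ltnW.
  have [i0|i0] := eqVneq i (Ordinal n0); last by exists (Ordinal n0); rewrite eq_sym.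
  by exists (Ordinal n1); rewrite i0.
pose z1 : 'rV[int]_n := \row_l (if l == i1 then 2 else z ord0 l).
have -> : 2 * K * side k * mean k (wide_shell k) g =
   K * side k * mean k (wide_shell k) g + K * side k * mean k (wide_shell k) g by ring.
have zR l : -1 <= (z ord0 l)%:~R :> R /\ (z ord0 l)%:~R <= 2 :> R.
  have /andP[h1 h2] := zb l; split; first by move: h1; rewrite -(ler_int R) intrN.
  by move: h2; rewrite -(ler_int R).
have zS l : 0 <= side k * (2 - (z ord0 l)%:~R) /\ 0 <= side k * ((z ord0 l)%:~R + 1).
  by have [? ?] := zR l; split; apply: mulr_ge0; lra.
have ziR : (z ord0 i)%:~R = - 1 :> R \/ (z ord0 i)%:~R = 2 :> R.
  by case: zi => ->; [left; rewrite intrN|right].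
rewrite distrC -(subrKA (cube_avg k z1)) (le_trans (ler_normD _ _))// lerD//.
  have := @move_chain _ _ _ _ fg (cube_lo R k z1) (cube_lo R k (const_mx 2))
    (const_mx (side k)) (3 * side k) (wide_shell k) _ _ wm wl _ _.
  rewrite -!cube_hi_const vol_cube => /(_ _ _ _ _)/le_trans; apply.
  - by move=> l; rewrite mxE ltW.
  - move=> l; rewrite !mxE; case: ifP => _; first lra.
    by have [? ?] := zS l; apply/andP; split; rewrite !intrB; lra.
  - apply: box_wide_shell.
    + move=> l; rewrite !mxE; case: ifP => _; first lra.
      by have [? ?] := zS l; rewrite !intrB; lra.
    + by move=> l; rewrite !mxE; lra.
    + by exists i1; left; rewrite !mxE eqxx; lra.
  - by rewrite mulr_gt0// exprn_gt0.
  - by apply: K_le; nra.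
have := @move_chain _ _ _ _ fg (cube_lo R k z) (cube_lo R k z1)
    (const_mx (side k)) (3 * side k) (wide_shell k) _ _ wm wl _ _.
rewrite -!cube_hi_const vol_cube => /(_ _ _ _ _)/le_trans; apply.
- by move=> l; rewrite mxE ltW.
- move=> l; have [? ?] := zS l.
  by rewrite !mxE; case: ifP => _; apply/andP; split; rewrite ?intrB; lra.
- apply: box_wide_shell.
  + by move=> l; have [? ?] := zS l; rewrite !mxE; rewrite !intrB; lra.
  + by move=> l; have [? ?] := zS l; rewrite !mxE; case: ifP => _; lra.
  + exists i; rewrite !mxE eq_sym (negbTE ii1) intrB.
    by case: ziR => ->; [right|left]; lra.
- by rewrite mulr_gt0// exprn_gt0.
- by apply: K_le; nra.
Qed.

(** Telescoping from a small cube around x up to its shell, across the shell to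
    the diagonal cube, and outwards along the diagonal cubes. *)
Lemma cube_avg_bound k x (M N : nat) : (1 < n)%N -> shell k x -> (0 < N)%N ->
  `|cube_avg (k - M%:Z) (cube_index (k - M%:Z) x)| <=
  4 * K * side k * (near_sum M g k x + far_sum N g k) +
  `|cube_avg (k + N%:Z) (const_mx 2)|.
Proof.
move=> n1 kx N0; have s0 := @side_gt0 R k.
have K0 : 0 <= K by rewrite /step_const divr_ge0 ?mulr_ge0// ltW.
have near : `|cube_avg (k - M%:Z) (cube_index (k - M%:Z) x) -
              cube_avg k (cube_index k x)| <= K * side k * near_sum M g k x.
  elim: M => [|M IH]; first by rewrite subr0 subrr normr0 /near_sum big_ord0 mulr0.
  rewrite /near_sum big_ord_recr/= mulrDr [leRHS]addrC.
  rewrite -(subrKA (cube_avg (k - M%:Z) (cube_index (k - M%:Z) x))).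
  rewrite (le_trans (ler_normD _ _))// lerD//.
  have := @parent_step (k - M.+1%:Z) _ _ (cube_index_half (k - M.+1%:Z) x).
  rewrite (_ : k - M.+1%:Z + 1 = k - M%:Z); last by lia.
  by move=> /le_trans; apply; rewrite sideBn !mulrA.
have far : `|cube_avg k (const_mx 2) - cube_avg (k + N%:Z) (const_mx 2)| <=
     2 * K * side k * far_sum N g k.
  elim: {N0} N => [|N IH]; first by rewrite addr0 subrr normr0 /far_sum big_ord0 mulr0.
  rewrite /far_sum big_ord_recr/= mulrDr.
  rewrite -(subrKA (cube_avg (k + N%:Z) (const_mx 2))).
  rewrite (le_trans (ler_normD _ _))// lerD//.
  have := outer_step (k + N%:Z); rewrite (_ : k + N%:Z + 1 = k + N.+1%:Z); last by lia.
  by move=> /le_trans; apply; rewrite sideDn !mulrA.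
have st := shell_step n1 kx.
have far1 : mean k (wide_shell k) g <= far_sum N g k.
  case: N N0 {far} => // N _; rewrite /far_sum big_ord_recl /= expr0 mul1r addr0 lerDl.
  by apply: sumr_ge0 => m _; rewrite mulr_ge0// mean_ge0.
have near0 : 0 <= near_sum M g k x.
  by apply: sumr_ge0 => m _; rewrite mulr_ge0// mean_ge0.
have KS : 0 <= K * side k by rewrite mulr_ge0// ltW.
set w := K * side k in KS near *.
have e1 : 4 * K * side k = 4 * w by rewrite /w mulrA.
have e2 : 2 * K * side k = 2 * w by rewrite /w mulrA.
rewrite e2 in far st; rewrite e1.
have st' := le_trans st (ler_wpM2l (mulr_ge0 (ler0n _ 2) KS) far1).
set a1 := cube_avg (k - M%:Z) _ in near *; set a2 := cube_avg k _ in near st' *.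
set a3 := cube_avg k _ in far st' *; set a4 := cube_avg (k + N%:Z) _ in far *.
set S1 := near_sum _ _ _ _ in near near0 *; set S2 := far_sum _ _ _ in far st' *.
have w1 : 0 <= w * S1 by rewrite mulr_ge0.
have -> : a1 = (a1 - a2) + ((a2 - a3) + ((a3 - a4) + a4)) by rewrite subrK subrK subrK.
apply: (@le_trans _ _ (w * S1 + (2 * w * S2 + (2 * w * S2 + `|a4|)))).
  apply: (le_trans (ler_normD _ _)); apply: lerD near _.
  apply: (le_trans (ler_normD _ _)); apply: lerD st' _.
  by apply: (le_trans (ler_normD _ _)); exact: lerD far _.
have -> : 4 * w * (S1 + S2) = 4 * (w * S1) + 4 * w * S2 by rewrite mulrDr !mulrA.
have -> : 4 * w * S2 = 2 * w * S2 + 2 * w * S2 by rewrite -!mulrDl -natrD.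
by rewrite !addrA lerD2r -!addrA lerD2r; lra.
Qed.

Lemma cube_avg_limit x k (e : R) : {for x, continuous (f : 'rV[R]_n -> R)} -> 0 < e ->
  exists M0 : nat, forall M : nat, (M0 <= M)%N ->
  `|f x - cube_avg (k - M%:Z) (cube_index (k - M%:Z) x)| <= e.
Proof.
move=> fx e0.
have : nbhs x [set y : 'rV[R]_n | `|f x - f y| <= e].
  by move/cvgrPdist_le : fx => /(_ _ e0).
move=> /nbhs_ballP[d /= d0 Hd].
exists (Num.trunc (side k / d)).+1 => M M0.
set j := k - M%:Z.
have jd : side j < d.
  rewrite /j sideBn ltr_pdivrMr ?exprn_gt0// mulrC -ltr_pdivrMr//.
  apply: (lt_le_trans (truncnS_gt _)).
  by rewrite -natrX ler_nat (leq_trans M0)// ltnW// ltn_expl.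
have close y : cube_at j x y -> `|f x - f y| <= e.
  move=> Qy; apply: Hd; rewrite mx_norm_ball /ball_ /=.
  have Qx := cube_at_self j x.
  rewrite [ltLHS]mx_normrE; apply: bigmax_lt => //= -[u i] _ /=.
  rewrite !mxE (ord1 u); have := Qx i; have := Qy i; rewrite /= cube_hiE ltr_norml.
  by move=> /andP[? ?] /andP[? ?]; apply/andP; split; lra.
have [B fB] := slope_bf fg.
have mf := slope_mf fg.
have mQ := measurable_cube_at j x.
have V0 := vol0 j (cube_index j x); set V := vol _ _ in V0.
have muQ : fine (mu (cube_at j x)) = V by [].
have cstI r : mu.-integrable (cube_at j x) (EFin \o fun=> r).
  by apply: (@box_integrable _ _ _ _ _ `|r|); [exact: measurable_cst|move=> ?].
have fI : mu.-integrable (cube_at j x) (EFin \o f) by exact: (box_integrable _ _ mf fB).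
have dI : mu.-integrable (cube_at j x) (EFin \o (fun y => f x - f y)).
  apply: (@box_integrable _ _ _ _ _ (B + B)).
    exact: measurable_funB (measurable_cst _) mf.
  by move=> y; rewrite (le_trans (ler_normB _ _))// lerD.
have -> : f x - cube_avg j (cube_index j x) =
    (\int[mu]_(y in cube_at j x) (f x - f y)) / V.
  rewrite (RintegralB mQ (cstI _) fI) (Rintegral_cst mu mQ) muQ mulrBl mulfK//.
  by rewrite gt_eqF.
rewrite normrM (gtr0_norm (x := V^-1)) ?invr_gt0// ler_pdivrMr//.
apply: (le_trans (le_normr_Rintegral mQ dI)).
rewrite -muQ -(Rintegral_cst mu mQ).
apply: (le_Rintegral mQ) => //.
apply: (@box_integrable _ _ _ _ _ (B + B)).
  exact: measurableT_comp (@normr_measurable R setT) (measurable_funB (measurable_cst _) mf).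
by move=> y; rewrite normr_id (le_trans (ler_normB _ _))// lerD.
Qed.

(** The small cubes shrink to x, and far out the averages of f vanish. *)
Theorem pointwise_representation k x (J : int) (e : R) : (1 < n)%N -> shell k x ->
  {for x, continuous (f : 'rV[R]_n -> R)} -> (forall y, ~ centered_cube J y -> f y = 0) ->
  0 < e ->
  exists M : nat, `|f x| <= 4 * K * side k * (near_sum M g k x + far_sum M g k) + e.
Proof.
move=> n1 kx fx fJ e0; have [M0 HM] := cube_avg_limit k fx e0.
pose M := (M0 + `|J - k|)%N.+1; exists M.
have /HM : (M0 <= M)%N by rewrite /M; lia.
have : cube_avg (k + M%:Z) (const_mx 2) = 0.
  rewrite /cube_avg /avg.
  have -> : \int[mu]_(x in cube (k + M%:Z) (const_mx 2)) f x =
            \int[mu]_(x in cube (k + M%:Z) (const_mx 2)) 0.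
    apply: eq_Rintegral => y; rewrite inE => Qy; apply: fJ => Jy.
    have n0 : (0 < n)%N by exact: ltnW.
    have := Qy (Ordinal n0); move/centered_cubeP : Jy => /(_ (Ordinal n0)).
    rewrite /= !mxE; have : side J <= side (k + M%:Z) by apply: ler_side; rewrite /M; lia.
    by move=> ? /andP[? ?] /andP[? ?]; lra.
  by rewrite Rintegral_cst ?mul0r//; exact: measurable_box.
move=> E0 H2; have := @cube_avg_bound k x M M n1 kx (ltn0Sn _).
rewrite E0 normr0 addr0 => H1; rewrite -[f x](subrK (cube_avg (k - M%:Z) (cube_index (k - M%:Z) x))).
by rewrite (le_trans (ler_normD _ _))// addrC lerD.
Qed.

End representation.

(** * Measurability *)

Section measurability_on_Rn.
Context (R : realType) (n : nat).
Local Notation mu := (@lebesgue_Rn R n).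
Local Notation T := (Rn R n).

(** An open set is the union of the dyadic cubes that it contains, and these are
    countably many. *)
Lemma open_measurable_Rn (U : set 'rV[R]_n) : open U -> measurable (U : set T).
Proof.
move=> oU.
pose F (jz : nat * 'rV[int]_n) : set T :=
  if `[< cube (- jz.1%:Z) jz.2 `<=` U >] then cube (- jz.1%:Z) jz.2 else set0.
rewrite (_ : U = \bigcup_jz F jz).
  apply: countable_bigcupT_measurable => [|jz]; first exact: countableP.
  by rewrite /F; case: ifP => _; [exact: measurable_box|exact: measurable0].
apply/seteqP; split => [x Ux|x [jz _]]; last first.
  by rewrite /F; case: asboolP => // + ?; exact.
have /nbhs_ballP[d /= d0 Hd] : nbhs x U by exact: open_nbhs_nbhs.
pose m := (Num.trunc d^-1).+1.
exists (m, cube_index (- m%:Z) x) => //; rewrite /F/=.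
have Qx := cube_at_self (- m%:Z) x.
case: asboolP => // -[] y Qy; apply: Hd; rewrite mx_norm_ball /ball_ /=.
have md : side R (- m%:Z) < d.
  rewrite -[- _]add0r sideBn mul1r -[d]invrK ltf_pV2 ?posrE ?invr_gt0 ?exprn_gt0//.
  apply: (lt_le_trans (truncnS_gt d^-1)).
  by rewrite -natrX ler_nat ltnW// ltn_expl.
rewrite [ltLHS]mx_normrE; apply: bigmax_lt => //= -[u i] _ /=.
rewrite !mxE (ord1 u); have := Qx i; have := Qy i; rewrite /= cube_hiE ltr_norml.
by move=> /andP[? ?] /andP[? ?]; apply/andP; split; lra.
Qed.

Lemma continuous_measurable_Rn (f : 'rV[R]_n -> R) : continuous f ->
  measurable_fun [set: T] (f : T -> R).
Proof.
move=> /continuousP cf; apply: (measurability _ (RGenOpens.measurableE R)).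
move=> _ [_ [a [b ->] <-]]; rewrite setTI; apply: open_measurable_Rn.
exact/cf/interval_open.
Qed.

End measurability_on_Rn.

Section measurability_general.
Context d (X : measurableType d) (R : realType).

Lemma measurable_variable_powR (f q : X -> R) :
  measurable_fun setT f -> measurable_fun setT q -> (forall x, 1 <= q x) ->
  measurable_fun setT (fun x => f x `^ q x).
Proof.
move=> mf mq q1.
rewrite (_ : (fun x => _) = (fun x => if f x == 0 then 0 else expR (q x * ln (f x)))).
  apply: measurable_fun_ifT.
  - by apply: (measurable_fun_eqr mf); exact: measurable_cst.
  - exact: measurable_cst.
  - apply: (measurableT_comp (@measurable_expR R)).
    by apply: measurable_funM => //; exact: measurableT_comp (@measurable_ln R) mf.
apply/funext => x; rewrite /powR; case: ifP => // _.
by rewrite gt_eqF// (lt_le_trans ltr01).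
Qed.

Variables (m : {measure set X -> \bar R}) (N : X -> nat).
Hypothesis mN : forall i, measurable (N @^-1` [set i]).

Let bigcup_fibers : \bigcup_i (N @^-1` [set i]) = setT.
Proof. by apply/seteqP; split => // x _; exists (N x). Qed.

Let trivIset_fibers : trivIset setT (fun i => N @^-1` [set i]).
Proof. by move=> i j _ _ [x [/= <- <-]]. Qed.

Lemma measurable_fun_fibers (F : nat -> \bar R) : measurable_fun setT (F \o N).
Proof.
move=> _ A _; rewrite setTI (_ : _ @^-1` _ = \bigcup_(i in F @^-1` A) (N @^-1` [set i])).
  exact: bigcup_measurable.
apply/seteqP; split => [x Ax|x [i Ai Ni]]; first by exists (N x).
by rewrite /= (_ : N x = i).
Qed.

Local Open Scope ereal_scope.

Lemma integral_fibers (F : nat -> \bar R) : (forall i, 0 <= F i) ->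
  \int[m]_x F (N x) = \sum_(i <oo) F i * m (N @^-1` [set i]).
Proof.
move=> F0; rewrite -bigcup_fibers ge0_integral_bigcup//; last first.
  by rewrite bigcup_fibers; exact: measurable_fun_fibers.
apply: eq_eseriesr => i _.
rewrite -integral_cst//; apply: eq_integral => x; rewrite inE => /= ->.
by [].
Qed.

End measurability_general.

(** * Averaging over cells is bounded on L^1 *)

Section cells.
Context d (X : measurableType d) (R : realType) (m : {measure set X -> \bar R}).
Local Open Scope ereal_scope.

Lemma measurable_cells (I : countType) (cls : X -> I) (F : I -> \bar R) :
  (forall a, measurable (cls @^-1` [set a])) -> measurable_fun setT (F \o cls).
Proof.
move=> mcls.
have E : F \o cls = (fun i => oapp F 0 (pickle_inv i)) \o (pickle \o cls).
  by apply/funext => x /=; rewrite pickleK_inv.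
rewrite E; apply: measurable_fun_fibers => i.
case: (pickle_inv i) (@pickle_invK I i) => [a /= ai|] .
  rewrite (_ : _ @^-1` _ = cls @^-1` [set a])//.
  by apply/seteqP; split => x /=; [rewrite -ai => /(pcan_inj (@pickleK I))|move=> ->].
move=> _; have [[a ai]|na] := pselect (exists a : I, pickle a = i).
  rewrite (_ : _ @^-1` _ = cls @^-1` [set a])//.
  by apply/seteqP; split => x /=; [rewrite -ai => /(pcan_inj (@pickleK I))|move=> ->].
rewrite (_ : _ @^-1` _ = set0)//; apply/seteqP; split => // x /= xi.
by apply: na; exists (cls x).
Qed.

(** A function that is constant on cells integrates to the sum of its values
    times the measures of the cells; when each summand is an integral over one
    member of a disjoint family, the sum is an integral again. *)
Lemma integral_cells_le (I : countType) (cls : X -> I) (F : I -> \bar R)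
    (S : I -> set X) (psi : X -> \bar R) (C : R) :
  (forall a, measurable (cls @^-1` [set a])) ->
  (forall a, measurable (S a)) -> trivIset setT S ->
  (forall a, 0 <= F a) -> measurable_fun setT psi -> (forall x, 0 <= psi x) ->
  (0 <= C)%R ->
  (forall a, F a * m (cls @^-1` [set a]) <= C%:E * \int[m]_(x in S a) psi x) ->
  \int[m]_x F (cls x) <= C%:E * \int[m]_x psi x.
Proof.
move=> mcls mS tS F0 mpsi psi0 C0 FS.
pose N x := pickle (cls x).
pose F' i := oapp F 0 (pickle_inv i).
pose S' i := oapp S set0 (@pickle_inv I i).
have mS' i : measurable (S' i) by rewrite /S'; case: (pickle_inv i) => /=.
have F'0 i : 0 <= F' i by rewrite /F'; case: (pickle_inv i) => /=.
have NE i : N @^-1` [set i] = oapp (fun a => cls @^-1` [set a]) set0 (@pickle_inv I i).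
  apply/seteqP; split => [x <-|x]; first by rewrite /N pickleK_inv.
  by case: (pickle_inv i) (@pickle_invK I i) => //= a <- <-.
have mN i : measurable (N @^-1` [set i]) by rewrite NE; case: (pickle_inv i) => /=.
have -> : \int[m]_x F (cls x) = \int[m]_x F' (N x).
  by apply: eq_integral => x _; rewrite /F' /N pickleK_inv.
rewrite integral_fibers//.
apply: (@le_trans _ _ (\sum_(i <oo) C%:E * \int[m]_(x in S' i) psi x)).
  apply: lee_nneseries => [i _ _|i _]; first exact: mule_ge0.
  rewrite NE /F' /S'; case: (pickle_inv i) => [a|] /=; first exact: FS.
  by rewrite mul0e mule_ge0// ?lee_fin// integral_ge0.
rewrite nneseriesZl//; last by move=> i _; exact: integral_ge0.
rewrite lee_wpmul2l ?lee_fin//.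
rewrite -ge0_integral_bigcup//.
- apply: ge0_subset_integral => //; exact: bigcup_measurable.
- exact: measurable_funTS.
- move=> i j _ _ [x []]; rewrite /S'.
  case: (pickle_inv i) (@pickle_invK I i) => //= a ai Sa.
  case: (pickle_inv j) (@pickle_invK I j) => //= b bj Sb.
  by rewrite -ai -bj; congr pickle; apply: tS => //; exists x.
Qed.

End cells.

Section shell_averages.
Context (R : realType) (n : nat).
Local Notation mu := (@lebesgue_Rn R n).
Local Notation T := (Rn R n).
Local Notation c := (unit_volume R n).
Local Notation side := (@side R).
Implicit Types (x : 'rV[R]_n) (j k : int) (m : nat).

Definition scale x : int := xget 0 [set k | shell k x].

Lemma scaleP x : x != 0 -> shell (scale x) x.
Proof. by move=> /shell_exists[k kx]; rewrite /scale; case: xgetP => [?|/(_ k)]. Qed.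

Lemma shell_neq0 k x : shell k x -> x != 0.
Proof.
move=> [_ kx]; apply/eqP => x0; apply: kx; apply/centered_cubeP => i.
by rewrite x0 mxE oppr_lt0 side_gt0 ltW// side_gt0.
Qed.

Lemma scale_shell k x : shell k x -> scale x = k.
Proof. by move=> kx; exact: shell_disjoint (scaleP (shell_neq0 kx)) kx. Qed.

Lemma measurable_set0_Rn : measurable ([set 0] : set T).
Proof.
rewrite (_ : [set 0] = ~` \bigcup_k (shell k : set T)).
  apply: measurableC; apply: countable_bigcupT_measurable; first exact: countableP.
  by move=> k; exact: measurable_shell.
apply/seteqP; split => [x -> [k _ /shell_neq0]|x nx]; first by rewrite eqxx.
by apply: contrapT => /eqP /shell_exists[k kx]; apply: nx; exists k.
Qed.

Local Open Scope ereal_scope.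
Variables (psi : T -> \bar R).
Hypotheses (mpsi : measurable_fun setT psi) (psi0 : forall x, 0 <= psi x).

(** The origin is the only point that lies in no shell; it forms the cell None. *)
Definition near_cell m x : option (int * 'rV[int]_n) :=
  if x == 0%R then None else Some (scale x, cube_index (scale x - m%:Z) x).

Definition near_mean m x : \bar R :=
  if x == 0%R then 0
  else (side (scale x - m%:Z) ^- n)%:E *
       \int[mu]_(y in cube_at (scale x - m%:Z) x) psi y.

Definition far_cell x : option int := if x == 0%R then None else Some (scale x).

Definition far_mean m x : \bar R :=
  if x == 0%R then 0
  else (side (scale x + m%:Z) ^- n)%:E *
       \int[mu]_(y in wide_shell (scale x + m%:Z)) psi y.

Let near_cellE m k z :
  near_cell m @^-1` [set Some (k, z)] = shell k `&` cube (k - m%:Z) z.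
Proof.
apply/seteqP; split => x /=.
  rewrite /near_cell; case: eqVneq => // x0 [<- <-].
  by split; [exact: scaleP|exact/cubeP].
move=> [kx /cubeP <-]; rewrite /near_cell (negbTE (shell_neq0 kx)).
by rewrite (scale_shell kx).
Qed.

Let near_cell0 m : near_cell m @^-1` [set None] = [set 0%R].
Proof.
apply/seteqP; split => x /=; rewrite /near_cell; first by case: eqVneq.
by move=> ->; rewrite eqxx.
Qed.

Let measurable_near_cell m a : measurable ((near_cell m : T -> _) @^-1` [set a]).
Proof.
case: a => [[k z]|]; last by rewrite near_cell0; exact: measurable_set0_Rn.
rewrite near_cellE; apply: measurableI; first exact: measurable_shell.
exact: measurable_box.
Qed.

Let near_F m a : \bar R := if a is Some (k, z) then (side (k - m%:Z) ^- n)%:E *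
       \int[mu]_(y in near_cell m @^-1` [set a]) psi y else 0.

Let near_meanE m x : near_mean m x = near_F m (near_cell m x).
Proof.
have [x0|x0] := eqVneq x 0%R; first by rewrite /near_mean /near_cell x0 eqxx.
rewrite /near_mean (negbTE x0).
have -> : near_cell m x = Some (scale x, cube_index (scale x - m%:Z) x).
  by rewrite /near_cell (negbTE x0).
rewrite /near_F near_cellE; congr (_ * _); congr (integral _ _ _).
apply/seteqP; split => y; last by case.
move=> xy; split => //; move/cubeP : xy => /esym/cube_index_coarser xy.
exact: (shell_index_eq xy (scaleP x0)).
Qed.

Lemma near_mean_ge0 m x : 0 <= near_mean m x.
Proof.
rewrite /near_mean; case: ifP => // _; rewrite mule_ge0 ?integral_ge0//.
by rewrite lee_fin invr_ge0 exprn_ge0// ltW// side_gt0.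
Qed.

Lemma far_mean_ge0 m x : 0 <= far_mean m x.
Proof.
rewrite /far_mean; case: ifP => // _; rewrite mule_ge0 ?integral_ge0//.
by rewrite lee_fin invr_ge0 exprn_ge0// ltW// side_gt0.
Qed.

Lemma measurable_near_mean m : measurable_fun setT (near_mean m : T -> \bar R).
Proof.
rewrite (_ : (near_mean m : T -> _) = near_F m \o near_cell m).
  exact: measurable_cells (measurable_near_cell m).
by apply/funext => x; exact: near_meanE.
Qed.

(** For fixed m the cubes of the shells form a partition, and the average over a
    cell, integrated over that cell, is the integral over the cell. *)
Lemma integral_near_mean m : \int[mu]_x near_mean m x <= c%:E * \int[mu]_x psi x.
Proof.
have c0 : (0 <= c)%R by exact: vol_ge0.
under eq_integral => x _ do rewrite near_meanE.
apply: (@integral_cells_le _ _ _ mu _ (near_cell m : T -> _) (near_F m)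
   (fun a => (near_cell m : T -> _) @^-1` [set a]) psi c) => //.
- by move=> a b _ _ [x [/= <- <-]].
- move=> [[k z]|] //=; rewrite mule_ge0 ?integral_ge0//.
  by rewrite lee_fin invr_ge0 exprn_ge0// ltW// side_gt0.
move=> [[k z]|]; last by rewrite mul0e mule_ge0 ?integral_ge0.
rewrite /near_F muleAC lee_wpmul2r ?integral_ge0//.
have sn : (0 < side (k - m%:Z) ^+ n)%R by rewrite exprn_gt0// side_gt0.
rewrite muleC -lee_pdivlMr// ?lte_fin ?invr_gt0//.
rewrite invrK -EFinM -(vol_cube R (k - m%:Z) z) -mu_boxE.
apply: le_measure; rewrite ?inE; [exact: measurable_near_cell|exact: measurable_box|].
by rewrite near_cellE => x [].
Qed.

Let far_cellE k : far_cell @^-1` [set Some k] = shell k.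
Proof.
apply/seteqP; split => x /=.
  by rewrite /far_cell; case: eqVneq => // x0 [<-]; exact: scaleP.
by move=> kx; rewrite /far_cell (negbTE (shell_neq0 kx)) (scale_shell kx).
Qed.

Let measurable_far_cell a : measurable ((far_cell : T -> _) @^-1` [set a]).
Proof.
case: a => [k|]; first by rewrite far_cellE; exact: measurable_shell.
rewrite (_ : _ @^-1` _ = [set 0%R]); first exact: measurable_set0_Rn.
apply/seteqP; split => x /=; rewrite /far_cell; first by case: eqVneq.
by move=> ->; rewrite eqxx.
Qed.

Let far_F j a : \bar R := if a is Some k then (side (k + j) ^- n)%:E *
       \int[mu]_(y in wide_shell (k + j)) psi y else 0.

Let far_meanE m x : far_mean m x = far_F m (far_cell x).
Proof. by rewrite /far_mean /far_F /far_cell; case: eqVneq. Qed.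

Lemma measurable_far_mean m : measurable_fun setT (far_mean m : T -> \bar R).
Proof.
rewrite (_ : (far_mean m : T -> _) = far_F m \o far_cell).
  exact: measurable_cells measurable_far_cell.
by apply/funext => x; exact: far_meanE.
Qed.

Let shell_F m j a : \bar R := if a is Some k then (side (k + m%:Z) ^- n)%:E *
       \int[mu]_(y in shell (k + j)) psi y else 0.

Let shell_F_ge0 m j a : 0 <= shell_F m j a.
Proof.
case: a => [k|] //=; rewrite mule_ge0 ?integral_ge0//.
by rewrite lee_fin invr_ge0 exprn_ge0// ltW// side_gt0.
Qed.

(* wide shells overlap, shells do not *)
Let far_split m a : far_F m a = shell_F m m a + shell_F m (m%:Z + 1) a.
Proof.
case: a => [k|] /=; last by rewrite adde0.
rewrite -ge0_muleDr ?integral_ge0//; congr (_ * _).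
rewrite -ge0_integral_setU//; [|exact: measurable_shell|exact: measurable_shell| |].
- congr (integral _ _ _); rewrite /wide_shell /shell !addrA.
  have := @centered_cube_subset R n (k + m%:Z) (k + m%:Z + 1) ltac:(lia).
  have := @centered_cube_subset R n (k + m%:Z + 1) (k + m%:Z + 1 + 1) ltac:(lia).
  move=> s1 s2; apply/seteqP; split => x /=.
    by move=> [x1 x2]; have [x3|x3] := pselect (centered_cube (k + m%:Z + 1) x); [left|right].
  by move=> [[x1 x2]|[x1 x2]]; split => //; [exact: s1|move=> /s2].
- exact: measurable_funTS.
- apply/eqP/seteqP; split => // x [/shell_disjoint /[apply]]; lia.
Qed.

Let integral_shell m j : \int[mu]_x shell_F m j (far_cell x) <=
  (c * (4 / 2 ^+ m) ^+ n)%:E * \int[mu]_x psi x.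
Proof.
have c0 : (0 <= c)%R by exact: vol_ge0.
have C0 : (0 <= c * (4 / 2 ^+ m) ^+ n)%R by rewrite mulr_ge0// exprn_ge0// divr_ge0.
apply: (@integral_cells_le _ _ _ mu _ (far_cell : T -> _) (shell_F m j)
   (fun a => if a is Some k then shell (k + j) else set0) psi) => //.
- by case=> [k|] //; exact: measurable_shell.
- move=> [k|] [l|] _ _ [x []] //= kx lx; congr Some.
  by have := shell_disjoint kx lx; lia.
move=> [k|] /=; last by rewrite mul0e mule_ge0 ?integral_ge0.
rewrite muleAC lee_wpmul2r ?integral_ge0//.
have sn : (0 < side (k + m%:Z) ^+ n)%R by rewrite exprn_gt0// side_gt0.
rewrite muleC -lee_pdivlMr// ?lte_fin ?invr_gt0//.
rewrite invrK -EFinM -mulrA -exprMn sideDn.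
have -> : (4 / 2 ^+ m * (side k * 2 ^+ m) = side (k + 1 + 1))%R.
  by rewrite !sideS; field; rewrite expf_neq0.
rewrite -mu_centered_cube far_cellE; apply: le_measure; rewrite ?inE.
- exact: measurable_shell.
- exact: measurable_centered_cube.
- exact: subDsetl.
Qed.

(** The shell k has at most the volume of (4 / 2 ^ m) ^ n cubes of side
    2 ^ (k + m), the volume by which integrals over the shell k + m are divided. *)
Lemma integral_far_mean m :
  \int[mu]_x far_mean m x <= (2 * c * (4 / 2 ^+ m) ^+ n)%:E * \int[mu]_x psi x.
Proof.
have m1 := measurable_cells (shell_F m m) measurable_far_cell.
have m2 := measurable_cells (shell_F m (m%:Z + 1)) measurable_far_cell.
have -> : \int[mu]_x far_mean m x =
    \int[mu]_x (shell_F m m (far_cell x) + shell_F m (m%:Z + 1) (far_cell x)).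
  by apply: eq_integral => x _; rewrite far_meanE far_split.
rewrite (ge0_integralD mu measurableT (fun x _ => shell_F_ge0 m m (far_cell x)) m1
  (fun x _ => shell_F_ge0 m (m%:Z + 1) (far_cell x)) m2).
rewrite -mulrA mulr_natl mulr2n EFinD ge0_muleDl; last 2 first.
- by rewrite lee_fin mulr_ge0 ?vol_ge0// exprn_ge0// divr_ge0.
- by rewrite lee_fin mulr_ge0 ?vol_ge0// exprn_ge0// divr_ge0.
by apply: leeD; exact: integral_shell.
Qed.

Variable rho : R.
Hypothesis rho_bound : (0 <= rho < 2 ^+ n)%R.

(** The weight rho ^ m of the far means grows more slowly than the factor
    2 ^ (- m n) of integral_far_mean decays. *)
Definition hardy_term m x : \bar R :=
  ((2 ^+ m)^-1)%:E * near_mean m x + (rho ^+ m)%:E * far_mean m x.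

Definition hardy_majorant x : \bar R := \sum_(m <oo) hardy_term m x.

Let near0 m x : 0 <= ((2 ^+ m)^-1)%:E * near_mean m x.
Proof. by rewrite mule_ge0 ?near_mean_ge0// lee_fin invr_ge0 exprn_ge0. Qed.

Let far0 m x : 0 <= (rho ^+ m)%:E * far_mean m x.
Proof.
have /andP[r0 _] := rho_bound.
by rewrite mule_ge0 ?far_mean_ge0// lee_fin exprn_ge0.
Qed.

Let term_ge0 m x : 0 <= hardy_term m x.
Proof. by rewrite /hardy_term adde_ge0. Qed.

Lemma hardy_majorant_ge0 x : 0 <= hardy_majorant x.
Proof. by apply: nneseries_ge0 => m _ _; exact: term_ge0. Qed.

Lemma hardy_majorant_lb (M : nat) x :
  \sum_(m < M) hardy_term m x <= hardy_majorant x.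
Proof.
rewrite -(big_mkord xpredT (fun m => hardy_term m x)).
by apply: nneseries_lim_ge => m _ _; exact: term_ge0.
Qed.

Let measurable_near m :
  measurable_fun setT (fun x : T => ((2 ^+ m)^-1)%:E * near_mean m x).
Proof. by apply: measurable_funeM; exact: measurable_near_mean. Qed.

Let measurable_far m :
  measurable_fun setT (fun x : T => (rho ^+ m)%:E * far_mean m x).
Proof. by apply: measurable_funeM; exact: measurable_far_mean. Qed.

Let measurable_term m : measurable_fun setT (hardy_term m : T -> \bar R).
Proof. exact: emeasurable_funD (measurable_near m) (measurable_far m). Qed.

Lemma measurable_hardy_majorant : measurable_fun setT (hardy_majorant : T -> \bar R).
Proof.
exact: (@ge0_emeasurable_sum _ _ _ setT (fun m (x : T) => hardy_term m x) xpredT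
  (fun m x _ _ => term_ge0 m x) (fun m _ => measurable_term m)).
Qed.

Definition hardy_const : R := (c * 2 + 2 * c * 4 ^+ n * (1 - rho / 2 ^+ n)^-1)%R.

Lemma hardy_const_ge0 : (0 <= hardy_const)%R.
Proof.
have /andP[r0 r1] := rho_bound; have c0 : (0 <= c)%R := vol_ge0 _ _.
rewrite /hardy_const addr_ge0 ?mulr_ge0 ?exprn_ge0// invr_ge0 subr_ge0.
by rewrite ler_pdivrMr ?exprn_gt0// mul1r ltW.
Qed.

Lemma integral_hardy_majorant : \int[mu]_x psi x < +oo ->
  \int[mu]_x hardy_majorant x <= hardy_const%:E * \int[mu]_x psi x.
Proof.
move=> poo; have /andP[r0 r1] := rho_bound; have c0 : (0 <= c)%R := vol_ge0 _ _.
have p0 : 0 <= \int[mu]_x psi x by exact: integral_ge0.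
rewrite (integral_nneseries mu measurableT measurable_term (fun m x _ => term_ge0 m x)).
pose u m : R := (c * (2^-1) ^+ m + 2 * c * 4 ^+ n * (rho / 2 ^+ n) ^+ m)%R.
have r0' : (0 <= rho / 2 ^+ n)%R by rewrite divr_ge0// exprn_ge0.
have u0 m : (0 <= u m)%R by rewrite /u addr_ge0 ?mulr_ge0 ?exprn_ge0 ?invr_ge0.
apply: (@le_trans _ _ (\sum_(m <oo) (u m)%:E * \int[mu]_x psi x)).
  apply: lee_nneseries => [m _ _|m _].
    by apply: integral_ge0 => x _; exact: term_ge0.
  rewrite /hardy_term (ge0_integralD mu measurableT (fun x _ => near0 m x)
    (measurable_near m) (fun x _ => far0 m x) (measurable_far m)).
  rewrite (ge0_integralZl mu measurableT (measurable_near_mean m)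
    (fun x _ => near_mean_ge0 m x)); last by rewrite lee_fin invr_ge0 exprn_ge0.
  rewrite (ge0_integralZl mu measurableT (measurable_far_mean m)
    (fun x _ => far_mean_ge0 m x)); last by rewrite lee_fin exprn_ge0.
  rewrite /u EFinD ge0_muleDl ?lee_fin ?mulr_ge0 ?exprn_ge0//.
  apply: leeD.
    apply: le_trans (lee_wpmul2l _ (integral_near_mean m)) _.
      by rewrite lee_fin invr_ge0 exprn_ge0.
    by rewrite muleA -EFinM mulrC exprVn.
  apply: le_trans (lee_wpmul2l _ (integral_far_mean m)) _.
    by rewrite lee_fin exprn_ge0.
  rewrite muleA -EFinM lee_wpmul2r// lee_fin le_eqVlt; apply/orP; left; apply/eqP.
  by rewrite !exprMn !exprVn -!exprM (mulnC m n); ring.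
have pfin : \int[mu]_x psi x \is a fin_num by rewrite ge0_fin_numE.
rewrite -(fineK pfin) [leRHS]muleC.
under eq_eseriesr do rewrite muleC.
rewrite nneseriesZl; last by move=> m _; rewrite lee_fin.
rewrite lee_wpmul2l ?lee_fin ?fine_ge0//.
have -> : hardy_const = (c / (1 - 2^-1) + 2 * c * 4 ^+ n / (1 - rho / 2 ^+ n))%R.
  by rewrite /hardy_const; congr (_ + _)%R; field.
rewrite le_eqVlt; apply/orP; left; apply/eqP; apply/cvg_lim => //.
have C1 := @cvg_geometric_series R c 2^-1.
have C2 := @cvg_geometric_series R (2 * c * 4 ^+ n)%R (rho / 2 ^+ n)%R.
rewrite (_ : (fun _ => _) = EFin \o
  (series (geometric c 2^-1) \+ series (geometric (2 * c * 4 ^+ n)%R (rho / 2 ^+ n)%R))%R).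
  apply: cvg_EFin; first by apply: nearW => N.
  apply: cvgD; [apply: C1|apply: C2].
    by rewrite ger0_norm ?invr_ge0// invf_lt1// ltr1n.
  by rewrite ger0_norm// ltr_pdivrMr ?exprn_gt0// mul1r.
by apply/funext => N /=; rewrite sumEFin /series/= -big_split/=.
Qed.

End shell_averages.

(** * Elementary convexity *)

Section convexity.
Context (R : realType).
Implicit Types (q s t lam : R).

Lemma pos_powRD (x r s : R) : 0 < x -> x `^ (r + s) = x `^ r * x `^ s.
Proof. by move=> x0; rewrite powRD // (gt_eqF x0) implybT. Qed.

Lemma powR_pred q t : 0 < q -> 0 <= t -> t `^ (q - 1) * t = t `^ q.
Proof. by move=> q0 t0; rewrite mulrC mulr_powRB1. Qed.

Lemma exprn_powR (m : nat) q t : 0 <= t -> (t ^+ m) `^ q = (t `^ q) ^+ m.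
Proof.
by move=> t0; rewrite -(powR_mulrn m t0) -(powR_mulrn m (powR_ge0 t q)) -!powRrM mulrC.
Qed.

Lemma powR_le_self q t : 1 <= q -> 0 <= t <= 1 -> t `^ q <= t.
Proof.
move=> q1 /andP[t0 t1]; rewrite -(powR_pred (lt_le_trans ltr01 q1) t0) ler_piMl//.
apply: (@le_trans _ _ (1 `^ (q - 1))); last by rewrite powR1.
by rewrite ge0_ler_powR ?nnegrE ?subr_ge0.
Qed.

Lemma powR_ge_self q t : 1 <= q -> 1 <= t -> t <= t `^ q.
Proof. by move=> q1 t1; rewrite -[leLHS]powRr1 ?(le_trans ler01)// ler_powR. Qed.

Lemma powR_inv_pred q t : 0 < t -> t `^ (1 - q) * t `^ (q - 1) = 1.
Proof. by move=> t0; rewrite -pos_powRD// addrA subrK subrr powRr0. Qed.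

(** The only form of Jensen's inequality that is needed: the convex function
    t ^ q lies above a line, up to the additive constant lam. *)
Lemma le_tangent q lam t : 1 <= q -> 0 < lam -> 0 <= t ->
  t <= lam + lam `^ (1 - q) * t `^ q.
Proof.
move=> q1 lam0 t0; have [tl|lt] := leP t lam.
  by rewrite -[leLHS]addr0 lerD// mulr_ge0// powR_ge0.
apply: (@le_trans _ _ (lam `^ (1 - q) * (lam `^ (q - 1) * t))).
  by rewrite mulrA powR_inv_pred// mul1r.
rewrite -[leLHS]add0r lerD ?(ltW lam0)// ler_wpM2l ?powR_ge0//.
rewrite -(powR_pred (lt_le_trans ltr01 q1) t0) ler_wpM2r//.
by rewrite ge0_ler_powR ?nnegrE ?subr_ge0// ltW.
Qed.

Lemma powR_absorb q lam t : 1 <= q -> 0 < lam ->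
  lam <= lam `^ (1 - q) * t -> lam `^ q <= t.
Proof.
move=> q1 lam0; rewrite -(@ler_pM2l _ (lam `^ (q - 1))) ?powR_gt0// mulrA.
rewrite (powR_pred (lt_le_trans ltr01 q1) (ltW lam0)) [X in _ <= X * _]mulrC.
by rewrite powR_inv_pred// mul1r.
Qed.

(** The tangent inequality at the height A / (2 W), summed with the weights: the
    additive constants amount to at most half of the sum A. *)
Lemma power_sum_le (M : nat) (w u : nat -> R) (W q : R) :
  1 <= q -> 1 <= W -> (forall m, 0 <= w m) -> (forall m, 0 <= u m) ->
  \sum_(m < M) w m <= W ->
  ((\sum_(m < M) w m * u m) / (2 * W)) `^ q <= \sum_(m < M) w m * u m `^ q.
Proof.
move=> q1 W1 w0 u0 sW; set A := \sum_(m < M) w m * u m.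
set B := \sum_(m < M) w m * u m `^ q.
have B0 : 0 <= B by apply: sumr_ge0 => m _; rewrite mulr_ge0// powR_ge0.
have A0 : 0 <= A by apply: sumr_ge0 => m _; rewrite mulr_ge0.
have W0 : 0 < 2 * W by lra.
have [->|An0] := eqVneq A 0; first by rewrite mul0r powR0// gt_eqF//; lra.
have [lam lamE] : exists lam, lam = A / (2 * W) by exists (A / (2 * W)).
rewrite -lamE.
have lam0 : 0 < lam by rewrite lamE divr_gt0// lt_neqAle eq_sym An0.
have H : A <= lam * W + lam `^ (1 - q) * B.
  apply: (@le_trans _ _ (\sum_(m < M) w m * (lam + lam `^ (1 - q) * u m `^ q))).
    by apply: ler_sum => m _; rewrite ler_wpM2l// le_tangent.
  under eq_bigr do rewrite mulrDr mulrCA.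
  by rewrite big_split/= -mulr_suml -mulr_sumr mulrC lerD2r ler_wpM2l// ltW.
have AE : A = 2 * (lam * W) by rewrite lamE; field; lra.
have : lam <= lam `^ (1 - q) * B.
  apply: (@le_trans _ _ (lam * W)); first by rewrite ler_peMr// ltW.
  by move: H; rewrite {1}AE; lra.
exact: powR_absorb.
Qed.

Lemma geometric_sum_le (M : nat) (r : R) : 0 <= r < 1 ->
  \sum_(m < M) r ^+ m <= (1 - r)^-1.
Proof.
move=> /andP[r0 r1]; have r1' : 0 < 1 - r by lra.
rewrite -(@ler_pM2l _ (1 - r))// divff ?gt_eqF//.
have := subrX1 r M; move: (\sum_(i < M) r ^+ i) => S E.
have : 0 <= r ^+ M by rewrite exprn_ge0.
by lra.
Qed.

(** The factor 2 ^ m of the far averages is enlarged to (2 s) ^ m in order to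
    leave summable weights s ^ (- m); P < n is what makes room for it. *)
Lemma exists_gain (n : nat) (P : R) : 1 <= P -> P < n%:R ->
  exists2 s : R, 1 < s & 0 <= (2 * s) `^ P < 2 ^+ n.
Proof.
move=> P1 Pn; pose e := (n%:R - P) / (2 * P).
have P0 : 0 < P by lra.
have e0 : 0 < e by rewrite divr_gt0 ?mulr_gt0// subr_gt0.
have lt2 u v : u < v -> 2 `^ u < 2 `^ v :> R.
  move=> uv; rewrite /powR pnatr_eq0/= ltr_expR ltr_pM2r//.
  by rewrite ln_gt0// ltr1n.
exists (2 `^ e); first by rewrite -[ltLHS](powRr0 2) lt2.
rewrite powR_ge0/= -[X in X * _](@powRr1 _ 2)// -pos_powRD//.
rewrite -powRrM -powR_mulrn//.
have -> : (1 + e) * P = (n%:R + P) / 2 by rewrite /e; field; lra.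
by apply: lt2; lra.
Qed.

End convexity.

(** * Hardy's inequality from an averaging estimate *)

Section hardy.
Context (R : realType) (n : nat).
Local Notation mu := (@lebesgue_Rn R n).
Local Notation T := (Rn R n).
Local Notation c := (unit_volume R n).
Local Notation side := (@side R).
Implicit Types (x y : 'rV[R]_n) (E : set T) (j k : int) (m : nat).

Definition volume_bound : R := (1 + c) * 8 ^+ n.

(** Both the cubes and the wide shells that occur in the representation at x
    satisfy this with the same constants: a wide shell of scale j is part of a
    cube of side 8 side j, its points have coordinates at most 4 side j, and
    those of x are at most 2 side j. *)
Definition adapted x j E := [/\ measurable E,
  (mu E <= (volume_bound * side j ^+ n)%:E)%E &
  forall y, E y -> forall i, `|x ord0 i - y ord0 i| <= 6 * side j].

(** For a constant exponent this is Jensen's inequality; for a variable one the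
    point is that q is evaluated at x on the left and at y on the right. *)
Definition power_mean_bound (q phi : T -> R) (K : R) := forall x j E, adapted x j E ->
  mean j E phi `^ q x <= K * mean j E (fun y : T => phi y `^ q y).

Lemma adapted_cube_at x j : adapted x j (cube_at j x).
Proof.
have s0 := @side_gt0 R j; have c0 : 0 <= c := vol_ge0 _ _.
split; first exact: measurable_cube_at.
  rewrite /cube_at /cube mu_boxE vol_cube lee_fin ler_wpM2r ?exprn_ge0 ?(ltW s0)//.
  have : 1 <= 8 ^+ n :> R by rewrite exprn_ege1// ler1n.
  by rewrite /volume_bound; nra.
move=> y yE i; have := cube_at_self j x i; have := yE i.
rewrite /= cube_hiE ler_norml => /andP[? ?] /andP[? ?]; apply/andP; split; lra.
Qed.

Lemma adapted_wide_shell x k m : shell k x ->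
  adapted x (k + m%:Z) (wide_shell (k + m%:Z)).
Proof.
move=> [/centered_cubeP kx _]; set j := k + m%:Z.
have s0 := @side_gt0 R j; have c0 : 0 <= c := vol_ge0 _ _.
have kj : side (k + 1) <= 2 * side j by rewrite -sideS; apply: ler_side; rewrite /j; lia.
have s4 : side (j + 2) = 4 * side j by rewrite sideD mulrC /side /exprz /= -natrX.
have wm := @measurable_wide_shell R n j.
split => //.
  apply: (@le_trans _ _ (mu (centered_cube (j + 2)))).
    by apply: le_measure; rewrite ?inE//; [exact: measurable_centered_cube|exact: subDsetl].
  rewrite mu_centered_cube lee_fin sideS s4 mulrA exprMn mulrA ler_wpM2r ?exprn_ge0 ?(ltW s0)//.
  rewrite -natrM ler_wpM2r ?exprn_ge0//; lra.
move=> y [/centered_cubeP yE _] i; have := yE i; have := kx i.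
by rewrite s4 ler_norml => /andP[? ?] /andP[? ?]; apply/andP; split; lra.
Qed.

Variables (q phi : T -> R) (P K s : R).
Local Notation psi := (fun y : T => phi y `^ q y).
Hypotheses (q1 : forall x, 1 <= q x) (P1 : 1 <= P) (K0 : 0 <= K) (s1 : 1 < s).
Hypothesis (gain : 0 <= (2 * s) `^ P < 2 ^+ n).
Hypotheses (phi0 : forall x, 0 <= phi x) (mpsi : measurable_fun setT psi).
Hypothesis (ipsi : (\int[mu]_x (psi x)%:E < +oo)%E).
Hypothesis (means : power_mean_bound q phi K).

Definition hardy_loss : R := 8 * (1 - s^-1)^-1.

Let EFin_mean j E : measurable E ->
  (mean j E psi)%:E = ((side j ^- n)%:E * \int[mu]_(y in E) (psi y)%:E)%E.
Proof.
move=> mE; rewrite /mean mulrC EFinM /Rintegral fineK//.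
rewrite ge0_fin_numE; last by apply: integral_ge0 => y _; rewrite lee_fin powR_ge0.
apply: le_lt_trans ipsi.
apply: (@ge0_subset_integral _ _ _ mu _ _ mE measurableT (EFin \o psi) _ _ (@subsetT _ E)).
  exact/measurable_EFinP.
by move=> y _; rewrite lee_fin powR_ge0.
Qed.

(** Convexity moves the power inside the two sums. The near weights are summable;
    for the far ones the exponent q x <= P turns (2 s) ^ m into at most rho ^ m. *)
Lemma hardy_pointwise (M : nat) x : x != 0 -> q x <= P ->
  ((((near_sum M phi (scale x) x + far_sum M phi (scale x)) / hardy_loss) `^ q x)%:E
   <= K%:E * hardy_majorant (EFin \o psi) ((2 * s) `^ P) x)%E.
Proof.
move=> x0 qP; set k := scale x; have kx : shell k x := scaleP x0.
set rho := (2 * s) `^ P; have rho0 : 0 <= rho by exact: powR_ge0.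
set W := (1 - s^-1)^-1.
have s1' : (1 : R) < s := s1; have s0 : 0 < s by lra.
have si : 0 <= s^-1 < 1 by rewrite invr_ge0 (ltW s0) invf_lt1.
have W1 : 1 <= W.
  by case/andP: si => ? ?; rewrite /W -invr1 lef_pV2 ?posrE//; lra.
have q0 : 0 < q x by exact: lt_le_trans (q1 x).
set a := near_sum _ _ _ _; set b := far_sum _ _ _.
pose mn m := mean (k - m%:Z) (cube_at (k - m%:Z) x) phi.
pose mf m := mean (k + m%:Z) (wide_shell (k + m%:Z)) phi.
have mn0 m : 0 <= mn m by exact: mean_ge0.
have mf0 m : 0 <= mf m by exact: mean_ge0.
have a0 : 0 <= a.
  by apply: sumr_ge0 => m _; apply: mulr_ge0; [rewrite invr_ge0 exprn_ge0|exact: mn0].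
have b0 : 0 <= b.
  by apply: sumr_ge0 => m _; apply: mulr_ge0; [rewrite exprn_ge0|exact: mf0].
have Ha : (a / 4) `^ q x <= \sum_(m < M) (2 ^+ m)^-1 * mn m `^ q x.
  rewrite (_ : 4 = 2 * 2); last by ring.
  apply: (@power_sum_le _ M (fun m => (2 ^+ m)^-1) mn 2) => //.
    by rewrite ler1n.
  under eq_bigr do rewrite -exprVn.
  have h2 : 0 <= (2^-1 : R) < 1 by apply/andP; split; lra.
  have E2 : (1 - 2^-1)^-1 = 2 :> R by field.
  by rewrite -[leRHS]E2; exact: geometric_sum_le.
have Hb : (b / (2 * W)) `^ q x <= \sum_(m < M) rho ^+ m * mf m `^ q x.
  have -> : b = \sum_(m < M) s^-1 ^+ m * ((2 * s) ^+ m * mf m).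
    apply: eq_bigr => m _; rewrite [RHS]mulrA -exprMn.
    by rewrite (_ : s^-1 * (2 * s) = 2)//; field; rewrite gt_eqF.
  have u0 m : 0 <= (2 * s) ^+ m * mf m.
    by apply: mulr_ge0 (mf0 m); rewrite exprn_ge0// mulr_ge0// ltW.
  apply: (le_trans (@power_sum_le _ M (fun m => s^-1 ^+ m) (fun m => (2 * s) ^+ m * mf m)
           W _ (q1 x) W1 _ u0 _)).
  - by move=> m; rewrite exprn_ge0//; case/andP: si.
  - exact: geometric_sum_le.
  apply: ler_sum => m _.
  have base : 1 <= (2 * s) ^+ m by rewrite exprn_ege1//; lra.
  rewrite powRM ?(le_trans ler01 base)// mulrA ler_wpM2r ?powR_ge0//.
  apply: (@le_trans _ _ (1 * (((2 * s) ^+ m) `^ P))).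
    apply: ler_pM; rewrite ?powR_ge0 ?exprn_ge0//; first by case/andP: si.
    - by case/andP: si => ? ?; rewrite exprn_ile1// ltW.
    - exact: ler_powR.
  by rewrite mul1r exprn_powR//; lra.
have Hab : ((a + b) / hardy_loss) `^ q x <= (a / 4) `^ q x + (b / (2 * W)) `^ q x.
  have L8 : 0 < hardy_loss by rewrite /hardy_loss -/W; lra.
  have mono u v : 0 <= u -> u <= v -> u `^ q x <= v `^ q x.
    move=> u0 uv; rewrite ge0_ler_powR ?nnegrE ?(ltW q0)//.
    exact: le_trans uv.
  have ab0 : 0 <= (a + b) / hardy_loss by rewrite divr_ge0 ?addr_ge0// ltW.
  have [ab|ba] := leP (a / 4) (b / (2 * W)).
    apply: (@le_trans _ _ ((b / (2 * W)) `^ q x)); last first.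
      by rewrite lerDr powR_ge0.
    apply: mono => //; rewrite ler_pdivrMr// /hardy_loss -/W.
    have -> : b / (2 * W) * (8 * W) = 4 * b by field; lra.
    move: ab; rewrite ler_pdivlMr; last lra.
    rewrite mulrAC ler_pdivrMr// => ab.
    by nra.
  apply: (@le_trans _ _ ((a / 4) `^ q x)); last by rewrite lerDl powR_ge0.
  apply: mono => //; rewrite ler_pdivrMr// /hardy_loss -/W.
  have -> : a / 4 * (8 * W) = 2 * W * a by field.
  move: ba; rewrite ltr_pdivrMr; last lra.
  have -> : a / 4 * (2 * W) = W * a / 2 by field.
  by nra.
have ns m : ((mn m `^ q x)%:E <= K%:E * near_mean (EFin \o psi) m x)%E.
  rewrite /near_mean (negbTE x0) -/k -EFin_mean; last exact: measurable_cube_at.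
  by rewrite -EFinM lee_fin; apply: means; exact: adapted_cube_at.
have fs m : ((mf m `^ q x)%:E <= K%:E * far_mean (EFin \o psi) m x)%E.
  rewrite /far_mean (negbTE x0) -/k -EFin_mean; last exact: measurable_wide_shell.
  by rewrite -EFinM lee_fin; apply: means; exact: adapted_wide_shell.
have psi0 y : (0 <= (EFin \o psi) y)%E by rewrite lee_fin powR_ge0.
have nm0 m : (0 <= near_mean (EFin \o psi) m x)%E by exact: near_mean_ge0.
have fm0 m : (0 <= far_mean (EFin \o psi) m x)%E by exact: far_mean_ge0.
apply: (@le_trans _ _ (K%:E * \sum_(m < M) hardy_term (EFin \o psi) rho m x)%E); last first.
  rewrite lee_wpmul2l ?lee_fin//; apply: hardy_majorant_lb => //.
have ht0 m : (0 <= hardy_term (EFin \o psi) rho m x)%E.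
  by rewrite /hardy_term adde_ge0// mule_ge0// lee_fin ?invr_ge0 exprn_ge0.
rewrite ge0_sume_distrr//.
apply: (@le_trans _ _ (\sum_(m < M) ((2 ^+ m)^-1 * mn m `^ q x + rho ^+ m * mf m `^ q x)%:E)%E).
  rewrite sumEFin lee_fin big_split/=; apply: (le_trans Hab).
  exact: lerD.
apply: lee_sum => m _; rewrite /hardy_term EFinD muleDr//; last first.
  by apply: ge0_adde_def; rewrite inE mule_ge0// lee_fin ?invr_ge0 exprn_ge0.
apply: leeD; rewrite EFinM muleCA lee_wpmul2l// lee_fin ?invr_ge0 exprn_ge0//.
Qed.

End hardy.

(** * Log-Hoelder exponents *)

Section euclidean_norm.
Context (R : realType) (n : nat).
Implicit Types (v x y : 'rV[R]_n).

Lemma enorm_ge0 v : 0 <= enorm v.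
Proof. exact: sqrtr_ge0. Qed.

Lemma enorm_coord v i : `|v ord0 i| <= enorm v.
Proof.
rewrite -sqrtr_sqr /enorm ler_wsqrtr// (bigD1 i)//= lerDl.
by apply: sumr_ge0 => j _; exact: sqr_ge0.
Qed.

Lemma enorm_le v (B : R) : 0 <= B -> (forall i, `|v ord0 i| <= B) ->
  enorm v <= n%:R * B.
Proof.
move=> B0 vB; have nB : 0 <= n%:R * B by rewrite mulr_ge0.
rewrite -(ger0_norm nB) -sqrtr_sqr /enorm ler_wsqrtr//.
apply: (@le_trans _ _ (\sum_(i < n) B ^+ 2)).
  by apply: ler_sum => i _; rewrite -real_normK ?num_real// ler_sqr ?nnegrE.
rewrite sumr_const card_ord exprMn -[leLHS]mulr_natl ler_wpM2r ?sqr_ge0//.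
by rewrite -natrX ler_nat; case: (n) => // m; rewrite leq_pmull.
Qed.

Lemma enorm_sub_eq0 x y : enorm (x - y) = 0 -> x = y.
Proof.
move=> H; apply/rowP => i; apply/eqP; rewrite -subr_eq0 -normr_le0.
by rewrite -H; have := enorm_coord (x - y) i; rewrite !mxE.
Qed.

End euclidean_norm.

Section log_holder_exponent.
Context (R : realType) (n : nat).
Implicit Types (x y : 'rV[R]_n) (q : 'rV[R]_n -> R).

Lemma ln_e_ge1 x : 1 <= ln (expR 1 + enorm x).
Proof.
rewrite -[leLHS]expRK ler_ln ?posrE ?expR_gt0//.
  by rewrite lerDl enorm_ge0.
by rewrite ltr_wpDr ?enorm_ge0 ?expR_gt0.
Qed.

Record log_holder_real q (C0 Cinf qinf : R) : Prop := LogHolderReal {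
  lhr_C0 : 0 <= C0;
  lhr_Cinf : 0 <= Cinf;
  lhr_local : forall x y, 0 < enorm (x - y) < 2^-1 ->
    `|q x - q y| <= C0 / - ln (enorm (x - y));
  lhr_decay : forall x, `|q x - qinf| <= Cinf / ln (expR 1 + enorm x) }.

Lemma log_holder_fine (p : 'rV[R]_n -> \bar R) : log_holder p ->
  (forall x, p x = (fine (p x))%:E) /\
  exists C0 Cinf qinf, log_holder_real (fine \o p) C0 Cinf qinf.
Proof.
move=> [[C0 HC0] [Cinf [pinf Hinf]]].
have pE x : p x = (fine (p x))%:E.
  by rewrite fineK// fin_numE; have := Hinf x; case: (p x).
split => //; exists `|C0|, `|Cinf|, pinf; split => //.
- move=> x y xy; have := HC0 x y xy; rewrite pE (pE y) -EFinB lee_fin.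
  move=> /le_trans; apply; rewrite ler_wpM2r ?ler_norm// invr_ge0 oppr_ge0.
  by case/andP: xy => ? ?; rewrite ln_le0// ltW// (lt_trans (y := 2^-1))// invf_lt1// ltr1n.
- move=> x; have := Hinf x; rewrite pE -EFinB lee_fin.
  move=> /le_trans; apply; rewrite ler_wpM2r ?ler_norm// invr_ge0.
  exact: le_trans (ln_e_ge1 x).
Qed.

Variables (q : 'rV[R]_n -> R) (C0 Cinf qinf : R).
Hypothesis lhq : log_holder_real q C0 Cinf qinf.

Lemma log_holder_near_inf x : `|q x - qinf| <= Cinf.
Proof.
apply: le_trans (lhr_decay lhq x) _; have L := ln_e_ge1 x.
rewrite ler_pdivrMr ?(lt_le_trans ltr01 L)// ler_peMr//.
exact: lhr_Cinf lhq.
Qed.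

(** At distances of order l the exponents differ by a multiple of 1 / ln (1 / l),
    so that factors l ^ (q x - q y) stay bounded. For l bounded away from 0 it is
    enough that q is bounded, which the decay condition ensures. *)
Lemma log_holder_at_scale (D : R) : 1 <= D -> exists2 K : R, 0 <= K &
  forall x y (l : R), 0 < l < 1 -> enorm (x - y) <= D * l ->
  `|q x - q y| * - ln l <= K.
Proof.
move=> D1; have C00 := lhr_C0 lhq; have Ci0 := lhr_Cinf lhq.
have D0 : 0 < D by lra.
pose L := ln (4 * D ^+ 2).
have D2 : 1 <= D ^+ 2 by rewrite exprn_ege1.
have L0 : 0 <= L by rewrite ln_ge0//; lra.
exists (2 * C0 + 2 * Cinf * L).
  by rewrite addr_ge0 ?mulr_ge0.
move=> x y l /andP[l0 l1] xy.
have lnl : 0 <= - ln l by rewrite oppr_ge0 ln_le0// ltW.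
have [lsmall|lbig] := leP l (4 * D ^+ 2)^-1.
  apply: (@le_trans _ _ (2 * C0)); last by rewrite lerDl !mulr_ge0.
  have [d0|d0] := eqVneq (enorm (x - y)) 0.
    by rewrite (enorm_sub_eq0 d0) subrr normr0 mul0r mulr_ge0.
  have dp : 0 < enorm (x - y) by rewrite lt_neqAle eq_sym d0 enorm_ge0.
  have l4 : l * (4 * D ^+ 2) <= 1.
    by rewrite -ler_pdivlMr ?mul1r// mulr_gt0// exprn_gt0.
  have Dl : D * l < 2^-1 by nra.
  have dl : 0 < enorm (x - y) < 2^-1 by rewrite dp (le_lt_trans xy).
  have := lhr_local lhq dl; set d := enorm _ in dp xy dl *.
  have lnd : 2 * (- ln d) >= - ln l.
    (* l <= D^-2 gives D * l <= sqrt l *)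
    have dd : d ^+ 2 <= l.
      apply: (@le_trans _ _ ((D * l) ^+ 2)); last first.
        by rewrite exprMn [l ^+ 2]expr2; nra.
      by rewrite ler_sqr ?nnegrE// ?(ltW dp)// mulr_ge0// ltW.
    rewrite mulrN lerN2 mulr_natl -lnXn// ler_ln ?posrE ?exprn_gt0//.
  have lnd0 : 0 < - ln d.
    by rewrite oppr_gt0 ln_lt0// dp/=; case/andP: dl => _ ?; lra.
  rewrite ler_pdivlMr// => H.
  have q0 := normr_ge0 (q x - q y); nra.
have lnL : - ln l <= L.
  rewrite -lnV ?posrE// /L ler_ln ?posrE ?invr_gt0 ?mulr_gt0 ?exprn_gt0//.
  by rewrite -[leRHS]invrK lef_pV2 ?posrE ?invr_gt0 ?mulr_gt0 ?exprn_gt0// ltW.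
have := log_holder_near_inf x; have := log_holder_near_inf y => qy qx.
have qxy : `|q x - q y| <= 2 * Cinf.
  rewrite -(subrKA qinf) (le_trans (ler_normD _ _))// [`|qinf - _|]distrC; lra.
apply: (@le_trans _ _ (2 * Cinf * L)); last by rewrite lerDr mulr_ge0.
by apply: ler_pM.
Qed.

(** The power n + 1 makes it integrable. *)
Definition decay_error x : R := (expR 1 + enorm x) ^- n.+1.

Lemma decay_error_ge0 x : 0 <= decay_error x.
Proof. by rewrite invr_ge0 exprn_ge0// addr_ge0 ?expR_ge0 ?enorm_ge0. Qed.

Let expR1_enorm_ge1 x : 1 <= expR 1 + enorm x.
Proof.
rewrite -[leLHS]addr0 lerD ?enorm_ge0//.
by rewrite -[leLHS]expR0 ler_expR.
Qed.

(** Below 1, either t is at most the error term, or its size is polynomial in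
    |x| and the decay condition makes t ^ (q x - qinf) bounded. *)
Lemma decay_compare (r1 r2 : 'rV[R]_n -> R) x t :
  1 <= r1 x -> `|r1 x - r2 x| <= Cinf / ln (expR 1 + enorm x) -> 0 <= t <= 1 ->
  t `^ r1 x <= expR (n.+1%:R * Cinf) * t `^ r2 x + decay_error x.
Proof.
move=> r1x r12 /andP[t0 t1].
have B0 : 0 < expR 1 + enorm x := lt_le_trans ltr01 (expR1_enorm_ge1 x).
have e0 := decay_error_ge0 x.
have E0 : 0 <= expR (n.+1%:R * Cinf) * t `^ r2 x by rewrite mulr_ge0 ?expR_ge0 ?powR_ge0.
have [te|et] := leP t (decay_error x).
  apply: (@le_trans _ _ t); last lra.
  by apply: powR_le_self => //; rewrite t0.
have tp : 0 < t by exact: le_lt_trans et.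
apply: (@le_trans _ _ (expR (n.+1%:R * Cinf) * t `^ r2 x)); last by rewrite lerDl.
rewrite /powR gt_eqF// -expRD ler_expR -lerBlDr -mulrBl.
have Ln : - ln t <= n.+1%:R * ln (expR 1 + enorm x).
  rewrite mulr_natl -lnXn// -lnV ?posrE// ler_ln ?posrE ?invr_gt0 ?exprn_gt0//.
  by rewrite -[leRHS]invrK lef_pV2 ?posrE ?invr_gt0 ?exprn_gt0// ltW.
have L1 := ln_e_ge1 x; set L := ln (expR 1 + _) in r12 Ln L1.
have lt0 : ln t <= 0 by exact: ln_le0.
have Lp : 0 < L by lra.
apply: (@le_trans _ _ (`|r1 x - r2 x| * - ln t)).
  by rewrite -mulrNN ler_wpM2r ?oppr_ge0// -normrN ler_norm.
apply: (@le_trans _ _ (Cinf / L * (n.+1%:R * L))).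
  by apply: ler_pM; rewrite ?oppr_ge0.
by rewrite mulrCA divfK// gt_eqF.
Qed.

End log_holder_exponent.

(** * Power mean inequalities *)

Section power_means.
Context (R : realType) (n : nat).
Local Notation mu := (@lebesgue_Rn R n).
Local Notation T := (Rn R n).
Local Notation side := (@side R).
Local Notation V := (volume_bound R n).
Implicit Types (x y : 'rV[R]_n) (E : set T) (j k : int).

Lemma volume_bound_ge1 : 1 <= V.
Proof.
have c0 : 0 <= unit_volume R n := vol_ge0 _ _.
have : 1 <= 8 ^+ n :> R by rewrite exprn_ege1// ler1n.
by rewrite /volume_bound; nra.
Qed.

Lemma adapted_lty x j E : adapted x j E -> (mu E < +oo)%E.
Proof. by move=> [_ + _] => /le_lt_trans; apply; rewrite ltry. Qed.

(** Averaging phi <= lam + B psi with lam half of the mean of phi, so that lam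
    can be absorbed. With the tangent inequality for B psi this plays the role
    of Jensen's inequality. *)
Lemma mean_absorb x j E (phi psi : T -> R) (B : R) (lam := mean j E phi / V / 2) :
  adapted x j E -> mu.-integrable E (EFin \o phi) -> mu.-integrable E (EFin \o psi) ->
  (forall y, 0 <= phi y) -> (forall y, 0 <= psi y) -> 0 <= B ->
  (forall y, E y -> phi y <= lam + B * psi y) -> lam <= B * mean j E psi.
Proof.
move=> aE iphi ipsi phi0 psi0 B0 H; have V1 := volume_bound_ge1.
have [mE muE _] := aE; have Eoo := adapted_lty aE.
have sn : 0 < side j ^+ n by rewrite exprn_gt0// side_gt0.
have lam0 : 0 <= lam.
  by apply: divr_ge0 => //; apply: divr_ge0; [exact: mean_ge0|exact: le_trans V1].
have ilam : mu.-integrable E (EFin \o fun=> lam).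
  by apply: (@bounded_integrable _ _ _ _ `|lam|) => //; exact: measurable_cst.
have iB : mu.-integrable E (EFin \o (fun y => B * psi y)).
  by rewrite (_ : _ \o _ = (fun y => B%:E * (EFin \o psi) y)%E)//; exact: integrableZl.
have isum : mu.-integrable E (EFin \o (fun y => lam + B * psi y)).
  pose h y := (B * psi y)%R.
  rewrite (_ : _ \o _ = (EFin \o (fun=> lam)) \+ (EFin \o h))%E//.
  by have := integrableD mE ilam iB.
have : \int[mu]_(y in E) phi y <= \int[mu]_(y in E) (lam + B * psi y).
  exact: le_Rintegral.
rewrite (RintegralD mE ilam iB) (Rintegral_cst mu mE) (RintegralZl _ mE ipsi).
have fE : fine (mu E) <= V * side j ^+ n.
  by rewrite -lee_fin fineK// ge0_fin_numE.
have : \int[mu]_(y in E) phi y = 2 * V * side j ^+ n * lam.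
  rewrite /lam /mean; field; rewrite gt_eqF// ?gt_eqF//; lra.
move=> ->; rewrite /mean.
have : 0 <= \int[mu]_(y in E) psi y by exact: Rintegral_ge0.
move: (\int[mu]_(y in E) psi y) => I I0 HI.
rewrite mulrA ler_pdivlMr//.
have e1 := ler_wpM2l lam0 fE.
have e2 : lam * side j ^+ n <= lam * (V * side j ^+ n).
  by rewrite ler_wpM2l// ler_peMl// ltW.
have e3 : 2 * V * side j ^+ n * lam = 2 * (lam * (V * side j ^+ n)) by ring.
by lra.
Qed.

(** Splitting off the constant that relates a mean to the height lam of
    mean_absorb. *)
Lemma mean_lamE j E phi : mean j E phi = 2 * V * (mean j E phi / V / 2).
Proof. by have V1 := volume_bound_ge1; field; lra. Qed.

Lemma power_mean_const (r : R) (phi : T -> R) : 1 <= r ->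
  measurable_fun setT phi -> (exists B, forall y, `|phi y| <= B) ->
  (forall y, 0 <= phi y) -> measurable_fun setT (fun y : T => phi y `^ r) ->
  power_mean_bound (fun=> r) phi ((2 * V) `^ r).
Proof.
move=> r1 mphi [B phiB] phi0 mpsi x j E aE.
have [mE muE _] := aE; have Eoo := adapted_lty aE; have V1 := volume_bound_ge1.
have iphi := bounded_integrable mE Eoo mphi phiB.
have ipsi : mu.-integrable E (EFin \o (fun y : T => phi y `^ r)).
  apply: (bounded_integrable (B := B `^ r) mE Eoo mpsi) => y.
  rewrite ger0_norm ?powR_ge0// ge0_ler_powR ?nnegrE//; first lra.
    by rewrite (le_trans _ (phiB y)).
  by rewrite (le_trans (ler_norm _)).
rewrite [in leLHS]mean_lamE.
set lam := mean j E phi / V / 2.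
have lam0 : 0 <= lam.
  by apply: divr_ge0 => //; apply: divr_ge0; [exact: mean_ge0|exact: le_trans V1].
rewrite powRM//; last by lra.
rewrite ler_wpM2l ?powR_ge0//.
have [->|lamn0] := eqVneq lam 0.
  rewrite powR0 ?gt_eqF//; first by apply: mean_ge0 => y; exact: powR_ge0.
  by lra.
have lamp : 0 < lam by rewrite lt_neqAle eq_sym lamn0.
apply: (powR_absorb r1 lamp).
exact: (mean_absorb aE iphi ipsi phi0 (fun y => powR_ge0 _ _) (powR_ge0 lam (1 - r))
   (fun y _ => le_tangent r1 lamp (phi0 y))).
Qed.

Variables (q : 'rV[R]_n -> R) (C0 Cinf qinf : R).
Hypotheses (lhq : log_holder_real q C0 Cinf qinf) (q1 : forall x, 1 <= q x).

(** For values in {0} U [1, oo[ no error term is needed: a mean below 1 is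
    compared through phi <= phi ^ q. A mean above 1 is at most side j ^ (- n),
    because phi <= phi ^ q has integral at most 1, so that side j < 1 and
    changing the exponent from q y to q x costs a bounded factor. *)
Lemma power_mean_variable : exists2 K : R, 0 <= K & forall phi : T -> R,
  measurable_fun setT phi -> (exists B, forall y, `|phi y| <= B) ->
  (forall y, phi y = 0 \/ 1 <= phi y) ->
  measurable_fun setT (fun y : T => phi y `^ q y) ->
  (\int[mu]_y (phi y `^ q y)%:E <= 1)%E ->
  power_mean_bound q phi K.
Proof.
have V1 := volume_bound_ge1.
have D1 : 1 <= 6 * n.+1%:R :> R by rewrite -natrM ler1n.
have [K K0 HK] := log_holder_at_scale lhq D1.
exists ((2 * V) `^ (qinf + Cinf) * expR (n%:R * K)).
  by rewrite mulr_ge0 ?powR_ge0 ?expR_ge0.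
move=> phi mphi [B phiB] phi01 mpsi psi1 x j E aE.
have phi0 y : 0 <= phi y by case: (phi01 y) => [->//|]; exact: le_trans.
have [mE muE dE] := aE; have Eoo := adapted_lty aE.
have psi0 y : 0 <= phi y `^ q y by exact: powR_ge0.
have iphi := bounded_integrable mE Eoo mphi phiB.
have psiE : (\int[mu]_(y in E) (phi y `^ q y)%:E <= 1)%E.
  apply: le_trans psi1.
  apply: (@ge0_subset_integral _ _ _ mu _ _ mE measurableT
    (fun y => (phi y `^ q y)%:E) _ _ (@subsetT _ E)).
    exact/measurable_EFinP.
  by move=> y _; rewrite lee_fin.
have ipsi : mu.-integrable E (EFin \o (fun y : T => phi y `^ q y)).
  apply/integrableP; split; first by apply/measurable_EFinP; exact: measurable_funTS.
  under eq_integral => y _ do rewrite /= ger0_norm//.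
  by apply: le_lt_trans psiE _; rewrite ltry.
have phipsi y : phi y <= phi y `^ q y.
  by case: (phi01 y) => [->|?]; [exact: powR_ge0|exact: powR_ge_self].
rewrite [in leLHS]mean_lamE.
set lam := mean j E phi / V / 2.
have lam0 : 0 <= lam.
  by apply: divr_ge0 => //; apply: divr_ge0; [exact: mean_ge0|exact: le_trans V1].
have qb : q x <= qinf + Cinf.
  by have := log_holder_near_inf lhq x; rewrite ler_norml => /andP[_ ?]; lra.
rewrite powRM//; last by lra.
rewrite -mulrA; apply: ler_pM; rewrite ?powR_ge0//.
  by apply: ler_powR => //; lra.
have M0 : 0 <= mean j E (fun y : T => phi y `^ q y) by exact: mean_ge0.
have e1 : 1 <= expR (n%:R * K) by rewrite -[leLHS]expR0 ler_expR mulr_ge0.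
have [lam1|lam1] := leP lam 1.
  apply: (@le_trans _ _ lam); first by apply: powR_le_self => //; rewrite lam0.
  apply: (@le_trans _ _ (1 * mean j E (fun y : T => phi y `^ q y))).
    apply: (mean_absorb aE iphi ipsi phi0 psi0) => // y _.
    by rewrite mul1r (le_trans (phipsi y))// lerDr.
  by rewrite ler_wpM2r.
have lamp : 0 < lam by lra.
have sj := @side_gt0 R j; have sn : 0 < side j ^+ n by rewrite exprn_gt0.
have lamle : lam <= side j ^- n.
  rewrite /lam /mean -mulrA -[leRHS]mul1r mulrAC.
  have I1 : \int[mu]_(y in E) phi y <= 1.
    apply: (@le_trans _ _ (\int[mu]_(y in E) (phi y `^ q y))).
      exact: le_Rintegral.
    by rewrite -lee_fin /Rintegral fineK//; exact: integrable_fin_num.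
  have I0 : 0 <= \int[mu]_(y in E) phi y by exact: Rintegral_ge0.
  rewrite ler_wpM2r ?invr_ge0 ?(ltW sn)//.
  rewrite -[leRHS]mulr1; apply: ler_pM => //.
    by rewrite mulr_ge0 ?invr_ge0//; lra.
  rewrite -invfM invf_le1; last by lra.
  by lra.
have l01 : 0 < side j < 1.
  rewrite sj /= ltNge; apply/negP => j1.
  have : 1 <= side j ^+ n by rewrite exprn_ege1.
  rewrite -invf_le1 ?exprn_gt0// => /(le_trans lamle).
  by rewrite leNgt lam1.
have lnlam : ln lam <= n%:R * - ln (side j).
  rewrite mulrN mulr_natl -lnXn// -lnV ?posrE// ler_ln ?posrE ?invr_gt0//.
have cmp y : E y -> lam `^ (1 - q y) <= lam `^ (1 - q x) * expR (n%:R * K).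
  move=> Ey; have -> : 1 - q y = (1 - q x) + (q x - q y) by rewrite addrA subrK.
  rewrite pos_powRD// ler_wpM2l ?powR_ge0// /powR gt_eqF// ler_expR.
  have xy : enorm (x - y) <= 6 * n.+1%:R * side j.
    apply: (@le_trans _ _ (n%:R * (6 * side j))).
      by apply: enorm_le => [|i]; [rewrite mulr_ge0// ltW|rewrite !mxE; exact: dE].
    by rewrite mulrCA -mulrA ler_wpM2l// ler_wpM2r ?(ltW sj)// ler_nat.
  have := HK x y (side j) l01 xy => HKxy.
  apply: (@le_trans _ _ (`|q x - q y| * (n%:R * - ln (side j)))).
    apply: (@le_trans _ _ (`|q x - q y| * ln lam)).
      by rewrite ler_wpM2r ?ler_norm// ln_ge0// ltW.
    by rewrite ler_wpM2l.
  by rewrite mulrCA ler_wpM2l.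
have HB y : E y -> phi y <= lam + (lam `^ (1 - q x) * expR (n%:R * K)) * phi y `^ q y.
  move=> Ey; apply: (le_trans (le_tangent (q1 y) lamp (phi0 y))).
  by rewrite lerD2l ler_wpM2r// cmp.
have B0 : 0 <= lam `^ (1 - q x) * expR (n%:R * K) by rewrite mulr_ge0 ?powR_ge0 ?expR_ge0.
apply: (powR_absorb (q1 x) lamp); rewrite mulrA.
exact: (mean_absorb aE iphi ipsi phi0 psi0 B0 HB).
Qed.

End power_means.

(** * The error term is integrable *)

Section decay_integral.
Context (R : realType) (n : nat).
Local Notation mu := (@lebesgue_Rn R n).
Local Notation T := (Rn R n).
Local Notation c := (unit_volume R n).

Lemma measurable_inv_ge0 d (X : measurableType d) (f : X -> R) :
  (forall x, 0 <= f x) -> measurable_fun setT f -> measurable_fun setT (fun x => (f x)^-1).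
Proof.
move=> f0 mf; rewrite (_ : (fun x => _) = (@powR R ^~ (-1)) \o f).
  exact: measurableT_comp (measurable_powR _) mf.
by apply/funext => x /=; rewrite powR_inv1.
Qed.

Lemma measurable_coord i : measurable_fun setT (fun x : T => x ord0 i : R).
Proof. by apply: continuous_measurable_Rn => x; exact: coord_continuous. Qed.

Lemma measurable_enorm (F : T -> 'rV[R]_n) :
  (forall i, measurable_fun setT (fun x => F x ord0 i)) ->
  measurable_fun setT (fun x => enorm (F x)).
Proof.
move=> mF; apply: (measurableT_comp (continuous_measurable_fun (@sqrt_continuous R))).
apply: measurable_sum => i; exact: measurable_funX.
Qed.

Lemma measurable_enorm_id : measurable_fun setT (@enorm R n : T -> R).
Proof. exact: measurable_enorm measurable_coord. Qed.

Lemma measurable_decay_error : measurable_fun setT (@decay_error R n : T -> R).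
Proof.
apply: measurable_inv_ge0 => [x|].
  by rewrite exprn_ge0// addr_ge0 ?expR_ge0 ?enorm_ge0.
apply: measurable_funX; apply: measurable_funD; first exact: measurable_cst.
exact: measurable_enorm_id.
Qed.

Lemma enorm_out_centered_cube k (x : 'rV[R]_n) : ~ centered_cube k x -> side R k <= enorm x.
Proof.
move=> kx; rewrite leNgt; apply/negP => xk; apply: kx; apply/centered_cubeP => i.
have := le_lt_trans (enorm_coord x i) xk.
by rewrite ltr_norml => /andP[-> /ltW].
Qed.

Local Open Scope ereal_scope.

(** On the cube of side 2 ^ (j + 1) outside the one of half its side the error is
    of order 2 ^ (- j (n + 1)), and the volume is of order 2 ^ (j n). *)
Lemma integral_decay_error : exists B : R,
  \int[mu]_x (decay_error x)%:E <= B%:E.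
Proof.
pose b (j : nat) : R := ((2 / 2 ^+ j) ^+ n.+1)%R.
have b0 j : (0 <= b j)%R by rewrite exprn_ge0// divr_ge0// exprn_ge0.
pose h (j : nat) (x : T) := (b j)%:E * (\1_(centered_cube j%:Z : set T) x)%:E.
have h0 j x : 0 <= h j x by rewrite /h mule_ge0// lee_fin.
have mI (j : nat) : measurable_fun setT (fun x : T => (\1_(centered_cube j%:Z : set T) x)%:E : \bar R).
  by apply/measurable_EFinP; apply: measurable_indic; exact: measurable_centered_cube.
have mh j : measurable_fun setT (h j) by exact: measurable_funeM.
have err x : (decay_error x)%:E <= \sum_(j <oo) h j x.
  have [M Mx] := centered_cube_exists x.
  have H : exists m, `[< centered_cube m%:Z x >] by exists M; apply/asboolP.
  have [m /asboolP mx mmin] := find_ex_minn H.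
  apply: (@le_trans _ _ (h m x)).
    rewrite /h indicE mem_set//= mule1 lee_fin /decay_error /b -[leLHS]exprVn.
    have E0 : (0 < expR 1 + enorm x)%R by rewrite ltr_wpDr ?enorm_ge0 ?expR_gt0.
    rewrite ler_pXn2r ?nnegrE ?invr_ge0 ?(ltW E0) ?divr_ge0 ?exprn_ge0//.
    rewrite -[leRHS]invrK lef_pV2 ?posrE ?invr_gt0 ?divr_gt0 ?exprn_gt0//.
    rewrite invf_div; case: m mx mmin => [|m] mx mmin.
      rewrite expr0; apply: (@le_trans _ _ (expR 1)); last by rewrite lerDl enorm_ge0.
      by apply: (@le_trans _ _ (expR 0)); rewrite ?ler_expR// expR0; lra.
    have nm : ~ centered_cube m%:Z x by move=> /asboolP/mmin; rewrite ltnn.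
    have := enorm_out_centered_cube nm; rewrite side_nat exprS mulrAC divff// mul1r.
    by move=> /le_trans; apply; rewrite lerDr expR_ge0.
  apply: (@le_trans _ _ (\sum_(0 <= j < m.+1) h j x)).
    by rewrite big_nat_recr//= leeDr// sume_ge0.
  exact: nneseries_lim_ge.
have mS : measurable_fun setT (fun x : T => \sum_(j <oo) h j x).
  exact: (@ge0_emeasurable_sum _ _ _ setT h xpredT (fun k x _ _ => h0 k x) (fun k _ => mh k)).
exists (c * 2 ^+ n.+1 * 2 ^+ n * 2)%R.
apply: (@le_trans _ _ (\int[mu]_x \sum_(j <oo) h j x)).
  apply: (ge0_le_integral mu measurableT) mS _.
  - by move=> x _; rewrite lee_fin decay_error_ge0.
  - by apply/measurable_EFinP; exact: measurable_decay_error.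
  - by move=> x _; exact: err.
rewrite (integral_nneseries mu measurableT mh (fun k x _ => h0 k x)).
pose u : R := (c * 2 ^+ n.+1 * 2 ^+ n)%R.
have -> : \sum_(j <oo) \int[mu]_x h j x = \sum_(j <oo) (u * 2^-1 ^+ j)%:E.
  apply: eq_eseriesr => j _.
  rewrite /h (ge0_integralZl mu measurableT (mI j)); last 2 first.
  - by move=> x _; rewrite lee_fin.
  - by rewrite lee_fin.
  rewrite integral_indic//; last exact: measurable_centered_cube.
  rewrite setIT [X in _ * X](_ : _ = (c * side R (j%:Z + 1) ^+ n)%:E); last exact: mu_centered_cube.
  rewrite -EFinM; congr EFin.
  rewrite sideS side_nat /b /u (exprVn _ j).
  have : (2 ^+ j != 0 :> R)%R by rewrite expf_neq0.
  move: (2 ^+ j)%R => a a0; rewrite (exprMn _ 2%R a^-1%R) (exprMn _ 2%R a) exprVn !exprS.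
  have : (a ^+ n != 0)%R by rewrite expf_neq0.
  by move: (a ^+ n)%R => v v0; field; rewrite a0 v0.
rewrite le_eqVlt; apply/orP; left; apply/eqP; apply/cvg_lim => //.
rewrite (_ : (fun _ => _) = EFin \o (series (geometric u 2^-1))).
  apply: cvg_EFin; first by apply: nearW => N.
  have -> : (c * 2 ^+ n.+1 * 2 ^+ n * 2 = u / (1 - 2^-1))%R by rewrite /u; field.
  by apply: cvg_geometric_series; rewrite ger0_norm ?invr_ge0// invf_lt1// ltr1n.
by apply/funext => N /=; rewrite sumEFin /series.
Qed.

End decay_integral.

(** * The modular inequality *)

Section split.
Context (R : realType) (n : nat).
Local Notation mu := (@lebesgue_Rn R n).
Local Notation T := (Rn R n).
Implicit Types (x y : 'rV[R]_n) (E : set T) (g : T -> R).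

Definition large_part g (y : T) : R := if 1 <= g y then g y else 0.
Definition small_part g (y : T) : R := if 1 <= g y then 0 else g y.

Lemma large_small g y : g y = large_part g y + small_part g y.
Proof. by rewrite /large_part /small_part; case: ifP; rewrite ?addr0 ?add0r. Qed.

Lemma large_part01 g y : large_part g y = 0 \/ 1 <= large_part g y.
Proof. by rewrite /large_part; case: ifP; [right|left]. Qed.

Lemma measurable_large_part g :
  measurable_fun setT g -> measurable_fun setT (large_part g).
Proof.
move=> mg; apply: measurable_fun_ifT; [|exact: mg|exact: measurable_cst].
exact: measurable_fun_ler (measurable_cst _) mg.
Qed.

Lemma measurable_small_part g :
  measurable_fun setT g -> measurable_fun setT (small_part g).
Proof.
move=> mg; apply: measurable_fun_ifT; [|exact: measurable_cst|exact: mg].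
exact: measurable_fun_ler (measurable_cst _) mg.
Qed.

Variable g : T -> R.
Hypotheses (mg : measurable_fun setT g) (g0 : forall y, 0 <= g y).
Hypothesis gB : exists B, forall y, `|g y| <= B.

Lemma large_part_ge0 y : 0 <= large_part g y.
Proof. by rewrite /large_part; case: ifP. Qed.

Lemma small_part_ge0 y : 0 <= small_part g y.
Proof. by rewrite /small_part; case: ifP. Qed.

Lemma small_part_le1 y : small_part g y <= 1.
Proof. by rewrite /small_part; case: ifPn => //; rewrite -ltNge => /ltW. Qed.

Lemma large_part_bounded : exists B, forall y, `|large_part g y| <= B.
Proof.
have [B HB] := gB; exists B => y; rewrite /large_part; case: ifP => // _.
by rewrite normr0 (le_trans _ (HB y)).
Qed.

Lemma small_part_bounded : exists B, forall y, `|small_part g y| <= B.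
Proof. by exists 1 => y; rewrite ger0_norm ?small_part_ge0// small_part_le1. Qed.

Let mean_split j E : measurable E -> (mu E < +oo)%E ->
  mean j E g = mean j E (large_part g) + mean j E (small_part g).
Proof.
move=> mE Eoo; rewrite /mean -mulrDl; congr (_ / _).
have [B0 H0] := large_part_bounded; have [B1 H1] := small_part_bounded.
have i0 := bounded_integrable mE Eoo (measurable_large_part mg) H0.
have i1 := bounded_integrable mE Eoo (measurable_small_part mg) H1.
rewrite -(RintegralD mE i0 i1); apply: eq_Rintegral => y _; exact: large_small.
Qed.

Lemma near_sum_split M k x :
  near_sum M g k x = near_sum M (large_part g) k x + near_sum M (small_part g) k x.
Proof.
rewrite /near_sum -big_split/=; apply: eq_bigr => m _; rewrite -mulrDr; congr (_ * _).
by apply: mean_split; [exact: measurable_cube_at|exact: mu_box_lty].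
Qed.

Lemma far_sum_split M k :
  far_sum M g k = far_sum M (large_part g) k + far_sum M (small_part g) k.
Proof.
rewrite /far_sum -big_split/=; apply: eq_bigr => m _; rewrite -mulrDr; congr (_ * _).
by apply: mean_split; [exact: measurable_wide_shell|exact: wide_shell_lty].
Qed.

Lemma large_part_powR (r : R) y : 0 < r -> large_part g y `^ r <= g y `^ r.
Proof.
move=> r0; rewrite /large_part; case: ifP => // _.
by rewrite powR0 ?powR_ge0// gt_eqF.
Qed.

Lemma small_part_powR (r : R) y : 0 < r -> small_part g y `^ r <= g y `^ r.
Proof.
move=> r0; rewrite /small_part; case: ifP => // _.
by rewrite powR0 ?powR_ge0// gt_eqF.
Qed.

End split.

Section modular.
Context (R : realType) (n : nat).
Local Notation mu := (@lebesgue_Rn R n).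
Local Notation T := (Rn R n).
Local Notation c := (unit_volume R n).
Implicit Types (x y : 'rV[R]_n).

Variables (q : 'rV[R]_n -> R) (C0 Cinf qinf P : R).
Hypotheses (lhq : log_holder_real q C0 Cinf qinf) (q1 : forall x, 1 <= q x).
Hypotheses (mq : measurable_fun setT (q : T -> R)).
Hypotheses (P1 : 1 <= P) (qP : \forall x \ae mu, q x <= P).
Hypotheses (qinf1 : 1 <= qinf) (qinfP : qinf <= P).
Local Notation D := (expR (n.+1%:R * Cinf)).

Let decay_qinf x : `|qinf - q x| <= Cinf / ln (expR 1 + enorm x).
Proof. by rewrite distrC; exact: lhr_decay lhq x. Qed.

(** Above 1 the larger exponent P dominates; below 1 the exponent at infinity
    does, up to the error. *)
Lemma power_split_bound x t : q x <= P -> 0 <= t ->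
  t `^ q x <= t `^ P + (D * t `^ qinf + decay_error x).
Proof.
move=> xP t0; have e0 := decay_error_ge0 x.
have D0 : 0 <= D * t `^ qinf by rewrite mulr_ge0 ?expR_ge0 ?powR_ge0.
have [t1|t1] := leP 1 t.
  have H : t `^ q x <= t `^ P by apply: ler_powR.
  by lra.
have H := @decay_compare _ _ Cinf q (fun=> qinf) x t (q1 x) (lhr_decay lhq x).
have : 0 <= t <= 1 by rewrite t0 ltW.
by move=> /H; have := powR_ge0 t P; lra.
Qed.

Section one_function.
Variable g : T -> R.
Hypotheses (mg : measurable_fun setT g) (g0 : forall y, 0 <= g y).
Hypothesis gB : exists B, forall y, `|g y| <= B.
Hypothesis modg : (\int[mu]_y (g y `^ q y)%:E <= 1)%E.

Let mgq : measurable_fun setT (fun y : T => g y `^ q y).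
Proof. exact: measurable_variable_powR mg mq q1. Qed.

Let q0 x : 0 < q x. Proof. exact: lt_le_trans (q1 x). Qed.

Let cst1 (r : R) : 1 <= r -> forall x : T, 1 <= (fun=> r) x. Proof. by []. Qed.

Lemma modular_large : (\int[mu]_y (large_part g y `^ q y)%:E <= 1)%E.
Proof.
apply: le_trans modg; apply: (ge0_le_integral mu measurableT).
- by move=> y _; rewrite lee_fin powR_ge0.
- apply/measurable_EFinP.
  exact: (measurable_variable_powR (measurable_large_part mg) mq q1).
- exact/measurable_EFinP.
- by move=> y _; rewrite lee_fin large_part_powR.
Qed.

Lemma measurable_small_powR (r : R) : 1 <= r ->
  measurable_fun setT (fun y : T => small_part g y `^ r).
Proof.
move=> r1; exact: (measurable_variable_powR (measurable_small_part mg) (measurable_cst r) (cst1 r1)).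
Qed.

(** Below 1 a larger exponent gives a smaller power. *)
Lemma modular_small_top : (\int[mu]_y (small_part g y `^ P)%:E <= 1)%E.
Proof.
apply: le_trans modg; apply: (ae_ge0_le_integral measurableT).
- by move=> y _; rewrite lee_fin powR_ge0.
- by apply/measurable_EFinP; exact: measurable_small_powR.
- by move=> y _; rewrite lee_fin powR_ge0.
- exact/measurable_EFinP.
- have FF := @ae_filter_ringOfSetsType _ T R mu.
  apply: (@filterS _ _ FF _ _ _ qP) => y yP _; rewrite lee_fin.
  apply: le_trans (small_part_powR g y (q0 y)).
  have s0 := small_part_ge0 g0 y; have s1 := small_part_le1 g y.
  have [->|sn0] := eqVneq (small_part g y) 0.
    by rewrite powR0 ?powR_ge0// gt_eqF// (lt_le_trans ltr01 P1).
  have sp : 0 < small_part g y by rewrite lt_neqAle eq_sym sn0.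
  rewrite -(subrK (q y) P) pos_powRD// ler_piMl ?powR_ge0//.
  apply: (@le_trans _ _ (1 `^ (P - q y))); last by rewrite powR1.
  by rewrite ge0_ler_powR ?nnegrE ?subr_ge0.
Qed.

Lemma modular_small_inf (B : R) : (\int[mu]_x (decay_error x)%:E <= B%:E)%E ->
  (\int[mu]_y (small_part g y `^ qinf)%:E <= (D + B)%:E)%E.
Proof.
move=> HB.
have md : measurable_fun setT (fun y : T => (decay_error y)%:E).
  by apply/measurable_EFinP; exact: measurable_decay_error.
have mgq' : measurable_fun setT (fun y : T => (g y `^ q y)%:E) by exact/measurable_EFinP.
have mDq : measurable_fun setT (fun y : T => (D%:E * (g y `^ q y)%:E)%E).
  exact: measurable_funeM.
have D0 : (0 <= D%:E)%E by rewrite lee_fin expR_ge0.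
have gq0 (y : T) : (0 <= (g y `^ q y)%:E)%E by rewrite lee_fin powR_ge0.
have Dq0 (y : T) : (0 <= D%:E * (g y `^ q y)%:E)%E by exact: mule_ge0.
have d0 (y : T) : (0 <= (decay_error y)%:E)%E by rewrite lee_fin decay_error_ge0.
apply: (@le_trans _ _ (\int[mu]_y (D%:E * (g y `^ q y)%:E + (decay_error y)%:E))%E).
  apply: (ge0_le_integral mu measurableT).
  - by move=> y _; rewrite lee_fin powR_ge0.
  - by apply/measurable_EFinP; exact: measurable_small_powR.
  - exact: emeasurable_funD mDq md.
  - move=> y _; rewrite -EFinM -EFinD lee_fin.
    have s01 : 0 <= small_part g y <= 1.
      by rewrite small_part_ge0// small_part_le1.
    have := @decay_compare _ _ Cinf (fun=> qinf) q y (small_part g y) qinf1 (decay_qinf y) s01.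
    move=> /le_trans; apply; rewrite lerD2r ler_wpM2l ?expR_ge0//.
    exact: small_part_powR.
rewrite (ge0_integralD mu measurableT (fun y _ => Dq0 y) mDq (fun y _ => d0 y) md).
rewrite (ge0_integralZl mu measurableT mgq' (fun y _ => gq0 y) D0).
rewrite EFinD; apply: leeD => //.
by rewrite -[leRHS]mule1 lee_wpmul2l.
Qed.

End one_function.

End modular.

Section modular_hardy.
Context (R : realType) (n : nat).
Local Notation mu := (@lebesgue_Rn R n).
Local Notation T := (Rn R n).
Local Notation c := (unit_volume R n).
Implicit Types (x y : 'rV[R]_n).

Lemma hardy_combine (K L X a b r : R) : 1 <= r -> 0 < K -> 0 < L ->
  0 <= X -> 0 <= a -> 0 <= b -> X <= 2 * K * (a + b) ->
  (X / (4 * K * L)) `^ r <= (a / L) `^ r + (b / L) `^ r.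
Proof.
move=> r1 K0 L0 X0 a0 b0 H.
have KL : 0 < 4 * K * L by rewrite !mulr_gt0.
have mono u v : 0 <= u -> u <= v -> u `^ r <= v `^ r.
  move=> u0 uv; have v0 := le_trans u0 uv.
  by apply: ge0_ler_powR => //; lra.
have aux u v : 0 <= v -> u <= v -> X <= 2 * K * (u + v) -> X / (4 * K * L) <= v / L.
  move=> v0 uv HX; rewrite ler_pdivrMr//.
  have -> : v / L * (4 * K * L) = 4 * K * v by field; rewrite gt_eqF.
  by apply: (le_trans HX); nra.
have X1 : 0 <= X / (4 * K * L) by rewrite divr_ge0// ltW.
have [ab|/ltW ba] := leP a b.
  apply: (@le_trans _ _ ((b / L) `^ r)); last by rewrite lerDr powR_ge0.
  exact: mono (aux a b b0 ab H).
apply: (@le_trans _ _ ((a / L) `^ r)); last by rewrite lerDl powR_ge0.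
by apply: mono (aux b a a0 ba _) => //; rewrite addrC.
Qed.

Variables (q : 'rV[R]_n -> R) (C0 Cinf qinf P : R).
Hypotheses (n1 : (1 < n)%N) (c0 : 0 < c).
Hypotheses (lhq : log_holder_real q C0 Cinf qinf) (q1 : forall x, 1 <= q x).
Hypotheses (mq : measurable_fun setT (q : T -> R)).
Hypotheses (P1 : 1 <= P) (Pn : P < n%:R) (qP : \forall x \ae mu, q x <= P).
Hypotheses (qinf1 : 1 <= qinf) (qinfP : qinf <= P).
Local Notation D := (expR (n.+1%:R * Cinf)).

Let cst1 (r : R) : 1 <= r -> forall x : 'rV[R]_n, 1 <= (fun=> r) x. Proof. by []. Qed.

(** The large part of g is treated with the exponent q itself, the small part with
    the constant exponents P and qinf, which power_split_bound reassembles. *)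
Theorem modular_hardy : exists2 C : R, 0 < C & forall f g : T -> R,
  slope_bound f g -> continuous (f : 'rV[R]_n -> R) ->
  (exists J : int, forall y, ~ centered_cube J y -> f y = 0) ->
  (\int[mu]_y (g y `^ q y)%:E <= 1)%E ->
  (\int[mu]_x ((`|f x / enorm x| / C) `^ q x)%:E <= 1)%E.
Proof.
have [s s1 gain] := exists_gain P1 Pn.
have [Kp Kp0 HKp] := power_mean_variable lhq q1.
have [Be HBe] := @integral_decay_error R n.
set rho := (2 * s) `^ P in gain.
set V := volume_bound R n; set L := hardy_loss s; set K1 := 4 * step_const R n.
set hc := hardy_const n rho.
have L0 : 0 < L.
  have ss : s^-1 < 1 by rewrite invf_lt1// (lt_trans ltr01).
  by rewrite /L /hardy_loss mulr_gt0// invr_gt0 subr_gt0.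
have n0 : 0 < n%:R :> R by rewrite ltr0n ltnW.
have K10 : 0 < K1.
  by apply: mulr_gt0 => //; apply: divr_gt0 => //; rewrite !mulr_gt0 ?exprn_gt0.
have KL0 : 0 < 4 * K1 * L by do 2 apply: mulr_gt0 => //.
have hc0 : 0 <= hc by exact: hardy_const_ge0.
(* B bounds the integral of the majorant U; dividing by max 1 B inside the power
   divides the integral by at least as much, the exponents being at least 1 *)
pose B : R := (Kp * hc + (2 * V) `^ P * hc) +
  (D * ((2 * V) `^ qinf * (hc * (D + Be))) + Be).
have B1 : 0 < Num.max 1 B by rewrite lt_max ltr01.
exists (4 * K1 * L * Num.max 1 B); first exact: mulr_gt0.
move=> f g fg cf [J fJ] modg.
have mg := slope_mg fg; have gB := slope_bg fg; have g0 := slope_g0 fg.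
pose gl := large_part g; pose gs := small_part g.
have mgl : measurable_fun setT gl by exact: measurable_large_part.
have mgs : measurable_fun setT gs by exact: measurable_small_part.
have gl0 := large_part_ge0 g0 : forall y, 0 <= gl y.
have gs0 := small_part_ge0 g0 : forall y, 0 <= gs y.
have glB := large_part_bounded gB; have gsB := small_part_bounded g0.
pose pl (y : T) := gl y `^ q y.
pose pt (y : T) := gs y `^ P.
pose pi (y : T) := gs y `^ qinf.
have mpl : measurable_fun setT pl by exact: measurable_variable_powR mgl mq q1.
have mpt : measurable_fun setT pt by exact: measurable_small_powR.
have mpi : measurable_fun setT pi by exact: measurable_small_powR.
have ipl : (\int[mu]_y (pl y)%:E <= 1)%E := modular_large q1 mq mg modg.
have ipt : (\int[mu]_y (pt y)%:E <= 1)%E := modular_small_top q1 mq P1 qP mg g0 modg.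
have ipi : (\int[mu]_y (pi y)%:E <= (D + Be)%:E)%E.
  exact: (modular_small_inf lhq q1 mq qinf1 mg g0 modg HBe).
have oo1 (I : \bar R) : (I <= 1)%E -> (I < +oo)%E by move=> /le_lt_trans; apply; rewrite ltry.
have iploo := oo1 _ ipl; have iptoo := oo1 _ ipt.
have ipioo : (\int[mu]_y (pi y)%:E < +oo)%E by apply: le_lt_trans ipi _; rewrite ltry.
have pml := HKp gl mgl glB (large_part01 g) mpl ipl.
have pmt := power_mean_const P1 mgs gsB gs0 mpt.
have pmi := power_mean_const qinf1 mgs gsB gs0 mpi.
pose Hl := hardy_majorant (EFin \o pl) rho : T -> \bar R.
pose Ht := hardy_majorant (EFin \o pt) rho : T -> \bar R.
pose Hi := hardy_majorant (EFin \o pi) rho : T -> \bar R.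
have pos (h : T -> R) (r : T -> R) y : (0 <= (EFin \o (fun z : T => (h z `^ r z)%R)) y)%E.
  by rewrite lee_fin powR_ge0.
have Hl0 x : (0 <= Hl x)%E := hardy_majorant_ge0 (pos gl q) gain x.
have Ht0 x : (0 <= Ht x)%E := hardy_majorant_ge0 (pos gs (fun=> P)) gain x.
have Hi0 x : (0 <= Hi x)%E := hardy_majorant_ge0 (pos gs (fun=> qinf)) gain x.
have mEl : measurable_fun setT (EFin \o pl)
  by apply/measurable_EFinP; exact: mpl.
have mEt : measurable_fun setT (EFin \o pt)
  by apply/measurable_EFinP; exact: mpt.
have mEi : measurable_fun setT (EFin \o pi)
  by apply/measurable_EFinP; exact: mpi.
have mHl : measurable_fun setT Hl := measurable_hardy_majorant (pos gl q) gain.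
have mHt : measurable_fun setT Ht := measurable_hardy_majorant (pos gs (fun=> P)) gain.
have mHi : measurable_fun setT Hi := measurable_hardy_majorant (pos gs (fun=> qinf)) gain.
pose KV (r : R) := (2 * V) `^ r.
have KV0 r : 0 <= KV r by exact: powR_ge0.
have D0 : (0 <= D%:E)%E by rewrite lee_fin expR_ge0.
pose U1 x : \bar R := (Kp%:E * Hl x)%E.
pose U2 x : \bar R := ((KV P)%:E * Ht x)%E.
pose U3 x : \bar R := (D%:E * ((KV qinf)%:E * Hi x))%E.
pose U4 x : \bar R := (decay_error x)%:E.
have U10 x : (0 <= U1 x)%E by apply: mule_ge0 (Hl0 x); rewrite lee_fin.
have U20 x : (0 <= U2 x)%E by apply: mule_ge0 (Ht0 x); rewrite lee_fin.
have U30 x : (0 <= U3 x)%E by apply: (mule_ge0 D0); apply: mule_ge0 (Hi0 x); rewrite lee_fin.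
have U40 x : (0 <= U4 x)%E by rewrite lee_fin decay_error_ge0.
pose U x : \bar R := ((U1 x + U2 x) + (U3 x + U4 x))%E.
have U0 x : (0 <= U x)%E := adde_ge0 (adde_ge0 (U10 x) (U20 x)) (adde_ge0 (U30 x) (U40 x)).
pose Y x := (`|f x / enorm x| / (4 * K1 * L)) `^ q x.
have bound x : q x <= P -> ((Y x)%:E <= U x)%E.
  move=> xP; have e0 := decay_error_ge0 x.
  have q0 : 0 < q x by exact: lt_le_trans (q1 x).
  have [X0|X0] := eqVneq `|f x / enorm x| 0.
    by rewrite /Y X0 mul0r powR0// gt_eqF.
  have fx0 : f x / enorm x != 0 by rewrite -normr_eq0.
  have [fx en] : f x != 0 /\ enorm x != 0.
    by move: fx0; rewrite mulf_eq0 invr_eq0 negb_or => /andP[].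
  have en0 : 0 < enorm x by rewrite lt_neqAle eq_sym en enorm_ge0.
  have x0 : x != 0.
    apply/eqP => x0; move/eqP: en; apply; apply/eqP; rewrite eq_le enorm_ge0 andbT.
    by rewrite -(mulr0 n%:R); apply: enorm_le => // i; rewrite x0 mxE normr0.
  have kx := scaleP x0.
  (* an error of half the left-hand side can be absorbed *)
  have e2 : 0 < `|f x| / 2 by rewrite divr_gt0 ?normr_gt0.
  have [M HM] := pointwise_representation fg c0 n1 kx (cf x) fJ e2.
  set k := scale x in kx HM *.
  have sx : side R k <= enorm x by apply: enorm_out_centered_cube; exact: kx.2.
  set a := near_sum M gl k x + far_sum M gl k.
  set b := near_sum M gs k x + far_sum M gs k.
  have sum0 (h : T -> R) : (forall y, 0 <= h y) -> 0 <= near_sum M h k x + far_sum M h k.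
    by move=> h0; apply: addr_ge0; apply: sumr_ge0 => m _; apply: mulr_ge0;
       rewrite ?invr_ge0 ?exprn_ge0 ?mean_ge0.
  have a0 : 0 <= a := sum0 _ gl0.
  have b0 : 0 <= b := sum0 _ gs0.
  have gab : near_sum M g k x + far_sum M g k = a + b.
    by rewrite near_sum_split// far_sum_split// addrACA.
  have HX : `|f x / enorm x| <= 2 * K1 * (a + b).
    rewrite normrM normfV (ger0_norm (enorm_ge0 x)) ler_pdivrMr//.
    have ab0 : 0 <= a + b by exact: addr_ge0.
    have H1 : K1 * side R k * (a + b) <= K1 * enorm x * (a + b).
      by rewrite ler_wpM2r// ler_wpM2l// ltW.
    move: HM; rewrite gab -/K1 => HM.
    have -> : 2 * K1 * (a + b) * enorm x = 2 * (K1 * enorm x * (a + b)) by ring.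
    by lra.
  have xl : (((a / L) `^ q x)%:E <= Kp%:E * Hl x)%E.
    exact: (hardy_pointwise q1 Kp0 s1 gain gl0 mpl iploo pml M x0 xP).
  have xt : (((b / L) `^ P)%:E <= (KV P)%:E * Ht x)%E.
    exact: (hardy_pointwise (cst1 P1) (KV0 P) s1 gain gs0 mpt iptoo pmt M x0 (lexx P)).
  have xi : (((b / L) `^ qinf)%:E <= (KV qinf)%:E * Hi x)%E.
    exact: (hardy_pointwise (cst1 qinf1) (KV0 qinf) s1 gain gs0 mpi ipioo pmi M x0 qinfP).
  apply: (@le_trans _ _ (((a / L) `^ q x + (b / L) `^ P +
     (D * (b / L) `^ qinf + decay_error x))%:E)).
    rewrite lee_fin; apply: le_trans (hardy_combine (q1 x) K10 L0 _ a0 b0 HX) _ => //.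
    rewrite -addrA lerD2l; apply: (power_split_bound lhq q1 xP).
    by rewrite divr_ge0// ltW.
  rewrite !EFinD; apply: leeD; first exact: leeD xl xt.
  apply: leeD; last exact: lexx.
  by rewrite EFinM; apply: (lee_wpmul2l D0); exact: xi.
have mU1 : measurable_fun setT (U1 : T -> \bar R) := measurable_funeM Kp%:E mHl.
have mU2 : measurable_fun setT (U2 : T -> \bar R) := measurable_funeM (KV P)%:E mHt.
have mKi : measurable_fun setT (fun x : T => ((KV qinf)%:E * Hi x)%E) :=
  measurable_funeM (KV qinf)%:E mHi.
have mU3 : measurable_fun setT (U3 : T -> \bar R) := measurable_funeM D%:E mKi.
have mU4 : measurable_fun setT (U4 : T -> \bar R).
  by apply/measurable_EFinP; exact: measurable_decay_error.
have mU12 : measurable_fun setT (fun x : T => (U1 x + U2 x)%E) := emeasurable_funD mU1 mU2.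
have mU34 : measurable_fun setT (fun x : T => (U3 x + U4 x)%E) := emeasurable_funD mU3 mU4.
have mU : measurable_fun setT (U : T -> \bar R) := emeasurable_funD mU12 mU34.
have intU : (\int[mu]_x U x <= B%:E)%E.
  rewrite (ge0_integralD mu measurableT (fun x _ => adde_ge0 (U10 x) (U20 x)) mU12
    (fun x _ => adde_ge0 (U30 x) (U40 x)) mU34).
  rewrite (ge0_integralD mu measurableT (fun x _ => U10 x) mU1 (fun x _ => U20 x) mU2).
  rewrite (ge0_integralD mu measurableT (fun x _ => U30 x) mU3 (fun x _ => U40 x) mU4).
  have zl : (0 <= Kp%:E)%E by rewrite lee_fin.
  have zt : (0 <= (KV P)%:E)%E by rewrite lee_fin.
  have zi : (0 <= (KV qinf)%:E)%E by rewrite lee_fin.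
  have zh : (0 <= hc%:E)%E by rewrite lee_fin.
  rewrite /B EFinD; apply: leeD; rewrite EFinD; apply: leeD; last exact: HBe.
  - rewrite (ge0_integralZl mu measurableT mHl (fun x _ => Hl0 x) zl) EFinM.
    apply: (lee_wpmul2l zl); apply: (le_trans (integral_hardy_majorant mEl (pos gl q) gain iploo)).
    by apply: (le_trans (lee_wpmul2l zh ipl)); rewrite mule1.
  - rewrite (ge0_integralZl mu measurableT mHt (fun x _ => Ht0 x) zt) EFinM.
    apply: (lee_wpmul2l zt).
    apply: (le_trans (integral_hardy_majorant mEt (pos gs (fun=> P)) gain iptoo)).
    by apply: (le_trans (lee_wpmul2l zh ipt)); rewrite mule1.
  - have nn x (_ : setT x) : (0 <= (KV qinf)%:E * Hi x)%E :=
      mule_ge0 zi (Hi0 x).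
    rewrite (ge0_integralZl mu measurableT mKi nn D0) EFinM.
    apply: (lee_wpmul2l D0).
    rewrite (ge0_integralZl mu measurableT mHi (fun x _ => Hi0 x) zi) EFinM.
    apply: (lee_wpmul2l zi).
    apply: (le_trans (integral_hardy_majorant mEi (pos gs (fun=> qinf)) gain ipioo)).
    by rewrite EFinM; exact: (lee_wpmul2l zh ipi).
set B' := Num.max 1 B in B1 *.
have mfe : measurable_fun setT (fun x : T => `|f x / enorm x| / (4 * K1 * L)).
  apply: measurable_funM; last exact: measurable_cst.
  apply: (measurableT_comp (@normr_measurable R setT)).
  apply: measurable_funM; first exact: slope_mf fg.
  apply: measurable_inv_ge0 => [x|]; [exact: enorm_ge0|exact: measurable_enorm_id].
have mY : measurable_fun setT (fun x : T => (Y x)%:E).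
  by apply/measurable_EFinP; exact: (measurable_variable_powR mfe mq q1).
have Y0 (x : T) : (0 <= (Y x)%:E)%E by rewrite lee_fin powR_ge0.
have intY : (\int[mu]_x (Y x)%:E <= B%:E)%E.
  apply: le_trans intU.
  have FF := @ae_filter_ringOfSetsType _ T R mu.
  have ae : \forall x \ae mu, setT x -> ((Y x)%:E <= U x)%E.
    by apply: (@filterS _ _ FF _ _ _ qP) => x xP _; exact: bound.
  exact: (@ae_ge0_le_integral _ T R mu setT measurableT (fun x : T => (Y x)%:E) U
    (fun x _ => Y0 x) mY (fun x _ => U0 x) mU ae).
have Bi0 : (0 <= (B'^-1)%:E)%E by rewrite lee_fin invr_ge0 ltW.
have mBY : measurable_fun setT (fun x : T => ((B'^-1)%:E * (Y x)%:E)%E) :=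
  measurable_funeM (B'^-1)%:E mY.
have mLHS : measurable_fun setT
    (fun x : T => ((`|f x / enorm x| / (4 * K1 * L * B')) `^ q x)%:E).
  apply/measurable_EFinP; apply: (measurable_variable_powR _ mq q1).
  under eq_fun do rewrite invfM mulrA.
  by apply: measurable_funM mfe _; exact: measurable_cst.
apply: (@le_trans _ _ (\int[mu]_x ((B'^-1)%:E * (Y x)%:E))%E).
  apply: (ge0_le_integral mu measurableT _ mLHS mBY).
    by move=> x _; rewrite lee_fin powR_ge0.
  move=> x _; rewrite -EFinM lee_fin invfM mulrA mulrC.
  rewrite powRM ?invr_ge0 ?(ltW B1)//; last first.
    by apply: divr_ge0 => //; exact: ltW.
  rewrite ler_wpM2r ?powR_ge0//; apply: powR_le_self => //.
  rewrite invr_ge0 (ltW B1) invf_le1//=.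
  by rewrite /B' le_max lexx.
rewrite (ge0_integralZl mu measurableT mY (fun x _ => Y0 x) Bi0).
apply: (@le_trans _ _ ((B'^-1)%:E * B%:E)%E); first exact: (lee_wpmul2l Bi0 intY).
by rewrite -EFinM lee_fin mulrC ler_pdivrMr// mul1r /B' le_max lexx orbT.
Qed.

End modular_hardy.

(** * Smooth functions *)

Section smooth_slope.
Context (R : realType) (n : nat).
Local Notation T := (Rn R n).
Implicit Types (x v : 'rV[R]_n) (h f : 'rV[R]_n -> R) (i : 'I_n).

Let line_quotient h x v (s : R) :
  (fun t : R => t^-1 *: (((fun s => h (x + s *: v)) \o shift s) (t *: (1 : R)) -
                        h (x + s *: v))) =
  (fun t : R => t^-1 *: ((h \o shift (x + s *: v)) (t *: v) - h (x + s *: v))).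
Proof.
apply/funext => t /=; congr (_ *: (h _ - _)).
by rewrite [t *: 1]mulr1 scalerDl addrCA.
Qed.

Lemma is_derive_line h x v (s : R) : derivable h (x + s *: v) v ->
  is_derive s (1 : R) (fun s : R => h (x + s *: v)) ('D_v h (x + s *: v)).
Proof.
move=> dh; apply: DeriveDef.
  by rewrite /derivable line_quotient; exact: dh.
by rewrite /derive line_quotient.
Qed.

Lemma line_mean_value h x v (t : R) : (forall y, derivable h y v) -> 0 <= t ->
  exists2 s : R, 0 <= s <= t & h (x + t *: v) - h x = t * 'D_v h (x + s *: v).
Proof.
move=> dh t0.
have H s := is_derive_line (dh (x + s *: v)).
have [s st E] := @MVT_segment R (fun s : R => h (x + s *: v))
  (fun s => 'D_v h (x + s *: v)) 0 t t0 (fun s _ => H s)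
  (derivable_within_continuous (fun s _ => @ex_derive _ _ _ _ _ _ _ (H s))).
exists s; first by move: st; rewrite in_itv.
by move: E; rewrite scale0r addr0 subr0 mulrC.
Qed.

Lemma partial_vanish h (K : set 'rV[R]_n) i : closed K ->
  (forall x, ~ K x -> h x = 0) -> forall x, ~ K x -> partial i h x = 0.
Proof.
move=> cK hK x Kx; rewrite /partial (@near_eq_derive _ _ _ h (cst 0)).
  exact: derive_cst.
have : nbhs x (~` K) by apply: open_nbhs_nbhs; split => //; exact: closed_openC.
by apply: filterS => y /hK.
Qed.

Lemma compact_support_bounded h (K : set 'rV[R]_n) : compact K -> continuous h ->
  (forall x, ~ K x -> h x = 0) -> exists2 B : R, 0 <= B & forall x, `|h x| <= B.
Proof.
move=> cK ch hK.
have /compact_bounded[M [_ HM]] : compact (h @` K).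
  by apply: continuous_compact => //; exact: continuous_subspaceT.
exists (Num.max 0 (M + 1)); first by rewrite le_max lexx.
move=> x; have [Kx|Kx] := pselect (K x); last by rewrite hK// normr0 le_max lexx.
have := HM (M + 1); rewrite ltrDl => /(_ ltr01 (h x)) H.
by rewrite le_max H ?orbT//; exists x.
Qed.

Lemma compact_sub_centered_cube (K : set 'rV[R]_n) : compact K -> exists J : int, K `<=` centered_cube J.
Proof.
move=> /compact_bounded[M [_ HM]].
pose m := (Num.trunc (M + 1)).+1; exists m%:Z => x Kx; apply/centered_cubeP => i.
have xM : `|x| <= M + 1 by apply: HM => //; rewrite ltrDl.
have xi : `|x ord0 i| <= `|x|.
  by rewrite [leRHS]mx_normrE; apply: (le_bigmax _ (fun ij => `|x ij.1 ij.2|) (ord0, i)).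
have Mm : M + 1 < side R m%:Z.
  apply: (lt_trans (truncnS_gt _)); rewrite side_nat -natrX ltr_nat.
  exact: ltn_expl.
have := le_trans xi xM; rewrite ler_norml => /andP[? ?]; apply/andP; split; lra.
Qed.

Variable f : 'rV[R]_n -> R.
Hypothesis sf : smooth_compactly_supported f.

Let K : set 'rV[R]_n := closure [set x | f x != 0].

Let cK : compact K. Proof. exact: sf.2. Qed.

Let fK x : ~ K x -> f x = 0.
Proof.
move=> Kx; apply/eqP; apply: contrapT => /negP fx; apply: Kx; exact: subset_closure.
Qed.

Let closedK : closed K. Proof. exact: closed_closure. Qed.

Lemma smooth_continuous : continuous f.
Proof. exact: (sf.1 [::]).1. Qed.

Lemma smooth_centered_cube : exists J : int, forall y, ~ centered_cube J y -> f y = 0.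
Proof.
have [J KJ] := compact_sub_centered_cube cK; exists J => y Jy; apply: fK => /KJ; exact: Jy.
Qed.

(** The mean value theorem along a coordinate line, applied to f and then to its
    partial derivative; the bounded second derivative gives the quadratic term. *)
Lemma smooth_slope_bound : slope_bound (f : T -> R) (fun x : T => enorm (gradient f x)).
Proof.
have cp i : continuous (partial i f) := (sf.1 [:: i]).1.
have pK i x : ~ K x -> partial i f x = 0 by exact: partial_vanish.
have BP i := compact_support_bounded cK (cp i) (pK i).
have c2 i : continuous (partial i (partial i f)) := (sf.1 [:: i; i]).1.
have p2K i x : ~ K x -> partial i (partial i f) x = 0 by move=> Kx; exact: (partial_vanish i closedK (pK i) Kx).
have B2 i := compact_support_bounded cK (c2 i) (p2K i).
have gi x i : gradient f x ord0 i = partial i f x by rewrite mxE.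
split.
- exact: continuous_measurable_Rn smooth_continuous.
- apply: measurable_enorm => i.
  by under eq_fun do rewrite gi; exact: continuous_measurable_Rn (cp i).
- by have [B _ HB] := compact_support_bounded cK smooth_continuous fK; exists B.
- pose B := \sum_(i < n) s2val (cid2 (BP i)).
  have B0 i : 0 <= s2val (cid2 (BP i)) by case: (cid2 (BP i)).
  have HB i x : `|partial i f x| <= s2val (cid2 (BP i)) by case: (cid2 (BP i)).
  exists (n%:R * B) => x; rewrite ger0_norm ?enorm_ge0//; apply: enorm_le.
    by apply: sumr_ge0 => i _.
  move=> i; rewrite gi; apply: (le_trans (HB i x)).
  by rewrite /B (bigD1 i)//= lerDl sumr_ge0.
- by move=> x; exact: enorm_ge0.
- pose M := \sum_(i < n) s2val (cid2 (B2 i)).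
  have M0 i : 0 <= s2val (cid2 (B2 i)) by case: (cid2 (B2 i)).
  have HM i x : `|partial i (partial i f) x| <= s2val (cid2 (B2 i)) by case: (cid2 (B2 i)).
  have M00 : 0 <= M by apply: sumr_ge0 => i _.
  exists M; split => // x i t t0.
  have [s /andP[s0 st] ->] := line_mean_value x (fun y => (sf.1 [::]).2 i y) t0.
  have [r _ E] := line_mean_value x (fun y => (sf.1 [:: i]).2 i y) s0.
  have H2 : `|partial i f (x + s *: unitv R i) - partial i f x| <= M * t.
    rewrite [X in `|X|]E normrM (ger0_norm s0) mulrC; apply: ler_pM => //.
    apply: (le_trans (HM i _)).
    by rewrite /M (bigD1 i)//= lerDl sumr_ge0.
  have H1 : `|partial i f x| <= enorm (gradient f x).
    by rewrite -gi; exact: enorm_coord.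
  rewrite normrM (ger0_norm t0) [M * _]mulrC expr2 -mulrA -mulrDr.
  apply: ler_wpM2l => //; rewrite mulrC -/(unitv R i).
  have := ler_normD (partial i f (x + s *: unitv R i) - partial i f x) (partial i f x).
  by rewrite subrK /partial -/(unitv R i); lra.
Qed.

End smooth_slope.

(** * The inequality in the Luxemburg norm *)

Section final.
Context (R : realType) (n : nat).
Local Notation mu := (@lebesgue_Rn R n).
Local Notation T := (Rn R n).
Local Notation c := (unit_volume R n).
Implicit Types (x y : 'rV[R]_n).

Lemma slope_bound_scale (f g : T -> R) (l : R) : 0 < l -> slope_bound f g ->
  slope_bound (fun x => f x / l) (fun x => g x / l).
Proof.
move=> l0 [mf mg [Bf HBf] [Bg HBg] g0 [M [M0 HM]]].
have li0 : 0 <= l^-1 by rewrite invr_ge0 ltW.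
split.
- exact: measurable_funM mf (measurable_cst _).
- exact: measurable_funM mg (measurable_cst _).
- by exists (Bf / l) => x; rewrite normrM (ger0_norm li0) ler_wpM2r.
- by exists (Bg / l) => x; rewrite normrM (ger0_norm li0) ler_wpM2r.
- by move=> x; exact: mulr_ge0.
- exists (M / l); split; first exact: mulr_ge0.
  move=> x i t t0; rewrite -mulrBl normrM (ger0_norm li0).
  have -> : t * (g x / l) + M / l * t ^+ 2 = (t * g x + M * t ^+ 2) / l by ring.
  by rewrite ler_wpM2r// HM.
Qed.

Lemma ae_of_null_unit_cube : c = 0 -> forall Q : T -> Prop, \forall x \ae mu, Q x.
Proof.
move=> c0 Q; apply: (@negligibleS _ _ _ mu (\bigcup_(m : nat) (centered_cube m%:Z : set T))).
  by move=> x _; have [m xm] := centered_cube_exists x; exists m.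
apply: negligible_bigcup => m; exists (centered_cube m%:Z); split => //.
  exact: measurable_centered_cube.
by rewrite [LHS](mu_centered_cube R n m) c0 mul0r.
Qed.

Section exponent_at_infinity.
Variables (q : 'rV[R]_n -> R) (C0 Cinf qinf : R).
Hypotheses (lhq : log_holder_real q C0 Cinf qinf).

Lemma close_to_qinf (d : R) : 0 < d ->
  exists k : int, forall x, ~ centered_cube k x -> `|q x - qinf| <= d.
Proof.
move=> d0; pose B := expR (Cinf / d).
pose m := (Num.trunc B).+1; exists m%:Z => x mx.
have Bx : B <= expR 1 + enorm x.
  apply: (@le_trans _ _ (enorm x)); last by rewrite lerDr expR_ge0.
  apply: le_trans (enorm_out_centered_cube mx); rewrite side_nat -natrX.
  apply: ltW; apply: (lt_trans (truncnS_gt B)); rewrite ltr_nat; exact: ltn_expl.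
apply: (le_trans (lhr_decay lhq x)).
have L1 := ln_e_ge1 x; rewrite ler_pdivrMr; last by lra.
rewrite mulrC -ler_pdivrMr// -[leLHS]expRK ler_ln ?posrE ?expR_gt0//.
by rewrite (lt_le_trans _ Bx)// expR_gt0.
Qed.

Lemma qinf_ge1 : (0 < n)%N -> (forall x, 1 <= q x) -> 1 <= qinf.
Proof.
move=> n0 q1; apply/ler_addgt0Pr => e e0.
have [k Hk] := close_to_qinf e0.
pose x : 'rV[R]_n := const_mx (side R k + 1).
have kx : ~ centered_cube k x.
  by move=> /centered_cubeP/(_ (Ordinal n0)); rewrite mxE => /andP[_]; lra.
by have := Hk x kx; have := q1 x; rewrite ler_norml => ? /andP[? ?]; lra.
Qed.

(** The exponent exceeds P on a null set only, and far out there are sets of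
    positive measure. *)
Lemma qinf_le (P : R) : (0 < n)%N -> 0 < c -> (\forall x \ae mu, q x <= P) -> qinf <= P.
Proof.
move=> n0 c0 [N [mN N0 qN]]; apply/ler_addgt0Pr => e e0.
have [k Hk] := close_to_qinf e0.
pose z : 'rV[int]_n := const_mx 2.
have [x Qx xP] : exists2 x, cube k z x & q x <= P.
  apply: contrapT => H.
  have QN : cube k z `<=` N.
    by move=> x Qx; apply: qN => xP; apply: H; exists x.
  have : (mu (cube k z) <= mu N)%E.
    by apply: le_measure; rewrite ?inE//; exact: measurable_box.
  rewrite [X in (_ <= X)%E]N0 /cube mu_boxE vol_cube lee_fin leNgt.
  by rewrite mulr_gt0// exprn_gt0// side_gt0.
have kx : ~ centered_cube k x.
  move=> /centered_cubeP/(_ (Ordinal n0)); have := Qx (Ordinal n0).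
  by rewrite /= !mxE => /andP[? ?] /andP[? ?]; lra.
by have := Hk x kx; rewrite ler_norml => /andP[? ?]; lra.
Qed.

End exponent_at_infinity.

Lemma vLnorm_le (p : 'rV[R]_n -> \bar R) (f g : 'rV[R]_n -> R) (C : R) : 0 < C ->
  (forall l : R, 0 < l ->
    (\int[mu]_x ((`|g x| / l) `^ fine (p x))%:E <= 1)%E ->
    (\int[mu]_x ((`|f x| / (C * l)) `^ fine (p x))%:E <= 1)%E) ->
  (vLnorm p f <= C%:E * vLnorm p g)%E.
Proof.
move=> C0 H; rewrite -lee_pdivrMl//.
apply: le_ereal_inf_tmp => _ [l [l0 Hl] <-].
rewrite lee_pdivrMl// -EFinM; apply: ereal_inf_lbound.
exists (C * l); last by [].
by split; [exact: mulr_gt0|exact: (H l l0 Hl)].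
Qed.

End final.

Theorem theorem1p1 (R : realType) (n : nat) (p : 'rV[R]_n -> \bar R) :
  exponent p -> log_holder p ->
  (1 < exponent_inf p)%E ->
  (exponent_inf p <= exponent_sup p)%E ->
  (exponent_sup p < n%:R%:E)%E ->
  exists C : R, 0 < C /\
    forall f : 'rV[R]_n -> R, smooth_compactly_supported f ->
      (vLnorm p (fun x => (f x / enorm x)%R)
        <= C%:E * vLnorm p (fun x => enorm (gradient f x)))%E.
Proof.
move=> [mp p1] lhp inf1 infsup supn.
have [pE [C0 [Cinf [qinf lhq]]]] := log_holder_fine lhp.
set q := fine \o p in lhq.
have sup1 := lt_le_trans inf1 infsup.
pose P := fine (exponent_sup p).
have supE : exponent_sup p = P%:E.
  rewrite fineK// fin_numE -ltNye -ltey (lt_trans _ sup1) ?ltNyr//.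
  by rewrite (lt_trans supn) ?ltry.
have P1 : 1 < P by rewrite -lte_fin -supE.
have Pn : P < n%:R by rewrite -lte_fin -supE.
have n1 : (1 < n)%N by rewrite -(ltr_nat R) (lt_trans P1 Pn).
have n0 : (0 < n)%N by exact: ltnW.
(* a null space would have -oo as its essential supremum *)
have c0 : 0 < unit_volume R n.
  rewrite lt_neqAle vol_ge0 andbT eq_sym; apply/eqP => /ae_of_null_unit_cube null.
  have : (exponent_sup p <= -oo)%E by apply/ess_supP; exact: null.
  by rewrite supE leeNy_eq.
have q1 x : 1 <= q x by rewrite -lee_fin -pE.
have mq : measurable_fun setT (q : Rn R n -> R).
  by apply: (measurableT_comp _ mp); exact: fine_measurable.
have qP : \forall x \ae @lebesgue_Rn R n, q x <= P.
  have FF := @ae_filter_ringOfSetsType _ (Rn R n) R (@lebesgue_Rn R n).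
  have H := @ess_sup_ge _ (Rn R n) R (@lebesgue_Rn R n) p.
  by apply: (@filterS _ _ FF _ _ _ H) => x; rewrite -lee_fin -pE -supE.
have [C Cpos HC] := modular_hardy n1 c0 lhq q1 mq (ltW P1) Pn qP
  (qinf_ge1 lhq n0 q1) (qinf_le lhq n0 c0 qP).
exists C; split; first exact: Cpos.
move=> f sf; apply: (vLnorm_le Cpos) => l l0 Hl.
have fg := slope_bound_scale l0 (smooth_slope_bound sf).
have cf : continuous (fun x : 'rV[R]_n => f x / l).
  move=> x; have fx := @smooth_continuous R n f sf x.
  exact: (continuous_comp fx (@mulrr_continuous R l^-1 (f x))).
have cs : exists J : int, forall y : 'rV[R]_n, ~ centered_cube J y -> f y / l = 0.
  by have [J HJ] := smooth_centered_cube sf; exists J => y /HJ ->; rewrite mul0r.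
have modg : (\int[@lebesgue_Rn R n]_y ((enorm (gradient f y) / l) `^ q y)%:E <= 1)%E.
  by move: Hl; under eq_integral => x _ do rewrite ger0_norm ?enorm_ge0//.
have := HC _ _ fg cf cs modg.
rewrite (_ : (fun x : Rn R n => ((`|f x / l / enorm x| / C) `^ q x)%:E) =
  (fun x : Rn R n => ((`|f x / enorm x| / (C * l)) `^ fine (p x))%:E))//.
apply/funext => x; congr (_ `^ _)%:E.
by rewrite mulrAC normrM (gtr0_norm (x := l^-1)) ?invr_gt0// invfM mulrAC mulrA.
Qed.
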